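(* Let $X$ be a CB process with branching mechanism $\Phi$ given by $(\alpha,\beta,\pi)$, with natural filtration $(\mathcal{F}_t)$, and let $x>0$. Assume that $\alpha>0$ and that the Lévy measure $\pi$ is unbounded, i.e. has unbounded support. Then for any $t\in[0,\infty)$, any $\mathcal{F}_t$-measurable bounded random variable $F$ and any $\lambda\in(0,\infty)$, as $r\to\infty$, $$\mathbf{E}_x\left[Fe^{-\lambda X_t}\,\Big|\,\sup_{s\in(0,\infty)}\Delta X_s>r\right]\to\frac1x\,\mathbf{E}_x\left[X_tFe^{-\lambda X_t}\right].$$
   Context: A branching mechanism is a function $\Phi(\lambda)=\alpha\lambda+\beta\lambda^2+\int_{(0,\infty)}(e^{-\lambda\theta}-1+\lambda\theta)\,\pi(d\theta)$, $\lambda\ge0$, with $\alpha\in\mathbb{R}$, $\beta\ge0$ and $\pi$ a $\sigma$-finite measure on $(0,\infty)$ (the Lévy measure) with $\int_{(0,\infty)}(\theta\wedge\theta^2)\,\pi(d\theta)<\infty$; the case $\Phi\equiv0$ is excluded. A CB process with branching mechanism $\Phi$ is an rcll $[0,\infty)$-valued Markov process $X=(X_t)_{t\ge0}$ such that, writing $\mathbf{P}_x$ for its law when $X_0=x$ and $\mathbf{E}_x$ for the expectation, $\mathbf{E}_x[e^{-\lambda X_t}]=e^{-xv_t(\lambda)}$ for $\lambda\ge0$, where $v_t(\lambda)$ is the unique locally bounded nonnegative solution of $v_t(\lambda)=\lambda-\int_0^t\Phi(v_s(\lambda))\,ds$. $\Delta X_s=X_s-X_{s-}$ for $s>0$. 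*)

(* Defs.v *)
From HB Require Import structures.
From mathcomp Require Import all_boot all_order all_algebra.
From mathcomp Require Import all_classical all_reals all_analysis.
From mathcomp Require Import measurable_realfun.

Set Implicit Arguments.
Unset Strict Implicit.
Unset Printing Implicit Defensive.

Import Order.TTheory GRing.Theory Num.Theory.
Import numFieldNormedType.Exports.

Local Open Scope classical_set_scope.
Local Open Scope ring_scope.

(* A measure on (0, +oo) is represented by a measure on the line that gives
   mass 0 to ]-oo, 0]. *)
Record levy_measure (R : realType) (nu : {measure set R -> \bar R}) : Prop := {
  levy_carrier : nu (`]-oo, 0]%classic : set R) = 0%E ;
  levy_sigma_finite : sigma_finite (`]0, +oo[%classic : set R) nu ;
  levy_integrable :
    (\int[nu]_(theta in `]0%R, +oo[) (Num.min theta (theta ^+ 2))%:E < +oo)%E }.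

Definition branching_function (R : realType) (alpha beta : R)
    (nu : {measure set R -> \bar R}) (lambda : R) : R :=
  alpha * lambda + beta * lambda ^+ 2
  + \int[nu]_(theta in `]0, +oo[)
      (expR (- (lambda * theta)) - 1 + lambda * theta).

Record branching_mechanism (R : realType) (alpha beta : R)
    (nu : {measure set R -> \bar R}) : Prop := {
  branching_beta_ge0 : 0 <= beta ;
  branching_levy : levy_measure nu ;
  branching_neq0 :
    exists2 lambda : R, 0 <= lambda & branching_function alpha beta nu lambda != 0 }.

(* The closed support. *)
Definition measure_support (R : realType)
    (nu : {measure set R -> \bar R}) : set R :=
  [set theta | forall U : set R, open U -> U theta -> (0 < nu U)%E].

(* Measurability of s |-> u s is part of the meaning of the integral equation:
   the library's integral is defined, with junk values, for any integrand. *)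
Record cumulant_solution (R : realType) (Phi : R -> R) (lambda : R)
    (u : R -> R) : Prop := {
  cumulant_measurable : measurable_fun (`[0, +oo[%classic : set R) u ;
  cumulant_ge0 : forall t : R, 0 <= t -> 0 <= u t ;
  cumulant_locally_bounded : forall t : R, 0 <= t ->
    exists M : R, forall s : R, 0 <= s <= t -> u s <= M ;
  cumulant_eq : forall t : R, 0 <= t ->
    u t = lambda - \int[lebesgue_measure]_(s in `[0, t]) Phi (u s) }.

(* A process is indexed by R; only the times t >= 0 are meaningful, and all the
   definitions below ignore the values at negative times.  Likewise the family
   of laws P is indexed by R and only starting points x >= 0 matter. *)

Definition history (R : realType) d (T : measurableType d) (X : R -> T -> R)
    (t : R) : set (set T) :=
  \bigcup_(s in `[0, t]) preimage_set_system setT (X s) measurable.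

Definition natural_filtration (R : realType) d (T : measurableType d)
    (X : R -> T -> R) (t : R) : set (set T) := <<s history X t >>.

Definition rcll (R : realType) (f : R -> R) : Prop :=
  (forall t : R, 0 <= t -> f u @[u --> t^'+] --> f t) /\
  (forall t : R, 0 < t -> cvg (f u @[u --> t^'-])).

Definition jump (R : realType) (f : R -> R) (s : R) : R :=
  f s - lim (f u @[u --> s^'-]).

Record cb_process (R : realType) (Phi : R -> R) d (T : measurableType d)
    (X : R -> T -> R) (P : R -> probability T R) : Prop := {
  cb_measurable : forall t : R, 0 <= t -> measurable_fun setT (X t) ;
  cb_ge0 : forall (t : R) w, 0 <= t -> 0 <= X t w ;
  cb_rcll : forall w, rcll (X ^~ w) ;
  cb_start : forall x : R, 0 <= x -> P x [set w | X 0 w = x] = 1%E ;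
  cb_kernel : forall (t : R) (B : set R), 0 <= t -> measurable B ->
    measurable_fun (`[0, +oo[%classic : set R) (fun y => P y (X t @^-1` B)) ;
  (* P_x (X_{t+s} \in B | F_t) = P_{X_t} (X_s \in B) *)
  cb_markov : forall (x s t : R) (A : set T) (B : set R),
    0 <= x -> 0 <= s -> 0 <= t -> natural_filtration X t A -> measurable B ->
    P x (A `&` X (t + s) @^-1` B)
    = (\int[P x]_(w in A) P (X t w) (X s @^-1` B))%E ;
  cb_laplace : exists2 v : R -> R -> R,
    forall lambda : R, 0 <= lambda -> cumulant_solution Phi lambda (v ^~ lambda)
    & forall x t lambda : R, 0 <= x -> 0 <= t -> 0 <= lambda ->
      ('E_(P x)[fun w => expR (- (lambda * X t w))]
       = (expR (- (x * v t lambda)))%:E)%E }.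

(* The supremum is taken in \bar R, so that it is +oo on unbounded sets of
   jumps. *)
Definition sup_jump (R : realType) (f : R -> R) : \bar R :=
  ereal_sup [set (jump f s)%:E | s in `]0, +oo[].

Definition expectation_given (R : realType) d (T : measurableType d)
    (P : probability T R) (Y : T -> R) (A : set T) : R :=
  fine 'E_P[(Y \* \1_A)%R]%E / fine (P A).

(* Main.v *)
Require Import Defs.
From HB Require Import structures.
From mathcomp Require Import all_boot all_order all_algebra.
From mathcomp Require Import all_classical all_reals all_analysis.
From mathcomp Require Import measurable_realfun ring lra.

Set Implicit Arguments.
Unset Strict Implicit.
Unset Printing Implicit Defensive.

Import Order.TTheory GRing.Theory Num.Theory.
Import numFieldNormedType.Exports.

Local Open Scope classical_set_scope.
Local Open Scope ring_scope.

(* Let g_r(y) be the probability that a path started from y ever jumps by more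
   than r.  The sum of independent copies started from y and y' is a copy started
   from y + y', and the two summands almost surely have no common jump time, so
   1 - g_r is multiplicative and g_r(y) = 1 - exp(- c_r y).  As alpha > 0, the
   function exp(- X / r) satisfies a maximal inequality, whence c_r = O(1/r).
   Moreover c_r > 0: as pi has unbounded support, there is a polynomial p with
   p(1) = 0 and p(q) <= 1_{q < e^{-(r+1)}} on which the generator is positive, so
   the increments X_{s+h} - X_s, inserted as p(exp(X_s - X_{s+h})), exceed r + 1
   at a positive rate; discretize time and let h tend to 0.
   With G = F exp(- lambda X_t), the Markov property at t gives the contribution
   E_x[G (1 - exp(- c_r X_t))] ~ c_r E_x[G X_t] of the jumps after t, while
   g_r(x) ~ c_r x.  The jumps before t are negligible: such a jump at time s brings
   X above r, and E_y[exp(- lambda X_{t-s})] = exp(- y v_{t-s}(lambda)) is at most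
   exp(- kappa r) for y > r, with kappa > 0 the minimum of v(lambda) on [0, t]. *)

(** * Bounded measurable functions and their integrals *)

Section bounded_measurable.
Context {R : realType} {d} {T : measurableType d}.
Implicit Types f g : T -> R.

(** The hypotheses reach the law only through Laplace transforms and the Markov property at fixed
    times. Every statement on jumps is therefore proved for the largest increment [smax] on an
    equidistant grid and passed to the limit of fine meshes by dominated convergence; a continuous
    [ramp] stands for the indicator of a large increment, which would not survive the limit. The
    same limit yields the measurability of the jump events. Two independent copies have no common
    jump time because one path can be frozen: its jump times are countable, and the other path
    almost surely does not jump at a given time. Polynomials in exp(X_s - X_{s+h}) are used because
    their conditional means are explicit: the n-th power has mean exp(- X_s (v_h(n) - n)), which is
    1 + h X_s Phi(n) up to order h^2 for bounded X_s. No formula for c_r in terms of pi enters: c_r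
    cancels in the quotient, so its positivity and its order suffice, and multiplicativity replaces
    a description of the jumps by a Poisson measure. *)

Definition bmeas f := measurable_fun setT f /\ exists M : R, forall w, `|f w| <= M.

Lemma bmeas_cst (c : R) : bmeas (fun=> c).
Proof. by split; [exact: measurable_cst|exists `|c|]. Qed.

Lemma bmeasD f g : bmeas f -> bmeas g -> bmeas (fun w => f w + g w).
Proof.
move=> [mf [M fM]] [mg [N gN]]; split; first exact: measurable_funD.
by exists (M + N) => w; rewrite (le_trans (ler_normD _ _))// lerD.
Qed.

Lemma bmeasM f g : bmeas f -> bmeas g -> bmeas (fun w => f w * g w).
Proof.
move=> [mf [M fM]] [mg [N gN]]; split; first exact: measurable_funM.
by exists (M * N) => w; rewrite normrM ler_pM.
Qed.

Lemma bmeasN f : bmeas f -> bmeas (fun w => - f w).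
Proof.
move=> [mf [M fM]]; split; first exact: measurable_funN.
by exists M => w; rewrite normrN.
Qed.

Lemma bmeasB f g : bmeas f -> bmeas g -> bmeas (fun w => f w - g w).
Proof. by move=> bf bg; apply: bmeasD => //; exact: bmeasN. Qed.

Lemma bmeasZ (c : R) f : bmeas f -> bmeas (fun w => c * f w).
Proof. by move=> bf; apply: bmeasM => //; exact: bmeas_cst. Qed.

Lemma bmeas_sum (F : nat -> T -> R) n :
  (forall i, bmeas (F i)) -> bmeas (fun w => \sum_(i < n) F i w).
Proof.
move=> bF; elim: n => [|n IH].
  by under eq_fun do rewrite big_ord0; exact: bmeas_cst.
by under eq_fun do rewrite big_ord_recr/=; exact: bmeasD.
Qed.

Lemma bmeas_prod (F : nat -> T -> R) n :
  (forall i, bmeas (F i)) -> bmeas (fun w => \prod_(i < n) F i w).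
Proof.
move=> bF; elim: n => [|n IH].
  by under eq_fun do rewrite big_ord0; exact: bmeas_cst.
by under eq_fun do rewrite big_ord_recr/=; exact: bmeasM.
Qed.

Lemma bmeasX f n : bmeas f -> bmeas (fun w => f w ^+ n).
Proof.
move=> bf; elim: n => [|n IH].
  by under eq_fun do rewrite expr0; exact: bmeas_cst.
by under eq_fun do rewrite exprS; exact: bmeasM.
Qed.

Lemma bmeas_indic (A : set T) : measurable A -> bmeas (\1_A : T -> R).
Proof.
move=> mA; split; first exact: measurable_indic.
by exists 1 => w; rewrite indicE; case: (_ \in _); rewrite ?normr0 ?normr1.
Qed.

Lemma bmeas_itv (a b : R) f : measurable_fun setT f ->
  (forall w, a <= f w <= b) -> bmeas f.
Proof.
move=> mf fab; split=> //; exists (`|a| + `|b|) => w.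
have /andP[fa fb] := fab w.
rewrite ler_norml; apply/andP; split.
  by apply: le_trans fa; rewrite lerNl -[X in X + _]normrN (le_trans (ler_norm _))// lerDl.
by apply: (le_trans fb); rewrite (le_trans (ler_norm b))// lerDr.
Qed.

End bounded_measurable.

Lemma bmeas_comp {R : realType} {d d'} {T : measurableType d}
    {T' : measurableType d'} (f : T' -> R) (Z : T -> T') :
  bmeas f -> measurable_fun setT Z -> bmeas (fun w => f (Z w)).
Proof.
move=> [mf [M fM]] mZ; split; first exact: measurableT_comp.
by exists M => w.
Qed.

(* A uniform approximation by step functions reduces a linear, uniformly closed
   property of bounded measurable functions to the case of indicators. *)
Lemma bmeas_ind {R : realType} {d} {T : measurableType d} (C : (T -> R) -> Prop) :
  (forall A, measurable A -> C \1_A) ->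
  (forall (c : R) f, bmeas f -> C f -> C (fun w => c * f w)) ->
  (forall f g, bmeas f -> bmeas g -> C f -> C g -> C (fun w => f w + g w)) ->
  (forall f, bmeas f ->
     (forall e : R, 0 < e -> exists g, [/\ bmeas g, C g & forall w, `|f w - g w| <= e]) ->
     C f) ->
  forall f, bmeas f -> C f.
Proof.
move=> C1 CZ CD Ccl f bf.
have CT : C (fun=> 1).
  suff -> : (fun=> 1) = \1_[set: T] :> (T -> R) by exact: C1.
  by apply/funext => w; rewrite indicE in_setT.
have C0 (c : R) : C (fun=> c).
  have -> : (fun _ : T => c) = (fun w : T => c * 1) by apply/funext => w; rewrite mulr1.
  by apply: (CZ _ (fun=> 1)) => //; exact: bmeas_cst.
have step (g : T -> R) : measurable_fun setT g -> (forall w, 0 <= g w < 1) -> C g.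
  move=> mg g01.
  have bg : bmeas g by apply: (@bmeas_itv _ _ _ 0 1) => // w; case/andP: (g01 w) => -> /ltW.
  apply: Ccl => // e e0.
  have [n ne] : exists n, n.+1%:R^-1 < e.
    exists (Num.bound e^-1); rewrite invf_plt ?posrE//.
    apply: (lt_le_trans (archi_boundP _)); first by rewrite invr_ge0 ltW.
    by rewrite ler_nat.
  set N : R := n.+1%:R in ne.
  have N0 : 0 < N by rewrite /N ltr0n.
  pose A k := [set w | k.+1%:R / N <= g w].
  have mA k : measurable (A k).
    rewrite -[X in measurable X]setTI.
    by rewrite (_ : A k = g @^-1` `[k.+1%:R / N, +oo[);
      [exact: mg|apply/seteqP; split=> w /=; rewrite in_itv/= andbT].
  (* At [w] the sum counts the indices with (k + 1) / N <= g w, which is the integer part of N g(w);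
     as g < 1, the indices up to [n] suffice. *)
  exists (fun w => N^-1 * \sum_(k < n.+1) \1_(A k) w); split.
  - by apply: bmeasZ; apply: (bmeas_sum (F := fun k => \1_(A k))) => i; exact: bmeas_indic.
  - apply: CZ.
      by apply: (bmeas_sum (F := fun k => \1_(A k))) => i; exact: bmeas_indic.
    elim: n.+1 => [|m IH].
      by rewrite (_ : (fun _ => _) = fun=> 0)//; apply/funext => w; rewrite big_ord0.
    rewrite (_ : (fun _ => _) = fun w => \sum_(k < m) \1_(A k) w + \1_(A m) w).
      apply: CD => //; [|exact: bmeas_indic|exact: C1].
      by apply: (bmeas_sum (F := fun k => \1_(A k))) => i; exact: bmeas_indic.
    by apply/funext => w; rewrite big_ord_recr.
  move=> w; have /andP[g0 g1] := g01 w.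
  have Ng0 : 0 <= N * g w by rewrite mulr_ge0// ltW.
  have /andP[m1 m2] := Num.Theory.truncn_itv Ng0.
  set m := Num.truncn _ in m1 m2.
  have mn : (m <= n.+1)%N.
    rewrite -(ler_nat R) (le_trans m1)// -[leRHS]mulr1 ler_pM2l//; exact: ltW.
  have -> : \sum_(k < n.+1) \1_(A k) w = m%:R :> R.
    transitivity (\sum_(k < n.+1) (if (k < m)%N then 1 else 0) : R).
      apply: eq_bigr => k _; rewrite indicE; case: ifPn => km.
        rewrite mem_set//= /A/= ler_pdivrMr// mulrC (le_trans _ m1)// ler_nat//.
      rewrite memNset//= /A/=; apply/negP.
      rewrite -ltNge ltr_pdivlMr// mulrC (lt_le_trans m2)// ler_nat.
      by rewrite -leqNgt in km.
    by rewrite -big_mkcond/= -(big_ord_widen n.+1 (fun=> 1) mn) sumr_const card_ord.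
  rewrite (_ : _ - _ = N^-1 * (N * g w - m%:R)); last first.
    by rewrite mulrBr mulKf ?gt_eqF.
  rewrite normrM ger0_norm ?invr_ge0 ?(ltW N0)// ger0_norm ?subr_ge0//.
  rewrite (le_trans _ (ltW ne))// -[leRHS]mulr1 ler_pM2l ?invr_gt0//.
  by rewrite lerBlDl natr1 ltW.
have [mf [M fM]] := bf.
have M0 (w : T) : 0 <= M by exact: le_trans (fM w).
(* The + 1 makes the rescaled function strictly less than 1, as [step] requires, and keeps [K]
   positive. *)
pose K : R := 2 * `|M| + 1.
have K0 : 0 < K by rewrite /K ltr_pwDr// mulr_ge0.
pose g (w : T) : R := K^-1 * (f w + `|M|).
have fg : f = (fun w => K * g w + (- `|M|)).
  by apply/funext => w; rewrite /g mulrA divff ?gt_eqF// mul1r addrK.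
have mg : measurable_fun setT g.
  by apply: measurable_funM => //; apply: measurable_funD.
have g01 w : 0 <= g w < 1.
  have MM := ger0_norm (M0 w).
  have := fM w; rewrite ler_norml => /andP[f1 f2].
  apply/andP; split.
    by rewrite /g mulr_ge0 ?invr_ge0 ?(ltW K0)// MM -lerBlDr sub0r.
  rewrite /g mulrC ltr_pdivrMr// mul1r /K MM; clear M0; lra.
have bg : bmeas g by apply: (@bmeas_itv _ _ _ 0 1) => // w; case/andP: (g01 w) => -> /ltW.
rewrite fg; apply: CD => //; [exact: bmeasZ|exact: bmeas_cst|].
by apply: CZ => //; exact: step.
Qed.

Section bounded_integral.
Context {R : realType} {d} {T : measurableType d} (mu : probability T R).
Implicit Types f g : T -> R.

Lemma bmeas_integrable f : bmeas f -> mu.-integrable setT (EFin \o f).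
Proof.
move=> [mf [M fM]]; apply: measurable_bounded_integrable => //.
  by rewrite -ge0_fin_numE// fin_num_measure.
by exists M; split; [exact: num_real|move=> x Mx w _; exact: le_trans (ltW Mx)].
Qed.

Lemma bintegralE f : bmeas f -> (\int[mu]_w (f w)%:E)%E = (\int[mu]_w f w)%:E.
Proof. by move=> bf; rewrite fineK//; exact: integrable_fin_num (bmeas_integrable bf). Qed.

Lemma bintegralD f g : bmeas f -> bmeas g ->
  \int[mu]_w (f w + g w) = \int[mu]_w f w + \int[mu]_w g w.
Proof. by move=> bf bg; rewrite RintegralD//; exact: bmeas_integrable. Qed.

Lemma bintegralB f g : bmeas f -> bmeas g ->
  \int[mu]_w (f w - g w) = \int[mu]_w f w - \int[mu]_w g w.
Proof. by move=> bf bg; rewrite RintegralB//; exact: bmeas_integrable. Qed.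

Lemma bintegralZ (c : R) f : bmeas f -> \int[mu]_w (c * f w) = c * \int[mu]_w f w.
Proof. by move=> bf; rewrite RintegralZl//; exact: bmeas_integrable. Qed.

Lemma bintegral_cst (c : R) : \int[mu]_w c = c.
Proof. by rewrite Rintegral_cst//= probability_setT/= mulr1. Qed.

Lemma bintegral_sum (F : nat -> T -> R) n : (forall i, bmeas (F i)) ->
  \int[mu]_w (\sum_(i < n) F i w) = \sum_(i < n) \int[mu]_w F i w.
Proof.
move=> bF; elim: n => [|n IH].
  by rewrite big_ord0; under eq_Rintegral do rewrite big_ord0; rewrite bintegral_cst.
under eq_Rintegral do rewrite big_ord_recr/=.
by rewrite bintegralD ?IH ?big_ord_recr//; exact: bmeas_sum.
Qed.

Lemma le_bintegral f g : bmeas f -> bmeas g -> (forall w, f w <= g w) ->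
  \int[mu]_w f w <= \int[mu]_w g w.
Proof. by move=> bf bg fg; apply: le_Rintegral => //; exact: bmeas_integrable. Qed.

Lemma bintegral_bound f (M : R) : bmeas f -> (forall w, `|f w| <= M) ->
  `|\int[mu]_w f w| <= M.
Proof.
move=> bf fM; have fI w : - M <= f w <= M by rewrite -ler_norml.
rewrite ler_norml; apply/andP; split.
  rewrite -[leLHS]bintegral_cst; apply: le_bintegral => // [|w]; first exact: bmeas_cst.
  by case/andP: (fI w).
rewrite -[leRHS]bintegral_cst; apply: le_bintegral => // [|w]; first exact: bmeas_cst.
by case/andP: (fI w).
Qed.

Lemma bintegral_indic (A : set T) : measurable A -> \int[mu]_w \1_A w = fine (mu A).
Proof. by move=> mA; rewrite /Rintegral integral_indic// setIT. Qed.

Lemma bintegral_cvg (F : nat -> T -> R) f (M : R) :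
  (forall n, bmeas (F n)) -> (forall n w, `|F n w| <= M) -> bmeas f ->
  (forall w, F n w @[n --> \oo] --> f w) ->
  \int[mu]_w F n w @[n --> \oo] --> \int[mu]_w f w.
Proof.
move=> bF FM bf Ff.
have [] // := @dominated_convergence _ _ _ mu setT measurableT
   (fun n => EFin \o F n) (EFin \o f) (cst M%:E).
- by move=> n; apply/measurable_EFinP; case: (bF n).
- by apply/measurable_EFinP; case: bf.
- by apply/aeW => w _; apply: cvg_EFin; [apply: nearW|exact: Ff].
- by apply: (@bmeas_integrable (fun=> M)); exact: bmeas_cst.
- by apply/aeW => w n _; rewrite lee_fin.
move=> _ _ /=; rewrite bintegralE// => cv.
have : fine (\int[mu]_w (F n w)%:E)%E @[n --> \oo] --> \int[mu]_w f w.
  by apply: fine_cvg; exact: cv.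
by [].
Qed.

Lemma bintegral_ae0 f (N : set T) : bmeas f -> measurable N -> mu N = 0%E ->
  (forall w, ~ N w -> f w = 0) -> \int[mu]_w f w = 0.
Proof.
move=> bf mN N0 fN; rewrite /Rintegral.
rewrite (ae_eq_integral (cst 0%E))//; first by rewrite integral0.
  by apply/measurable_EFinP; case: bf.
by exists N; split=> // w /= H; apply: contrapT => /fN fw; apply: H => _; rewrite fw.
Qed.

End bounded_integral.

Lemma eq_bmeas {R : realType} {d} {T : measurableType d} (f g : T -> R) :
  f =1 g -> bmeas f -> bmeas g.
Proof. by move=> /funext ->. Qed.

Section bounded_fubini.
Context {R : realType} {d1 d2} {T1 : measurableType d1} {T2 : measurableType d2}.
Variables (P : probability T1 R) (Q : probability T2 R).
Local Open Scope ereal_scope.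

Lemma bmeas_section1 (f : T1 * T2 -> R) x : bmeas f -> bmeas (fun y => f (x, y)).
Proof.
by move=> bf; apply: (bmeas_comp (Z := fun y => (x, y)) bf); exact: measurable_pair1.
Qed.

Lemma bmeas_section2 (f : T1 * T2 -> R) y : bmeas f -> bmeas (fun x => f (x, y)).
Proof.
by move=> bf; apply: (bmeas_comp (Z := fun x => (x, y)) bf); exact: measurable_pair2.
Qed.

Lemma bfubini1 (f : T1 * T2 -> R) : bmeas f ->
  (\int[P \x Q]_z f z = \int[P]_x \int[Q]_y f (x, y))%R.
Proof.
move=> bf; rewrite {1}/Rintegral.
have intf := bmeas_integrable (P \x Q)%E bf.
rewrite -(integral12_prod_meas1 intf); congr fine.
by apply: eq_integral => x _; rewrite /fubini_F/= bintegralE//; exact: bmeas_section1.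
Qed.

Lemma bfubini2 (f : T1 * T2 -> R) : bmeas f ->
  (\int[P \x Q]_z f z = \int[Q]_y \int[P]_x f (x, y))%R.
Proof.
move=> bf; rewrite {1}/Rintegral.
have intf := bmeas_integrable (P \x Q)%E bf.
rewrite -(integral21_prod_meas1 intf); congr fine.
by apply: eq_integral => x _; rewrite /fubini_G/= bintegralE//; exact: bmeas_section2.
Qed.

End bounded_fubini.

(** * Functionals determined by Laplace transforms *)

Lemma cvg_harmonic_bound {R : realType} (u : nat -> R) (l C : R) :
  (forall n, `|u n - l| <= C * n.+1%:R^-1) -> u n @[n --> \oo] --> l.
Proof.
move=> uC; apply/cvgrPdist_le => e e0.
have h : C * harmonic n @[n --> \oo] --> (C * 0 : R) by apply: cvgMr; exact: cvg_harmonic.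
move: h; rewrite mulr0 => /cvgrPdist_le/(_ _ e0); apply: filterS => n.
rewrite sub0r normrN distrC => h; apply: (le_trans (uC n)).
exact: le_trans (ler_norm _) h.
Qed.

(** Functional form of Dynkin's theorem. The sets with indicator in [C] form a lambda-system because
    a disjoint union is a bounded limit of finite sums of indicators; uniform approximation then
    reaches every bounded function, a uniform limit being also a bounded one. *)
Lemma monotone_class {R : realType} {d} {T : measurableType d}
    (G : set (set T)) (C : (T -> R) -> Prop) :
  @measurable _ T = <<s G >> -> setI_closed G ->
  C (fun=> 1) -> (forall A, G A -> C \1_A) ->
  (forall (c : R) f, bmeas f -> C f -> C (fun w => c * f w)) ->
  (forall f g, bmeas f -> bmeas g -> C f -> C g -> C (fun w => f w + g w)) ->
  (forall (F : nat -> T -> R) f (M : R), (forall n, bmeas (F n)) ->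
     (forall n, C (F n)) -> (forall n w, `|F n w| <= M) -> bmeas f ->
     (forall w, F n w @[n --> \oo] --> f w) -> C f) ->
  forall f, bmeas f -> C f.
Proof.
move=> mG GI C1 CG CZ CD Clim.
have Csum (F : nat -> T -> R) n : (forall i, bmeas (F i)) -> (forall i, C (F i)) ->
    C (fun w => \sum_(i < n) F i w).
  move=> bF CF; elim: n => [|n IH].
    under eq_fun do rewrite big_ord0.
    have := CZ 0 _ (bmeas_cst 1) C1; congr C; apply/funext => w; exact: mul0r.
  by under eq_fun do rewrite big_ord_recr/=; apply: CD => //; exact: bmeas_sum.
have Cind A : measurable A -> C \1_A.
  rewrite mG; move: A; apply: (dynkin_induction mG) => //.
  - by suff -> : \1_[set: T] = (fun=> 1) :> (T -> R) by []; apply/funext => w; rewrite indicT.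
  - move=> A mA CA.
    have -> : \1_(~` A) = (fun w => 1 + (-1) * \1_A w) :> (T -> R).
      by apply/funext => w; rewrite !indicE in_setC mulN1r; case: (w \in A);
        rewrite ?subrr ?subr0.
    by apply: CD => //; [exact: bmeas_cst|apply: bmeasZ; exact: bmeas_indic|
      apply: CZ => //; exact: bmeas_indic].
  - move=> F mF tF CF.
    pose s n w : R := \sum_(i < n) \1_(F i) w.
    have sE n w : s n w = \1_(\big[setU/set0]_(i < n) F i) w.
      elim: n => [|n IH]; first by rewrite /s !big_ord0 indic0.
      rewrite /s !big_ord_recr/= -/(s n w) IH !indicE in_setU.
      case: (boolP (w \in F n)) => [Fn|]; last by rewrite orbF addr0.
      have [|] := boolP (w \in \big[setU/set0]_(i < n) F i); last by rewrite orbT add0r.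
      move=> /set_mem; rewrite -bigcup_mkord => -[i /= im Fi].
      move/trivIsetP : tF => /(_ i n Logic.I Logic.I); rewrite lt_eqF//.
      move=> /(_ isT) /seteqP[h _]; exfalso.
      by apply: (h w); split=> //; exact: set_mem.
    apply: (Clim s _ 1).
    + by move=> n; apply: (bmeas_sum (F := fun i => \1_(F i))) => i; exact: bmeas_indic.
    + by move=> n; apply: (Csum (fun i => \1_(F i))) => // i; exact: bmeas_indic.
    + by move=> n w; rewrite sE indicE; case: (_ \in _); rewrite ?normr0 ?normr1.
    + by apply: bmeas_indic; exact: bigcupT_measurable.
    + move=> w; have [[k _ Fk]|nF] := pselect ((\bigcup_k F k) w).
        rewrite indicE mem_set; last by exists k.
        apply: (@cvg_near_cst _ _ _ _ _ (@eventually_filter)); exists k.+1 => // n /= kn.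
        rewrite sE indicE mem_set//.
        by rewrite -bigcup_mkord; exists k.
      rewrite indicE memNset//; apply: (@cvg_near_cst _ _ _ _ _ (@eventually_filter)).
      apply: nearW => n; rewrite sE indicE memNset// -bigcup_mkord => -[k _ Fk].
      by apply: nF; exists k.
apply: bmeas_ind => // f bf H.
have He n : exists g, [/\ bmeas g, C g & forall w, `|f w - g w| <= n.+1%:R^-1].
  by apply: H; rewrite invr_gt0.
have [F HF] := choice He.
have [_ [M fM]] := bf.
apply: (Clim F f (M + 1)) => //.
- by move=> n; have [] := HF n.
- by move=> n; have [] := HF n.
- move=> n w; have [_ _ /(_ w) h] := HF n.
  rewrite -[F n w](subrK (f w)) addrC (le_trans (ler_normD _ _))// lerD//.
  by rewrite distrC (le_trans h)// invf_le1// ler1n.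
- move=> w; apply: (@cvg_harmonic_bound _ _ _ 1) => n; rewrite mul1r distrC.
  by have [_ _ /(_ w)] := HF n.
Qed.

(** Integration against a finite signed measure, in axiomatic form: linearity and bounded
    convergence are all that the monotone class argument uses, and weights of any sign are covered
    without building the measure. *)
Record bfunctional {R : realType} {d} {S : measurableType d} (L : (S -> R) -> R) : Prop := {
  bfunZ : forall (c : R) f, bmeas f -> L (fun s => c * f s) = c * L f ;
  bfunD : forall f g, bmeas f -> bmeas g -> L (fun s => f s + g s) = L f + L g ;
  bfun_cvg : forall (F : nat -> S -> R) f (M : R), (forall n, bmeas (F n)) ->
    (forall n s, `|F n s| <= M) -> bmeas f ->
    (forall s, F n s @[n --> \oo] --> f s) -> L (F n) @[n --> \oo] --> L f }.

Lemma bfunctional_ext {R : realType} {d} {S : measurableType d} (G : set (set S))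
    (L L' : (S -> R) -> R) :
  @measurable _ S = <<s G >> -> setI_closed G ->
  bfunctional L -> bfunctional L' -> L (fun=> 1) = L' (fun=> 1) ->
  (forall A, G A -> L \1_A = L' \1_A) -> forall f, bmeas f -> L f = L' f.
Proof.
move=> mG GI bL bL' E1 EG; apply: (monotone_class mG GI) => //.
- by move=> c f bf E; rewrite (bfunZ bL)// (bfunZ bL')// E.
- by move=> f g bf bg Ef Eg; rewrite (bfunD bL)// (bfunD bL')// Ef Eg.
move=> F f M bF EF FM bf Ff.
apply: (cvg_unique _ (bfun_cvg bL bF FM bf Ff)); first exact: Rhausdorff.
rewrite (_ : (fun n => L (F n)) = (fun n => L' (F n))); last exact/funext.
exact: (bfun_cvg bL' bF FM bf Ff).
Qed.

(** A measurable family of such functionals, not increasing the sup norm, so that it can be composed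
    with an integral. *)
Record bkernel {R : realType} {d d'} {S : measurableType d} {S' : measurableType d'}
    (K : (S -> R) -> S' -> R) : Prop := {
  bkerZ : forall (c : R) f s', bmeas f -> K (fun s => c * f s) s' = c * K f s' ;
  bkerD : forall f g s', bmeas f -> bmeas g ->
    K (fun s => f s + g s) s' = K f s' + K g s' ;
  bker_bmeas : forall f, bmeas f -> bmeas (K f) ;
  bker_bound : forall f (M : R) s', bmeas f -> (forall s, `|f s| <= M) -> `|K f s'| <= M ;
  bker_cvg : forall (F : nat -> S -> R) f (M : R) s', (forall n, bmeas (F n)) ->
    (forall n s, `|F n s| <= M) -> bmeas f ->
    (forall s, F n s @[n --> \oo] --> f s) -> K (F n) s' @[n --> \oo] --> K f s' }.

(** The Dirac kernel. With it [bfunctional_integral] treats the integral of f(Z) in the same way as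
    that of a transition kernel taken at Z. *)
Lemma bkernel_id {R : realType} {d} {S : measurableType d} : bkernel (@id (S -> R)).
Proof. by split. Qed.

(** Measurability in the parameter need only be checked on a pi-system, since it survives linear
    combinations and pointwise limits. *)
Lemma bkernel_prob {R : realType} {d d' d''} {S : measurableType d}
    {S' : measurableType d'} {T : measurableType d''} (G : set (set S))
    (q : S' -> probability T R) (Y : T -> S) :
  @measurable _ S = <<s G >> -> setI_closed G -> measurable_fun setT Y ->
  (forall A, G A -> measurable_fun setT (fun s' => \int[q s']_w \1_A (Y w))) ->
  bkernel (fun f s' => \int[q s']_w f (Y w)).
Proof.
move=> mG GI mY Gq; have bY f : bmeas f -> bmeas (f \o Y) by move=> bf; exact: bmeas_comp.
have B f (M : R) s' : bmeas f -> (forall s, `|f s| <= M) -> `|\int[q s']_w f (Y w)| <= M.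
  by move=> bf fM; apply: bintegral_bound => //; exact: bY.
have CV (F : nat -> S -> R) f (M : R) s' : (forall n, bmeas (F n)) ->
    (forall n s, `|F n s| <= M) -> bmeas f ->
    (forall s, F n s @[n --> \oo] --> f s) ->
    \int[q s']_w F n (Y w) @[n --> \oo] --> \int[q s']_w f (Y w).
  move=> bF FM bf Ff; apply: (bintegral_cvg (M := M)) => // [n|]; exact: bY.
split=> //.
- by move=> c f s' bf; rewrite bintegralZ//; exact: bY.
- by move=> f g s' bf bg; rewrite bintegralD//; exact: bY.
move=> f bf; split; last by have [_ [M fM]] := bf; exists M => s'; exact: B.
move: f bf; apply: (monotone_class mG GI) => //.
- by under eq_fun do rewrite bintegral_cst; exact: measurable_cst.
- move=> c f bf mf; rewrite (_ : (fun _ => _) = (fun s' => c * \int[q s']_w f (Y w))).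
    exact: measurable_funM.
  by apply/funext => s'; rewrite bintegralZ//; exact: bY.
- move=> f g bf bg mf mg.
  rewrite (_ : (fun _ => _) = (fun s' => \int[q s']_w f (Y w) + \int[q s']_w g (Y w))).
    exact: measurable_funD.
  by apply/funext => s'; rewrite bintegralD//; exact: bY.
move=> F f M bF mF FM bf Ff.
apply: (measurable_fun_cvg (h := fun n s' => \int[q s']_w F n (Y w))) => // s' _.
exact: CV.
Qed.

Lemma bfunctional_integral {R : realType} {d d' d''} {T : measurableType d}
    {S : measurableType d'} {S' : measurableType d''} (mu : probability T R)
    (W : T -> R) (Z : T -> S') (K : (S -> R) -> S' -> R) :
  bkernel K -> bmeas W -> measurable_fun setT Z ->
  bfunctional (fun f => \int[mu]_w (W w * K f (Z w))).
Proof.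
move=> bK bW mZ.
have bc f : bmeas f -> bmeas (fun w => W w * K f (Z w)).
  by move=> bf; apply: bmeasM => //; apply: bmeas_comp => //; exact: bker_bmeas.
split=> [c f bf|f g bf bg|F f M bF FM bf Ff].
- under eq_Rintegral do rewrite (bkerZ bK)// mulrCA.
  by rewrite bintegralZ//; exact: bc.
- under eq_Rintegral do rewrite (bkerD bK)// mulrDr.
  by rewrite bintegralD//; exact: bc.
have [_ [N WN]] := bW.
apply: (bintegral_cvg (M := N * M)) => [n|n w||w]; [exact: bc| |exact: bc|].
  by rewrite normrM ler_pM//; exact: (bker_bound bK).
by apply: cvgMr; exact: (bker_cvg bK).
Qed.

Lemma expR_ge_sqr {R : realType} (x : R) : 0 <= x -> x ^+ 2 / 4 <= expR x.
Proof.
move=> x0; have -> : x = x / 2 + x / 2 by rewrite -splitr.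
rewrite expRD -expr2; have -> : (x / 2 + x / 2) ^+ 2 / 4 = (x / 2) ^+ 2 by field.
rewrite lerXn2r ?nnegrE ?divr_ge0 ?expR_ge0//.
by rewrite (le_trans _ (expR_ge1Dx _))// lerDr.
Qed.

(* (1 - e^{-nz})^N with N about n e^{na} separates z > a from z <= a. *)
Lemma ray_approx {R : realType} (a z : R) : 0 <= a -> 0 <= z ->
  (1 - expR (- (n.+1%:R * z))) ^+ (Num.truncn (n.+1%:R * expR (n.+1%:R * a)))
    @[n --> \oo] --> (\1_(`]a, +oo[ : set R) z : R).
Proof.
move=> a0 z0; have [az|za] := ltP a z.
  rewrite indicE mem_set/=; last by rewrite in_itv/= az.
  have c0 : 0 < z - a by rewrite subr_gt0.
  apply: (@cvg_harmonic_bound _ _ _ (4 / (z - a) ^+ 2)) => n.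
  set m : R := n.+1%:R; set N := Num.truncn _.
  have m0 : 0 < m by rewrite /m ltr0n.
  have e1 : expR (- (m * z)) <= 1 by rewrite -expR0 ler_expR oppr_le0 mulr_ge0// ltW.
  have h0 : 0 <= 1 - expR (- (m * z)) by rewrite subr_ge0.
  have h1 : 1 - expR (- (m * z)) <= 1 by rewrite gerBl expR_ge0.
  rewrite ler0_norm; last by rewrite subr_le0 exprn_ile1.
  rewrite opprB.
  (* Bernoulli's inequality. As N <= m e^{ma}, the defect is at most m e^{-mc} with c = z - a, and
     e^{mc} >= (mc)^2 / 4 makes it a multiple of 1 / m. *)
  have bern k : 1 - (1 - expR (- (m * z))) ^+ k <= k%:R * expR (- (m * z)).
    elim: k => [|k IH]; first by rewrite expr0 subrr mul0r.
    rewrite exprS mulrBl mul1r -natr1 mulrDl mul1r.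
    rewrite opprB addrA addrAC lerD// ler_piMr ?expR_ge0//.
    exact: exprn_ile1.
  apply: (le_trans (bern N)).
  have Nle : N%:R <= m * expR (m * a).
    by rewrite truncn_le mulr_ge0 ?expR_ge0// ltW.
  apply: (@le_trans _ _ (m * expR (m * a) * expR (- (m * z)))).
    by rewrite ler_wpM2r ?expR_ge0.
  set c := z - a in c0 *; have := expR_ge_sqr (mulr_ge0 (ltW m0) (ltW c0)).
  have -> : m * expR (m * a) * expR (- (m * z)) = m / expR (m * c).
    by rewrite -mulrA -expRD -expRN; congr (_ * expR _); rewrite /c; ring.
  rewrite ler_pdivrMr// [leRHS]mulrC => key.
  rewrite ler_pdivrMr ?expR_gt0//.
  have -> : 4 / c ^+ 2 / m * expR (m * c) = 4 * expR (m * c) / (c ^+ 2 * m).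
    by field; rewrite !gt_eqF.
  rewrite ler_pdivlMr ?mulr_gt0 ?exprn_gt0// (le_trans _ key)//.
  by rewrite le_eqVlt; apply/orP; left; apply/eqP; ring.
rewrite indicE memNset/=; last by rewrite in_itv/= andbT; apply/negP; rewrite -leNgt.
apply: (@cvg_harmonic_bound _ _ _ 1) => n; rewrite subr0 mul1r.
set m : R := n.+1%:R; set N := Num.truncn _.
have m0 : 0 < m by rewrite /m ltr0n.
have e1 : expR (- (m * z)) <= 1 by rewrite -expR0 ler_expR oppr_le0 mulr_ge0// ltW.
have h0 : 0 <= 1 - expR (- (m * z)) by rewrite subr_ge0.
rewrite ger0_norm ?exprn_ge0//.
(* This is 1 - y <= e^{-y} with y = e^{-ma}. The N-th power is at most e^{-N y}, and N y >= m - 1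
   because N + 1 > m e^{ma} and y <= 1; hence it is at most 1 / m. *)
have h : 1 - expR (- (m * z)) <= expR (- expR (- (m * a))).
  apply: (le_trans _ (expR_ge1Dx _)); rewrite lerD2l lerN2 ler_expR lerN2.
  by rewrite ler_pM2l.
apply: (le_trans (lerXn2r N _ _ h)); rewrite ?nnegrE ?expR_ge0//.
rewrite -expRM_natl mulrN [leLHS]expRN lef_pV2 ?posrE ?expR_gt0//.
have Nge : m * expR (m * a) < N.+1%:R.
  exact: truncnS_gt.
have H : m - 1 <= N%:R * expR (- (m * a)).
  have e2 : expR (- (m * a)) <= 1 by rewrite -expR0 ler_expR oppr_le0 mulr_ge0// ltW.
  rewrite lerBlDr; apply: (@le_trans _ _ (N.+1%:R * expR (- (m * a)))).
    rewrite -ler_pdivrMr ?expR_gt0// expRN invrK; exact: ltW.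
  by rewrite -natr1 mulrDl mul1r lerD2l.
apply: (le_trans _ (expR_ge1Dx _)); rewrite -lerBlDl; exact: H.
Qed.

Lemma bmeas_exp_max {R : realType} (lambda : R) : 0 <= lambda ->
  bmeas (fun z : R => expR (- (lambda * Num.max z 0))).
Proof.
move=> l0; apply: (@bmeas_itv _ _ _ 0 1).
  apply: measurableT_comp => //; apply: measurable_funN.
  apply: measurable_funM => //; apply: measurable_maxr => //; exact: measurable_cst.
by move=> z; rewrite expR_ge0 -expR0 ler_expR oppr_le0 mulr_ge0// le_max lexx orbT.
Qed.

(** Expanding one factor of (1 - e^{-cz})^k at a time, the functionals agree on e^{-bz} (1 -
    e^{-cz})^k, and [ray_approx] recovers half-lines from these. The test functions use max(z, 0) to
    stay bounded on the whole line; the two extensionality hypotheses say that both functionals live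
    on the half-line. *)
Lemma laplace_unique {R : realType} (L L' : (R -> R) -> R) :
  bfunctional L -> bfunctional L' ->
  (forall f g : R -> R, bmeas f -> bmeas g ->
     (forall z, 0 <= z -> f z = g z) -> L f = L g) ->
  (forall f g : R -> R, bmeas f -> bmeas g ->
     (forall z, 0 <= z -> f z = g z) -> L' f = L' g) ->
  (forall lambda : R, 0 <= lambda -> L (fun z => expR (- (lambda * Num.max z 0))) =
                                L' (fun z => expR (- (lambda * Num.max z 0)))) ->
  forall f, bmeas f -> L f = L' f.
Proof.
move=> bL bL' eL eL' HL.
have pm (z : R) : 0 <= Num.max z 0 by rewrite le_max lexx orbT.
pose p (c b : R) k (z : R) : R :=
  expR (- (b * Num.max z 0)) * (1 - expR (- (c * Num.max z 0))) ^+ k.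
have bp c b k : 0 <= c -> 0 <= b -> bmeas (p c b k).
  move=> c0 b0; apply: bmeasM; first exact: bmeas_exp_max.
  by apply: bmeasX; apply: bmeasB; [exact: bmeas_cst|exact: bmeas_exp_max].
have HP c b k : 0 <= c -> 0 <= b -> L (p c b k) = L' (p c b k).
  move=> c0; elim: k b => [|k IH] b b0.
    have -> : p c b 0%N = (fun z => expR (- (b * Num.max z 0))).
      by apply/funext => z; rewrite /p expr0 mulr1.
    exact: HL.
  have -> : p c b k.+1 = (fun z => p c b k z + (-1) * p c (b + c) k z).
    by apply/funext => z; rewrite /p mulrDl opprD expRD exprS; ring.
  have bcb := bp c (b + c) k c0 (addr_ge0 b0 c0).
  have bN : bmeas (fun z => -1 * p c (b + c) k z) by exact: bmeasZ.
  rewrite (bfunD bL (bp c b k c0 b0) bN) (bfunD bL' (bp c b k c0 b0) bN).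
  by rewrite (bfunZ bL)// (bfunZ bL')// !IH// addr_ge0.
have E1 : L (fun=> 1) = L' (fun=> 1).
  have := HP 0 0 0%N (lexx _) (lexx _); congr (L _ = L' _);
    by apply/funext => z; rewrite /p expr0 mulr1 mul0r oppr0 expR0.
apply: (@bfunctional_ext R _ R (@RGenOInfty.G R)) => //.
- exact: RGenOInfty.measurableE.
- move=> _ _ [a ->] [b ->]; exists (Num.max a b); apply/seteqP; split=> z /=;
    rewrite !in_itv/= !andbT gt_max; first by move=> [-> ->].
  by move/andP.
move=> _ [a ->]; have bI : bmeas (\1_`]a, +oo[%classic : R -> R) by exact: bmeas_indic.
have [a0|a0] := ltP a 0.
  have I1 (z : R) : 0 <= z -> \1_`]a, +oo[%classic z = 1 :> R.
    by move=> z0; rewrite indicE mem_set//= in_itv/= andbT (lt_le_trans a0).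
  by rewrite (eL _ (fun=> 1))// ?(eL' _ (fun=> 1))//; exact: bmeas_cst.
pose k n := Num.truncn (n.+1%:R * expR (n.+1%:R * a)).
pose F n := p n.+1%:R 0 (k n).
have F1 n z : `|F n z| <= 1.
  rewrite /F /p mul0r oppr0 expR0 mul1r.
  have e1 : expR (- (n.+1%:R * Num.max z 0)) <= 1.
    by rewrite -expR0 ler_expR oppr_le0 mulr_ge0.
  by rewrite ger0_norm ?exprn_ge0 ?exprn_ile1 ?subr_ge0// gerBl expR_ge0.
have Fl z : F n z @[n --> \oo] --> (\1_(`]a, +oo[ : set R) z : R).
  have -> : \1_(`]a, +oo[ : set R) z = \1_(`]a, +oo[ : set R) (Num.max z 0) :> R.
    rewrite !indicE; congr (nat_of_bool _)%:R; apply/idP/idP;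
      rewrite !inE/= !in_itv/= !andbT lt_max; first by move=> ->.
    by move=> /orP[//|]; rewrite ltNge a0.
  rewrite /F /p; under eq_fun do rewrite mul0r oppr0 expR0 mul1r.
  exact: ray_approx.
have bF n : bmeas (F n) by exact: bp.
apply: (cvg_unique _ (bfun_cvg bL bF F1 bI Fl)); first exact: Rhausdorff.
rewrite (_ : (fun n => L (F n)) = (fun n => L' (F n))).
  exact: (bfun_cvg bL' bF F1 bI Fl).
by apply/funext => n; exact: HP.
Qed.

(** * Laws of Markov chains *)

Lemma measurable_self_generated {d} {T : measurableType d} :
  @measurable _ T = <<s @measurable _ T >>.
Proof.
apply/seteqP; split=> A; first exact: sub_sigma_algebra.
by move=> /(_ measurable); apply; split=> //; exact: sigma_algebra_measurable.
Qed.

(** Only the coordinates up to [n] are constrained: the generated sigma-algebra describes n + 1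
    points of a path, so that equality of laws on a grid reduces to products of one-point
    functions. *)
Definition cylinder {R : realType} (n : nat) : set (set (nat -> R)) :=
  [set A | exists2 B : nat -> set R, forall k, measurable (B k) &
     A = [set z | forall k, (k <= n)%N -> B k (z k)]].

Lemma cylinder_setI {R : realType} n : setI_closed (@cylinder R n).
Proof.
move=> _ _ [B mB ->] [C mC ->]; exists (fun k => B k `&` C k).
  by move=> k; exact: measurableI.
by apply/seteqP; split=> [z /= [hB hC] k kn|z /= h]; [split; auto|
  split=> k kn; have [] := h k kn].
Qed.

(** The last factor is kept apart to match [chain_property], where the last coordinate is the one
    that is integrated out. *)
Lemma indic_cylinder {R : realType} n (B : nat -> set R) (z : nat -> R) :
  \1_[set z | forall k, (k <= n)%N -> B k (z k)] z =
  (\prod_(k < n) \1_(B k) (z k)) * \1_(B n) (z n) :> R.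
Proof.
have [h|h] := pselect (forall k, (k <= n)%N -> B k (z k)).
  rewrite indicE mem_set// big1 => [|k _]; rewrite indicE mem_set ?mulr1//; first exact: h.
  by apply: h; exact: ltnW.
rewrite indicE memNset//; have [k kn Bk] : exists2 k, (k <= n)%N & ~ B k (z k).
  apply: contrapT => h'; apply: h => k kn; apply: contrapT => Bk; apply: h'.
  by exists k.
move: kn; rewrite leq_eqVlt => /predU1P[kn|kn].
  by rewrite -kn [X in _ * X]indicE memNset// mulr0.
by rewrite (bigD1 (Ordinal kn))//= [X in X * _ * _]indicE memNset// !mul0r.
Qed.

Section cylinder_sequences.
Context {R : realType} {d} {T : measurableType d} (n : nat).
Notation seqs := (g_sigma_algebraType (@cylinder R n)).

Lemma measurable_coordinate k : (k <= n)%N ->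
  measurable_fun setT (fun z : seqs => z k).
Proof.
move=> kn _ B mB; rewrite setTI; apply: sub_sigma_algebra.
exists (fun j => if j == k then B else setT) => [j|]; first by case: ifP.
apply/seteqP; split=> z /=.
  by move=> Bz j jn; case: ifPn => // /eqP ->.
by move=> /(_ k kn); rewrite eqxx.
Qed.

Lemma measurable_to_cylinder (Z : nat -> T -> R) :
  (forall k, measurable_fun setT (Z k)) ->
  @measurable_fun _ _ T seqs setT (fun w k => Z k w).
Proof.
move=> mZ; apply: (@measurability _ _ T seqs _ _ (@cylinder R n)) => //.
move=> _ [_ [B mB ->] <-]; rewrite setTI.
rewrite (_ : _ @^-1` _ = \bigcap_(k in [set k | (k <= n)%N]) (Z k @^-1` B k)).
  by apply: bigcap_measurable; [exists 0%N|move=> k _; rewrite -[X in measurable X]setTI; exact: mZ].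
by apply/seteqP; split=> w /= h k kn; exact: h.
Qed.

End cylinder_sequences.

Section markov_chain.
Context {R : realType} {d} {T : measurableType d}.
Variables (q : R -> probability T R) (Y : nat -> T -> R).

(* The chain Z under mu, weighted by W, moves by the transition y |-> law of Y 1
   under q y. *)
Definition chain_property {d'} {T' : measurableType d'} (mu : probability T' R)
    (W : T' -> R) (Z : nat -> T' -> R) :=
  forall n (b : nat -> R -> R) (f : R -> R), (forall k, bmeas (b k)) -> bmeas f ->
  \int[mu]_w (W w * ((\prod_(k < n.+1) b k (Z k w)) * f (Z n.+1 w))) =
  \int[mu]_w (W w * ((\prod_(k < n.+1) b k (Z k w)) * \int[q (Z n w)]_w' f (Y 1%N w'))).

Hypothesis mY : forall k, measurable_fun setT (Y k).
Hypothesis kerY : bkernel (fun (f : R -> R) y => \int[q y]_w f (Y 1%N w)).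
Hypothesis startY : forall (f : R -> R) y, 0 <= y -> bmeas f ->
  \int[q y]_w f (Y 0%N w) = f y.
Hypothesis start_meas : forall f : R -> R, bmeas f ->
  bmeas (fun y => \int[q y]_w f (Y 0%N w)).
Hypothesis chainY : forall y, chain_property (q y) (fun=> 1) Y.

(** Induction on [n]: the last coordinate is integrated out and absorbed into the factor of the
    previous one, as [g]. Measurability in the starting point is carried along because it follows
    from the same recursion. *)
Let finite_dim {d'} {T' : measurableType d'} (mu : probability T' R)
    (W : T' -> R) (Z : nat -> T' -> R) :
  bmeas W -> (forall k, measurable_fun setT (Z k)) -> (forall w, 0 <= Z 0%N w) ->
  chain_property mu W Z ->
  forall n (b : nat -> R -> R) (f : R -> R), (forall k, bmeas (b k)) -> bmeas f ->
  bmeas (fun y => \int[q y]_w ((\prod_(k < n) b k (Y k w)) * f (Y n w))) /\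
  \int[mu]_w (W w * ((\prod_(k < n) b k (Z k w)) * f (Z n w))) =
  \int[mu]_w (W w * \int[q (Z 0%N w)]_w' ((\prod_(k < n) b k (Y k w')) * f (Y n w'))).
Proof.
move=> bW mZ Z0 chainZ; elim=> [|n IH] b f bb bf.
  under eq_fun do under eq_Rintegral do rewrite big_ord0 mul1r.
  under eq_Rintegral do rewrite big_ord0 mul1r.
  split; first exact: start_meas.
  apply: eq_Rintegral => w _; congr (_ * _).
  by under eq_Rintegral do rewrite big_ord0 mul1r; rewrite startY.
pose g y := b n y * \int[q y]_w f (Y 1%N w).
have bg : bmeas g by apply: bmeasM => //; exact: (bker_bmeas kerY).
have [IH1 IH2] := IH b g bb bg.
have E y : \int[q y]_w ((\prod_(k < n.+1) b k (Y k w)) * f (Y n.+1 w)) =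
    \int[q y]_w ((\prod_(k < n) b k (Y k w)) * g (Y n w)).
  have := @chainY y n b f bb bf.
  under eq_Rintegral do rewrite mul1r; under [X in _ = X -> _]eq_Rintegral do rewrite mul1r.
  by move=> ->; apply: eq_Rintegral => w _; rewrite big_ord_recr/= /g mulrA.
split; first by under eq_fun do rewrite E.
rewrite chainZ//; under [RHS]eq_Rintegral do rewrite E.
rewrite -IH2; apply: eq_Rintegral => w _; congr (_ * _).
by rewrite big_ord_recr/= /g mulrA.
Qed.

Lemma chain_kernel n : bkernel
  (fun (g : g_sigma_algebraType (@cylinder R n) -> R) y => \int[q y]_w g (Y ^~ w)).
Proof.
apply: (@bkernel_prob R _ _ _ (g_sigma_algebraType (@cylinder R n)) R T
  (@cylinder R n) q (fun w k => Y k w)) => //.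
- exact: cylinder_setI.
- exact: measurable_to_cylinder.
move=> _ [B mB ->].
have bB k : bmeas (\1_(B k) : R -> R) by exact: bmeas_indic.
(* A chain of weight 0 satisfies [chain_property] trivially; it serves to extract the measurability
   half of [finite_dim]. *)
have c0 : chain_property (q 0) (fun=> 0) (fun=> (fun=> 0)).
  move=> k b f _ _.
  by under eq_Rintegral do rewrite mul0r; under [RHS]eq_Rintegral do rewrite mul0r.
have [|||[h _] _] := @finite_dim _ _ (q 0) _ _ _ _ _ c0 n _ _ bB (bB n) => //.
  exact: bmeas_cst.
by under eq_fun do under eq_Rintegral do rewrite indic_cylinder.
Qed.

(** A chain is determined by its transition and its starting point. This is applied to [X] observed
    after a time [t], with a weight from the past, and to the sum of two independent copies. *)
Lemma chain_law {d'} {T' : measurableType d'} (mu : probability T' R)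
    (W : T' -> R) (Z : nat -> T' -> R) n :
  bmeas W -> (forall k, measurable_fun setT (Z k)) -> (forall w, 0 <= Z 0%N w) ->
  chain_property mu W Z ->
  forall g : g_sigma_algebraType (@cylinder R n) -> R, bmeas g ->
  \int[mu]_w (W w * g (Z ^~ w)) =
  \int[mu]_w (W w * \int[q (Z 0%N w)]_w' g (Y ^~ w')).
Proof.
move=> bW mZ Z0 chainZ.
apply: (@bfunctional_ext R _ (g_sigma_algebraType (@cylinder R n)) (@cylinder R n)
  (fun g => \int[mu]_w (W w * g (Z ^~ w)))
  (fun g => \int[mu]_w (W w * \int[q (Z 0%N w)]_w' g (Y ^~ w')))) => //.
- exact: cylinder_setI.
- exact: (bfunctional_integral mu bkernel_id bW (measurable_to_cylinder mZ)).
- exact: (bfunctional_integral mu (chain_kernel n) bW (mZ 0%N)).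
- by under [RHS]eq_Rintegral do rewrite bintegral_cst.
move=> _ [B mB ->].
have bB k : bmeas (\1_(B k) : R -> R) by exact: bmeas_indic.
have [_ h] := @finite_dim _ _ mu W Z bW mZ Z0 chainZ n _ _ bB (bB n).
under eq_Rintegral do rewrite indic_cylinder.
by under [RHS]eq_Rintegral do under eq_Rintegral do rewrite indic_cylinder.
Qed.

End markov_chain.

(** * Jumps of right-continuous functions with left limits *)

Section rcll_functions.
Context {R : realType}.
Implicit Types f : R -> R.

Definition left_limit f (t : R) : R := lim (f u @[u --> t^'-]).

Lemma rcll_right f t e : rcll f -> 0 <= t -> 0 < e ->
  exists2 delta : R, 0 < delta & forall u, t <= u < t + delta -> `|f u - f t| < e.
Proof.
move=> [rc _] t0 e0; have /cvgrPdist_lt/(_ _ e0) := rc t t0.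
rewrite near_withinE => /nbhs_ballP[delta /= d0 H]; exists delta => // u /andP[].
rewrite le_eqVlt => /predU1P[-> _|tu ud]; first by rewrite subrr normr0.
rewrite distrC; apply: H => //; rewrite /ball/= ltr0_norm ?subr_lt0// opprB.
by rewrite ltrBlDl.
Qed.

Lemma rcll_left f t e : rcll f -> 0 < t -> 0 < e ->
  exists2 delta : R, 0 < delta &
    forall u, t - delta < u < t -> `|f u - left_limit f t| < e.
Proof.
move=> [_ lc] t0 e0; have /cvgrPdist_lt/(_ _ e0) := lc t t0.
rewrite near_withinE => /nbhs_ballP[delta /= d0 H]; exists delta => // u /andP[ud ut].
rewrite distrC; apply: H => //; rewrite /ball/= gtr0_norm ?subr_gt0//.
by rewrite ltrBlDl -ltrBlDr.
Qed.

Definition has_jump f (a b r : R) := exists2 s : R, a < s <= b & r < jump f s.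

Fixpoint smax (n : nat) (z : nat -> R) : R :=
  if n is k.+1 then Num.max (smax k z) (z k.+1 - z k) else 0.

Definition grid f (a h : R) (k : nat) : R := f (a + k%:R * h).

Definition mesh (a b : R) (n : nat) : R := (b - a) / n.+1%:R.

(** Continuity is the point: the indicator of ]r, +oo[ would not pass to the limit of the grid
    increments when that limit is [r] itself. The indicator is recovered as [e] tends to 0. *)
Definition ramp (r e x : R) : R := Num.min 1 (Num.max 0 ((x - r) / e)).

Lemma smax_ge0 n z : 0 <= smax n z.
Proof. by elim: n => //= n IH; rewrite le_max IH. Qed.

Lemma smax_ge n z k : (k < n)%N -> z k.+1 - z k <= smax n z.
Proof.
elim: n => // n IH; rewrite ltnS leq_eqVlt => /predU1P[->|kn] /=.
  by rewrite le_max lexx orbT.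
by rewrite le_max IH.
Qed.

Lemma smax_le n z c : 0 <= c -> (forall k, (k < n)%N -> z k.+1 - z k <= c) ->
  smax n z <= c.
Proof.
move=> c0; elim: n => //= n IH H; rewrite ge_max H// andbT.
by apply: IH => k kn; apply: H; exact: ltnW.
Qed.

Lemma ramp_ge0 r e x : 0 <= ramp r e x.
Proof. by rewrite /ramp le_min ler01 le_max lexx. Qed.

Lemma ramp_le1 r e x : ramp r e x <= 1.
Proof. by rewrite /ramp ge_min lexx. Qed.

Lemma ramp0 r e x : 0 < e -> x <= r -> ramp r e x = 0.
Proof.
move=> e0 xr; rewrite /ramp max_l; first by rewrite min_r.
by rewrite pmulr_lle0 ?invr_gt0// subr_le0.
Qed.

Lemma ramp1 r e x : 0 < e -> r + e <= x -> ramp r e x = 1.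
Proof.
move=> e0 rx; rewrite /ramp min_l// le_max; apply/orP; right.
by rewrite ler_pdivlMr// mul1r; lra.
Qed.

Lemma ramp_continuous r e : 0 < e -> continuous (ramp r e).
Proof.
move=> e0 x; apply: (@continuous_min _ _ (fun=> 1) (fun x => Num.max 0 ((x - r) / e))).
  exact: cvg_cst.
apply: (@continuous_max _ _ (fun=> 0) (fun x => (x - r) / e)); first exact: cvg_cst.
apply: cvgMl; apply: cvgB; [exact: cvg_id|exact: cvg_cst].
Qed.

Lemma mesh_gt0 a b n : a < b -> 0 < mesh a b n.
Proof. by move=> ab; rewrite /mesh divr_gt0 ?subr_gt0. Qed.

Lemma near_mesh_lt a b delta : 0 < delta -> \forall n \near \oo, mesh a b n < delta.
Proof.
move=> d0; have h : (b - a) * harmonic n @[n --> \oo] --> ((b - a) * 0 : R).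
  by apply: cvgMr; exact: cvg_harmonic.
move: h; rewrite mulr0 => /cvgrPdist_lt/(_ _ d0); apply: filterS => n.
by rewrite sub0r normrN => /(le_lt_trans (ler_norm _)).
Qed.

Lemma grid_straddle a b n s : a < s <= b ->
  exists2 k, (k < n.+1)%N & a + k%:R * mesh a b n < s <= a + k.+1%:R * mesh a b n.
Proof.
move=> /andP[as_ sb].
have : s <= a + n.+1%:R * mesh a b n.
  by rewrite /mesh mulrC divfK ?pnatr_eq0// addrC subrK.
elim: n.+1 => [|m IH].
  by rewrite mul0r addr0 => /(lt_le_trans as_); rewrite ltxx.
move=> sm; have [sm'|sm'] := leP s (a + m%:R * mesh a b n).
  by have [k km ks] := IH sm'; exists k => //; exact: ltnW.
by exists m => //; rewrite sm' sm.
Qed.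

(** For a fine mesh the cell that straddles [s] has its left end just before [s], where the left
    limit applies, and its right end at or just after [s], where right-continuity does; its
    increment is then close to the jump. *)
Lemma smax_gt_near f a b s rho : rcll f -> 0 <= a -> a < s <= b -> rho < jump f s ->
  \forall n \near \oo, rho < smax n.+1 (grid f a (mesh a b n)).
Proof.
move=> cf a0 /[dup] /andP[as_ sb] asb rj.
have s0 : 0 < s by exact: le_lt_trans as_.
pose e := (jump f s - rho) / 2.
have e0 : 0 < e by rewrite divr_gt0// subr_gt0.
have [d1 d10 H1] := rcll_right cf (ltW s0) e0.
have [d2 d20 H2] := rcll_left cf s0 e0.
near=> n.
have h1 : mesh a b n < d1 by near: n; exact: near_mesh_lt.
have h2 : mesh a b n < d2 by near: n; exact: near_mesh_lt.
have [k kn /andP[ks sk]] := grid_straddle n asb.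
apply: lt_le_trans (smax_ge _ kn); rewrite /grid.
set u := a + k%:R * _ in ks *; set v := a + k.+1%:R * _ in sk *.
have uv : v = u + mesh a b n by rewrite /u /v -natr1 mulrDl mul1r addrA.
have := H1 v; have := H2 u.
rewrite ks sk /=; have -> : s - d2 < u by lra.
have -> : v < s + d1 by lra.
move=> /(_ isT) + /(_ isT).
rewrite !ltr_norml => /andP[_ A] /andP[B _].
by rewrite /e /jump -/(left_limit f s) in A B; lra.
Unshelve. all: by end_near. Qed.

(** Compactness makes a local oscillation bound uniform. Near [s], two points on the same side have
    values less than 2e apart, and an increment across [s] is less than the jump at [s] plus 2e. *)
Lemma smax_le_near f a b rho : rcll f -> 0 <= a -> a < b -> 0 < rho ->
  (forall s, a < s <= b -> jump f s < rho) ->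
  \forall n \near \oo, smax n.+1 (grid f a (mesh a b n)) <= rho.
Proof.
move=> cf a0 ab rho0 jf.
have K := @segment_compact R a b.
move/compact_near_coveringP : K => /near_covering_withinP K.
have : \forall n \near \oo, `[a, b]%classic `<=`
    (fun u => forall v, u <= v <= u + mesh a b n -> v <= b -> f v - f u < rho).
  apply: (K _ \oo (fun n u => forall v, u <= v <= u + mesh a b n -> v <= b -> f v - f u < rho)).
  move=> s /=; rewrite in_itv/= => /andP[as_ sb].
  have s0 : 0 <= s by exact: le_trans as_.
  (* At s = a no point before [s] is considered, hence the guard a < s; elsewhere [e] serves both
     the same-side and the straddling case. *)
  have [e [e0 e1 e2]] : exists e : R, [/\ 0 < e, 2 * e <= rho &
      a < s -> jump f s + 2 * e <= rho].
    have [as'|] := ltP a s.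
      have js : jump f s < rho by apply: jf; rewrite as' sb.
      exists (Num.min (rho / 2) ((rho - jump f s) / 2)).
      split; [by rewrite lt_min; apply/andP; split; lra| |move=> _].
        have : Num.min (rho / 2) ((rho - jump f s) / 2) <= rho / 2 by rewrite ge_min lexx.
        lra.
      have : Num.min (rho / 2) ((rho - jump f s) / 2) <= (rho - jump f s) / 2.
        by rewrite ge_min lexx orbT.
      lra.
    by move=> sa; exists (rho / 2); split=> //; lra.
  have [d1 d10 H1] := rcll_right cf s0 e0.
  have [d2 d20 H2] : exists2 d2, 0 < d2 & a < s ->
      forall u, s - d2 < u < s -> `|f u - left_limit f s| < e.
    have [as'|sa] := ltP a s; last by exists 1.
    have [d2 d20 H2] := rcll_left cf (le_lt_trans a0 as') e0.
    by exists d2.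
  pose delta := Num.min d1 d2 / 2.
  have m1 : Num.min d1 d2 <= d1 by rewrite ge_min lexx.
  have m2 : Num.min d1 d2 <= d2 by rewrite ge_min lexx orbT.
  have delta0 : 0 < delta by rewrite divr_gt0// lt_min d10.
  exists (ball s delta, [set n | mesh a b n < delta]); first split => /=.
  - exact: nbhsx_ballx.
  - exact: near_mesh_lt.
  move=> [u n] [/= su hn]; rewrite in_itv/= => /andP[au ub] v /andP[uv vu] vb.
  move: su; rewrite /ball/= ltr_norml => /andP[su1 su2].
  have [us|su] := ltP u s.
    have as' : a < s by exact: le_lt_trans us.
    have := H2 as' u; rewrite us andbT.
    have -> : s - d2 < u by rewrite /delta in su1 su2; lra.
    move=> /(_ isT); rewrite ltr_norml => /andP[B1 B2].
    have [vs|sv] := ltP v s.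
      have := H2 as' v; rewrite vs andbT.
      have -> : s - d2 < v by rewrite /delta in su1 su2; lra.
      by move=> /(_ isT); rewrite ltr_norml => /andP[C1 C2]; lra.
    have := H1 v; rewrite sv/=.
    have -> : v < s + d1 by rewrite /delta in su1 su2 hn; lra.
    move=> /(_ isT); rewrite ltr_norml => /andP[C1 C2].
    by have := e2 as'; rewrite /jump -/(left_limit f s); lra.
  have := H1 u; rewrite su/=.
  have -> : u < s + d1 by rewrite /delta in su1 su2 hn; lra.
  move=> /(_ isT); rewrite ltr_norml => /andP[B1 B2].
  have := H1 v; rewrite (le_trans su uv)/=.
  have -> : v < s + d1 by rewrite /delta in su1 su2 hn; lra.
  by move=> /(_ isT); rewrite ltr_norml => /andP[C1 C2]; lra.
apply: filterS => n H; apply: smax_le => [|k kn]; first exact: ltW.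
have m0 := mesh_gt0 n ab.
have vE : a + k.+1%:R * mesh a b n = a + k%:R * mesh a b n + mesh a b n.
  by rewrite -natr1 mulrDl mul1r addrA.
have vb : a + k.+1%:R * mesh a b n <= b.
  rewrite -lerBrDl /mesh mulrCA -[leRHS]mulr1 ler_pM2l ?subr_gt0//.
  by rewrite ler_pdivrMr// mul1r ler_nat.
apply/ltW/H => //=; last by rewrite vE lexx andbT lerDl ltW.
rewrite in_itv/= lerDl mulr_ge0 ?(ltW m0)//=.
by apply: le_trans vb; rewrite vE lerDl ltW.
Qed.

Lemma has_jump_le f a b r r' : r <= r' -> has_jump f a b r' -> has_jump f a b r.
Proof. by move=> rr' [s sab js]; exists s => //; exact: le_lt_trans js. Qed.

Lemma ramp_smax_cvg f a b r e : rcll f -> 0 <= a -> a < b -> 0 <= r -> 0 < e ->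
  exists l : R, [/\ ramp r e (smax n.+1 (grid f a (mesh a b n))) @[n --> \oo] --> l,
    ~ has_jump f a b r -> l = 0 & has_jump f a b (r + e) -> l = 1].
Proof.
move=> cf a0 ab r0 e0.
have re0 : 0 < r + e by rewrite ltr_wpDl.
(* Cutting the levels at r + e bounds the set without changing the ramp, which is constant from
   there on; 0 is added so that the set is not empty. Its supremum is the limit of the truncated
   largest increments. *)
pose J := [set x : R | 0 <= x <= r + e /\ (x = 0 \/ has_jump f a b x)].
have J0 : J 0 by split; [apply/andP; split=> //; exact: ltW|left].
have ubJ : ubound J (r + e) by move=> x [/andP[]].
have supJ : has_sup J by split; [exists 0|exists (r + e)].
set S := sup J.
have S0 : 0 <= S by apply: ub_le_sup => //; exists (r + e).
have Sre : S <= r + e by apply: ge_sup => //; exists 0.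
pose u n := Num.min (r + e) (smax n.+1 (grid f a (mesh a b n))).
have uS : u n @[n --> \oo] --> S.
  apply/cvgrPdist_le => eps eps0.
  have A : \forall n \near \oo, S - eps <= u n.
    have [x [/andP[x0 xre] xJ]] := sup_adherent eps0 supJ.
    rewrite -/S => Sx; case: xJ => [xE|[s sab js]].
      apply: nearW => n; apply: (le_trans (ltW Sx)).
      by rewrite xE le_min smax_ge0 ltW.
    have := smax_gt_near cf a0 sab js; apply: filterS => n h.
    by apply: (le_trans (ltW Sx)); rewrite le_min xre ltW.
  have B : \forall n \near \oo, u n <= S + eps.
    have [re|re] := leP (r + e) (S + eps).
      by apply: nearW => n; rewrite ge_min re.
    have := @smax_le_near f a b (S + eps) cf a0 ab (ltr_wpDl S0 eps0).
    have h s : a < s <= b -> jump f s < S + eps.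
      move=> sab; rewrite ltNge; apply/negP => h.
      have : J (S + eps / 2).
        split; first by apply/andP; split; lra.
        by right; exists s => //; lra.
      by move=> /(ub_le_sup (ex_intro _ _ ubJ)); rewrite -/S; lra.
    by move=> /(_ h); apply: filterS => n un; rewrite ge_min un orbT.
  near=> n; rewrite ler_norml; apply/andP; split.
    by rewrite lerBrDl -lerBrDr opprK; near: n.
  by rewrite lerBlDl -lerBlDr; near: n.
exists (ramp r e S); split.
- have -> : (fun n => ramp r e (smax n.+1 (grid f a (mesh a b n)))) = (fun n => ramp r e (u n)).
    apply/funext => n; rewrite /u; case: (leP (r + e)) => // h.
    by rewrite !ramp1.
  by apply: continuous_cvg => //; exact: ramp_continuous.
- move=> nj; apply: ramp0 => //; apply: ge_sup; first by exists 0.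
  move=> x [_ [->//|hj]]; rewrite leNgt; apply/negP => rx.
  by apply: nj; exact: has_jump_le (ltW rx) hj.
- move=> hj; apply: ramp1 => //; apply: ub_le_sup; first by exists (r + e).
  by split; [apply/andP; split=> //; exact: ltW|right].
Unshelve. all: by end_near. Qed.

End rcll_functions.

(** * Branching mechanisms and cumulants *)

Section branching_function.
Context {R : realType}.

Definition levy_kernel (lambda theta : R) : R :=
  expR (- (lambda * theta)) - 1 + lambda * theta.

(** The derivative of [levy_kernel] in its first argument, at a point s <= M, is theta (1 - e^{-s
    theta}), which lies between 0 and theta min(1, M theta). The case a = 0 gives sign and
    integrability of the kernel, the general case the Lipschitz bound for [Phi]. *)
Lemma levy_kernel_incr (a b M theta : R) :
  0 <= a -> a <= b -> b <= M -> 0 < theta ->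
  0 <= levy_kernel b theta - levy_kernel a theta <=
    (b - a) * (Num.max 1 M * Num.min theta (theta ^+ 2)).
Proof.
move=> a0 ab bM t0.
pose E := expR (- (b * theta)); pose D := (b - a) * theta.
have D0 : 0 <= D by rewrite mulr_ge0 ?subr_ge0// ltW.
have E0 : 0 < E by exact: expR_gt0.
have b0 : 0 <= b by exact: le_trans ab.
have aE : expR (- (a * theta)) = E * expR D.
  by rewrite /E /D -expRD; congr expR; ring.
have bE : E = expR (- (a * theta)) * expR (- D).
  by rewrite /E /D -expRD; congr expR; ring.
have a1 : expR (- (a * theta)) <= 1 by rewrite -expR0 ler_expR oppr_le0 mulr_ge0// ltW.
have h1 : E * (1 + D) <= expR (- (a * theta)) by rewrite aE ler_pM2l// expR_ge1Dx.
have h2 : expR (- (a * theta)) - D <= E.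
  have := expR_ge1Dx (- D); rewrite bE => h.
  apply: (@le_trans _ _ (expR (- (a * theta)) * (1 - D))).
    by rewrite mulrBr mulr1 lerD2l lerN2 ler_piMl.
  by rewrite ler_pM2l// expR_gt0.
have incE : levy_kernel b theta - levy_kernel a theta = E - expR (- (a * theta)) + D.
  by rewrite /levy_kernel -/E /D; ring.
rewrite incE; apply/andP; split; first by lra.
have h3 : E - expR (- (a * theta)) + D <= D * (1 - E) by rewrite mulrDr mulr1 in h1 *; lra.
apply: (le_trans h3); rewrite /D -mulrA ler_wpM2l ?subr_ge0//.
have m1 : 1 <= Num.max 1 M by rewrite le_max lexx.
have mM : M <= Num.max 1 M by rewrite le_max lexx orbT.
have e1 : 1 - E <= b * theta.
  by have := expR_ge1Dx (- (b * theta)); rewrite -/E; lra.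
have e2 : 1 - E <= 1 by lra.
case: (leP theta) => _.
  rewrite [leRHS]mulrC ler_wpM2l ?(ltW t0)//; lra.
rewrite expr2 [leRHS]mulrC -mulrA ler_wpM2l ?(ltW t0)//.
apply: (le_trans e1); rewrite [leRHS]mulrC ler_wpM2r ?(ltW t0)//; lra.
Qed.

Lemma levy_kernel0 theta : levy_kernel 0 theta = 0.
Proof. by rewrite /levy_kernel mul0r oppr0 expR0 subrr add0r. Qed.

Variables (alpha beta : R) (nu : {measure set R -> \bar R}).
Hypothesis bm : branching_mechanism alpha beta nu.
Notation Phi := (branching_function alpha beta nu).
Notation pos := (`]0%R, +oo[%classic : set R).

Lemma levy_min_integrable :
  nu.-integrable pos (fun theta => (Num.min theta (theta ^+ 2))%:E).
Proof.
apply/integrableP; split.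
  apply/measurable_EFinP/measurable_funTS; apply: measurable_minr => //.
have [_ _ ]:= branching_levy bm; apply: le_lt_trans.
rewrite le_eqVlt; apply/orP; left; apply/eqP; apply: eq_integral => theta.
rewrite inE/= in_itv/= andbT => t0; rewrite ger0_norm// le_min ltW//=.
by rewrite exprn_ge0// ltW.
Qed.

Lemma measurable_levy_kernel lambda (D : set R) : measurable_fun D (levy_kernel lambda).
Proof.
apply: measurable_funTS; rewrite /levy_kernel; apply: measurable_funD.
  apply: measurable_funB => //; apply: measurableT_comp => //.
  by apply: measurable_funN; exact: measurable_funM.
exact: measurable_funM.
Qed.

Lemma levy_kernel_integrable (lambda : R) : 0 <= lambda ->
  nu.-integrable pos (EFin \o levy_kernel lambda).
Proof.
move=> l0; have := integrableZl (measurable_itv _) (lambda * Num.max 1 lambda) levy_min_integrable.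
apply: le_integrable => //; first by apply/measurable_EFinP; exact: measurable_levy_kernel.
move=> theta; rewrite /= in_itv/= andbT => t0; rewrite lee_fin.
have /andP[h1 h2] := levy_kernel_incr (lexx 0) l0 (lexx lambda) t0.
rewrite levy_kernel0 !subr0 in h1 h2.
by rewrite ger0_norm// (le_trans h2)// mulrA ler_norm.
Qed.

Lemma branching_functionE (lambda : R) : Phi lambda =
  alpha * lambda + beta * lambda ^+ 2 + \int[nu]_(theta in pos) levy_kernel lambda theta.
Proof. by []. Qed.

Lemma branching_function0 : Phi 0 = 0.
Proof.
rewrite branching_functionE mulr0 expr0n mulr0 !add0r.
by under eq_Rintegral do rewrite levy_kernel0; rewrite /Rintegral integral0.
Qed.

Lemma branching_function_ge0 (lambda : R) : 0 <= alpha -> 0 <= lambda -> 0 <= Phi lambda.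
Proof.
move=> a0 l0; rewrite branching_functionE !addr_ge0 ?mulr_ge0 ?exprn_ge0//.
  exact: branching_beta_ge0 bm.
apply: Rintegral_ge0 => theta; rewrite /= in_itv/= andbT => t0.
have /andP[h1 _] := levy_kernel_incr (lexx 0) l0 (lexx lambda) t0.
by rewrite levy_kernel0 subr0 in h1.
Qed.

Lemma branching_function_lipschitz (M : R) : exists2 L : R, 0 <= L &
  forall a b, 0 <= a <= M -> 0 <= b <= M -> `|Phi a - Phi b| <= L * `|a - b|.
Proof.
pose m := \int[nu]_(theta in pos) Num.min theta (theta ^+ 2).
have m0 : 0 <= m.
  apply: Rintegral_ge0 => theta; rewrite /= in_itv/= andbT => t0.
  by rewrite le_min ltW//= exprn_ge0// ltW.
have beta0 := branching_beta_ge0 bm.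
have K1 : 0 <= Num.max 1 M by rewrite le_max ler01.
exists (`|alpha| + beta * (2 * Num.max 1 M) + Num.max 1 M * m).
  by rewrite !addr_ge0// ?mulr_ge0.
have main a b : 0 <= a -> a <= b -> b <= M -> `|Phi a - Phi b| <=
    (`|alpha| + beta * (2 * Num.max 1 M) + Num.max 1 M * m) * `|a - b|.
  move=> a0 ab bM; have b0 := le_trans a0 ab.
  have ba0 : 0 <= b - a by rewrite subr_ge0.
  rewrite distrC [`|a - b|]distrC (ger0_norm ba0) !branching_functionE.
  set Ib := \int[nu]_(_ in _) levy_kernel b _; set Ia := \int[nu]_(_ in _) _.
  have IE : Ib - Ia = \int[nu]_(theta in pos) (levy_kernel b theta - levy_kernel a theta).
    by rewrite RintegralB//; exact: levy_kernel_integrable.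
  have inc : nu.-integrable pos (EFin \o (fun theta => levy_kernel b theta - levy_kernel a theta)).
    by apply: (@eq_integrable _ _ _ _ _ _ ((EFin \o levy_kernel b) \- (EFin \o levy_kernel a))%E) => //;
      apply: integrableB => //; exact: levy_kernel_integrable.
  have I1 : Ib - Ia <= (b - a) * (Num.max 1 M * m).
    rewrite IE mulrA /m -RintegralZl//; last exact: levy_min_integrable.
    apply: le_Rintegral => //.
      have := integrableZl (measurable_itv _) ((b - a) * Num.max 1 M) levy_min_integrable.
      exact.
    move=> theta; rewrite /= in_itv/= andbT => t0.
    have /andP[_] := levy_kernel_incr a0 ab bM t0.
    by rewrite mulrA.
  have I0 : 0 <= Ib - Ia.
    rewrite IE; apply: Rintegral_ge0 => theta; rewrite /= in_itv/= andbT => t0.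
    by have /andP[] := levy_kernel_incr a0 ab bM t0.
  have -> : alpha * b + beta * b ^+ 2 + Ib - (alpha * a + beta * a ^+ 2 + Ia) =
      alpha * (b - a) + beta * (b + a) * (b - a) + (Ib - Ia) by ring.
  rewrite (le_trans (ler_normD _ _))// mulrDl lerD//; last first.
    by rewrite ger0_norm// mulrC.
  rewrite (le_trans (ler_normD _ _))// mulrDl lerD//.
    by rewrite normrM (ger0_norm ba0).
  rewrite ger0_norm; last by rewrite !mulr_ge0// addr_ge0.
  rewrite ler_wpM2r// ler_wpM2l//.
  have : M <= Num.max 1 M by rewrite le_max lexx orbT.
  by lra.
move=> a b /andP[a0 aM] /andP[b0 bM]; have [ab|/ltW ba] := leP a b; first exact: main.
by rewrite distrC [`|a - b|]distrC; exact: main.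
Qed.

End branching_function.

(** * The integral equation of the cumulant *)

Section cumulant.
Context {R : realType}.
Variables (Phi : R -> R) (lambda : R) (u : R -> R).
Hypothesis lipPhi : forall M : R, exists2 L : R, 0 <= L &
  forall a b, 0 <= a <= M -> 0 <= b <= M -> `|Phi a - Phi b| <= L * `|a - b|.
Hypothesis Phi0 : Phi 0 = 0.
Hypothesis cu : cumulant_solution Phi lambda u.
Notation mu := (@lebesgue_measure R).

Lemma measurable_Phi_max : measurable_fun setT (fun z : R => Phi (Num.max z 0)).
Proof.
apply: continuous_measurable_fun => z; apply/cvgrPdist_le => /= e e0.
have [L L0 H] := lipPhi (`|z| + 1).
have Le : 0 < L + 1 by rewrite ltr_wpDl.
have d0 : 0 < Num.min 1 (e / (L + 1)) by rewrite lt_min ltr01 divr_gt0.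
near=> y.
have zy : `|z - y| < Num.min 1 (e / (L + 1)) by near: y; apply/nbhs_ballP; exists (Num.min 1 (e / (L + 1))).
have := zy; rewrite lt_min => /andP[zy1 zy2].
have zn := ler_norm z; have zn0 := normr_ge0 z.
have mz : Num.max z 0 <= `|z| + 1 by rewrite ge_max; apply/andP; split; lra.
have my : Num.max y 0 <= `|z| + 1.
  rewrite ge_max; apply/andP; split; last by lra.
  by move: zy1; rewrite ltr_norml => /andP[]; lra.
apply: le_trans (H _ _ _ _) _.
- by rewrite mz andbT le_max lexx orbT.
- by rewrite my andbT le_max lexx orbT.
have mm : `|Num.max z 0 - Num.max y 0| <= `|z - y|.
  have := ler_norm (z - y); have := ler_norm (y - z); rewrite [`|y - z|]distrC => h1 h2.
  have h0 := normr_ge0 (z - y).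
  by rewrite ler_norml; case: (leP z 0); case: (leP y 0) => ? ?; apply/andP; split; lra.
apply: (@le_trans _ _ ((L + 1) * (e / (L + 1)))).
  apply: ler_pM => //; first by rewrite lerDl.
  exact: le_trans mm (ltW zy2).
by rewrite mulrC divfK// gt_eqF.
Unshelve. all: by end_near. Qed.

Lemma cumulant_integrable (t : R) : 0 <= t ->
  mu.-integrable `[0, t] (EFin \o (fun s => Phi (u s))).
Proof.
move=> t0; have [M uM] := cumulant_locally_bounded cu t0.
have [L L0 H] := lipPhi (Num.max M 0).
apply: measurable_bounded_integrable => //.
- by rewrite /= lebesgue_measure_itv/=; case: ifP => _; rewrite ?ltry// -EFinD ltry.
- apply: (@eq_measurable_fun _ _ _ _ _ (fun s => Phi (Num.max (u s) 0))).
    move=> s; rewrite inE/= in_itv/= => /andP[s0 st].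
    by rewrite max_l// (cumulant_ge0 cu).
  have mut : measurable_fun (`[0, t]%classic : set R) u.
    apply: (measurable_funS _ _ (cumulant_measurable cu)) => // s/=.
    by rewrite !in_itv/= andbT => /andP[].
  exact: (measurableT_comp measurable_Phi_max mut).
exists (L * Num.max M 0); split; first exact: num_real.
move=> y yL s/=; rewrite in_itv/= => st; have /andP[s0 _] := st.
have us0 := cumulant_ge0 cu s0.
have := H (u s) 0; rewrite Phi0 !subr0 => h.
have usM : u s <= Num.max M 0 by rewrite le_max uM.
apply: (le_trans (h _ _)); rewrite ?us0 ?lexx ?le_max ?lexx ?orbT//.
  by rewrite le_max in usM.
by apply: ltW; apply: le_lt_trans yL; rewrite ler_wpM2l// ger0_norm.
Qed.

(** Integral form of u' = - Phi(u), with [c] an approximation of Phi(u): c = 0 gives the Lipschitz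
    bound in time, c = Phi(lambda) the derivative at 0. *)
Lemma cumulant_incr_bound (s t c K : R) : 0 <= s -> s <= t ->
  (forall r, s < r <= t -> `|Phi (u r) - c| <= K) ->
  `|u t - u s + c * (t - s)| <= K * (t - s).
Proof.
move=> s0 st HK; have t0 := le_trans s0 st.
have it := cumulant_integrable t0.
have E1 : u t - u s = - \int[mu]_(r in `]s, t]) Phi (u r).
  rewrite (cumulant_eq cu t0) (cumulant_eq cu s0).
  have := @Rintegral_itvB _ (fun r => Phi (u r)) (BLeft 0) (BRight t) s it.
  by rewrite !bnd_simp => <-//; ring.
have mst : mu `]s, t]%classic = (t - s)%:E.
  rewrite /= lebesgue_measure_itv/= lte_fin; case: ltP => // ts.
  by have -> : t = s; [apply/eqP; rewrite eq_le ts st|rewrite subrr].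
have sub : mu.-integrable `]s, t] (EFin \o (fun r => Phi (u r))).
  apply: integrableS it => // r/=; rewrite !in_itv/= => /andP[sr ->].
  by rewrite andbT (le_trans s0)// ltW.
have cstE (k : R) : \int[mu]_(r in `]s, t]) k = k * (t - s).
  rewrite Rintegral_cst//; congr (_ * _); have := congr1 fine mst; exact.
have cst_i (k : R) : mu.-integrable `]s, t] (EFin \o (fun=> k)).
  apply: measurable_bounded_integrable => //.
    by apply: (@le_lt_trans _ _ (t - s)%:E); [rewrite -mst|rewrite ltry].
  by exists `|k|; split; [exact: num_real|move=> y ky z _; exact: ltW].
have E2 : u t - u s + c * (t - s) = - \int[mu]_(r in `]s, t]) (Phi (u r) - c).
  rewrite E1 (RintegralB _ sub (cst_i c))//.
  by rewrite cstE; ring.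
have idiff : mu.-integrable `]s, t] (EFin \o (fun r => Phi (u r) - c)).
  exact: (integrableB _ sub (cst_i c)).
rewrite E2 normrN; apply: le_trans (le_normr_Rintegral _ _) _ => //.
rewrite -cstE.
apply: le_Rintegral => //; first exact: integrable_norm.
Qed.

Lemma cumulant0 : u 0 = lambda.
Proof.
by rewrite (cumulant_eq cu (lexx 0)) set_itv1 Rintegral_set1 subr0.
Qed.

Lemma cumulant_le_init (t : R) : (forall z, 0 <= z -> 0 <= Phi z) -> 0 <= t ->
  u t <= lambda.
Proof.
move=> P0 t0; rewrite (cumulant_eq cu t0) gerBl; apply: Rintegral_ge0 => s.
by rewrite /= in_itv/= => /andP[s0 _]; apply: P0; exact: (cumulant_ge0 cu).
Qed.

Lemma cumulant_lipschitz (t : R) : 0 <= t -> exists2 K : R, 0 <= K &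
  forall r s, 0 <= r -> r <= s -> s <= t -> `|u s - u r| <= K * (s - r).
Proof.
move=> t0; have [M uM] := cumulant_locally_bounded cu t0.
have M0 : 0 <= M by apply: le_trans (uM 0 _); [exact: (cumulant_ge0 cu)|rewrite lexx].
have [L L0 H] := lipPhi M; exists (L * M); first exact: mulr_ge0.
move=> r s r0 rs st; have := @cumulant_incr_bound r s 0 (L * M) r0 rs.
rewrite mul0r addr0; apply => y /andP[ry ys].
have y0 : 0 <= y by rewrite (le_trans r0)// ltW.
have uy0 := cumulant_ge0 cu y0.
have uyM : u y <= M by apply: uM; rewrite y0 (le_trans ys).
have := H (u y) 0; rewrite Phi0 !subr0 (ger0_norm uy0) uy0 uyM lexx M0 => h.
by apply: (le_trans (h isT isT)); rewrite ler_wpM2l.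
Qed.

(** On [0, t] the solution stays within K t of lambda, so Phi(u) stays within L K t of Phi(lambda);
    integrating gives the quadratic error. *)
Lemma cumulant_derivative : exists2 C : R, 0 <= C &
  forall t, 0 <= t <= 1 -> `|u t - lambda + Phi lambda * t| <= C * t ^+ 2.
Proof.
have [M uM] := cumulant_locally_bounded cu (@ler01 R).
have [L L0 H] := lipPhi M.
have [K K0 HK] := cumulant_lipschitz (@ler01 R).
exists (L * K); first exact: mulr_ge0.
move=> t /andP[t0 t1]; have := @cumulant_incr_bound 0 t (Phi lambda) (L * K * t) (lexx 0) t0.
rewrite cumulant0 subr0 expr2 mulrA; apply => r /andP[r0 rt].
have r1 : r <= 1 by exact: le_trans t1.
have b s : 0 <= s -> s <= 1 -> 0 <= u s <= M.
  by move=> s0 s1; rewrite (cumulant_ge0 cu s0) uM// s0.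
rewrite -{1}cumulant0 (le_trans (H _ _ _ _))//.
- exact: b (ltW r0) r1.
- exact: b.
rewrite -mulrA ler_wpM2l// (le_trans (HK _ _ _ (ltW r0) _))// subr0.
by rewrite ler_wpM2l.
Qed.

(** With [m] the supremum of [u] on the block, [u] moves by at most L (b - a) m <= m / 4. Hence m <=
    u a + m / 4, so m <= 4/3 u a, and u s >= u a - m / 4 >= 2/3 u a. *)
Lemma cumulant_block (a b L M : R) : 0 <= a -> a <= b -> 0 <= L ->
  (forall z, 0 <= z <= M -> `|Phi z| <= L * z) ->
  (forall r, a <= r <= b -> u r <= M) -> L * (b - a) <= 4^-1 ->
  forall s, a <= s <= b -> 2 / 3 * u a <= u s.
Proof.
move=> a0 ab L0 HL uM Lab.
pose J := [set u r | r in [set r | a <= r <= b]].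
have supJ : has_sup J.
  split; first by exists (u a), a => //=; rewrite lexx.
  by exists M => _ [r rab <-]; exact: uM.
set m := sup J.
have le_m r : a <= r <= b -> u r <= m.
  by move=> rab; apply: (sup_upper_bound supJ); exists r.
have u0 r : a <= r <= b -> 0 <= u r.
  by move=> /andP[ar _]; apply: (cumulant_ge0 cu); exact: le_trans ar.
have aab : a <= a <= b by rewrite lexx.
have m0 : 0 <= m by apply: le_trans (le_m a aab); exact: u0.
have close s : a <= s <= b -> `|u s - u a| <= m / 4.
  move=> /andP[as_ sb]; have := @cumulant_incr_bound a s 0 (L * m) a0 as_.
  rewrite mul0r addr0 => h; apply: (le_trans (h _)).
    move=> r /andP[ar rs]; have rab : a <= r <= b by rewrite (ltW ar) (le_trans rs).
    rewrite subr0 (le_trans (HL _ _))//; first by rewrite u0//= uM.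
    by rewrite ler_wpM2l// le_m.
  rewrite mulrAC [leLHS]mulrC ler_wpM2l//; apply: le_trans Lab.
  by rewrite ler_wpM2l// lerD2r.
have mle : m <= u a + m / 4.
  apply: ge_sup; first by exists (u a), a.
  move=> _ [r rab <-]; have := close r rab; rewrite ler_norml => /andP[_]; lra.
move=> s sab; have := close s sab; rewrite ler_norml => /andP[+ _].
by lra.
Qed.

(** Since |Phi z| <= L z on [0, M], [u] decays at most exponentially and cannot reach 0: each of
    finitely many blocks of length h with L h <= 1/4 costs a factor 2/3. *)
Lemma cumulant_bounded_below (t : R) : 0 <= t -> 0 < lambda ->
  exists2 c : R, 0 < c & forall s, 0 <= s <= t -> c <= u s.
Proof.
move=> t0 l0; have [M uM] := cumulant_locally_bounded cu t0.
have M0 : 0 <= M by apply: le_trans (uM 0 _); [exact: (cumulant_ge0 cu)|rewrite lexx].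
have [L L0 H] := lipPhi M.
have HL z : 0 <= z <= M -> `|Phi z| <= L * z.
  move=> zM; have /andP[z0 _] := zM; have := H z 0 zM.
  by rewrite Phi0 !subr0 (ger0_norm z0) lexx M0; apply.
have [n Hn] : exists n : nat, L * (t / n.+1%:R) <= 4^-1.
  exists (Num.bound (4 * L * t)); have := archi_boundP (_ : 0 <= 4 * L * t).
  rewrite !mulr_ge0// => /(_ isT) h.
  have hb : (Num.bound (4 * L * t))%:R <= (Num.bound (4 * L * t)).+1%:R :> R by rewrite ler_nat.
  by rewrite mulrA ler_pdivrMr//; lra.
set h := t / n.+1%:R in Hn.
have h0 : 0 <= h by rewrite divr_ge0.
have step k : forall s, 0 <= s <= t -> s <= k%:R * h -> (2 / 3) ^+ k * lambda <= u s.
  elim: k => [|k IH] s /andP[s0 st].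
    rewrite mul0r => sle; have -> : s = 0 by apply/eqP; rewrite eq_le sle.
    by rewrite cumulant0 expr0 mul1r.
  move=> sk; have [skh|ks] := leP s (k%:R * h).
    rewrite (le_trans _ (IH s _ skh)) ?s0// exprS -mulrA.
    by rewrite ler_piMl ?mulr_ge0 ?exprn_ge0 ?(ltW l0)//; lra.
  have a0 : 0 <= k%:R * h by rewrite mulr_ge0.
  have h1 r : k%:R * h <= r <= s -> u r <= M.
    move=> /andP[kr rs]; apply: uM; apply/andP; split; first exact: le_trans kr.
    exact: le_trans st.
  have h2 : L * (s - k%:R * h) <= 4^-1.
    apply: le_trans Hn; rewrite ler_wpM2l// lerBlDl.
    by rewrite -[X in _ + X]mul1r -mulrDl natr1.
  apply: (@le_trans _ _ (2 / 3 * u (k%:R * h))); last first.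
    by apply: (cumulant_block a0 (ltW ks) L0 HL h1 h2); rewrite lexx (ltW ks).
  rewrite exprS -mulrA ler_wpM2l//; apply: IH => //.
  by rewrite a0/=; exact: le_trans (ltW ks) st.
exists ((2 / 3) ^+ n.+1 * lambda); first by rewrite mulr_gt0 ?exprn_gt0.
move=> s st; apply: step => //; rewrite /h mulrC divfK ?pnatr_eq0//.
by case/andP: st.
Qed.

End cumulant.

(** * The Markov property at the jumps *)

Section jump_limit.
Context {R : realType}.
Implicit Types f : R -> R.

Definition jump_ramp f (a b r e : R) : R :=
  lim (ramp r e (smax n.+1 (grid f a (mesh a b n))) @[n --> \oo]).

Definition ever_jump f (a r : R) := exists2 s : R, a < s & r < jump f s.

Definition ever_jump_ind f (a r : R) : R := if `[< ever_jump f a r >] then 1 else 0.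

(** Only the two extreme cases are recorded: a largest jump between [r] and r + e leaves the value
    somewhere in [0, 1], which is harmless once the width tends to 0. *)
Lemma jump_rampP f a b r e : rcll f -> 0 <= a -> a < b -> 0 <= r -> 0 < e ->
  [/\ ramp r e (smax n.+1 (grid f a (mesh a b n))) @[n --> \oo] --> jump_ramp f a b r e,
      ~ has_jump f a b r -> jump_ramp f a b r e = 0 &
      has_jump f a b (r + e) -> jump_ramp f a b r e = 1].
Proof.
move=> cf a0 ab r0 e0; have [l [cl l0 l1]] := ramp_smax_cvg cf a0 ab r0 e0.
have -> : jump_ramp f a b r e = l by apply: cvg_lim => //; exact: Rhausdorff.
by split.
Qed.

Lemma jump_ramp_itv f a b r e : rcll f -> 0 <= a -> a < b -> 0 <= r -> 0 < e ->
  0 <= jump_ramp f a b r e <= 1.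
Proof.
move=> cf a0 ab r0 e0; have [cl _ _] := jump_rampP cf a0 ab r0 e0.
apply/andP; split.
  by apply: limr_ge; [exact: cvgP cl|apply: nearW => n; exact: ramp_ge0].
by apply: limr_le; [exact: cvgP cl|apply: nearW => n; exact: ramp_le1].
Qed.

(** For each path the sequence is eventually constant: the window comes to contain the jump time and
    the width drops below the excess of the jump over [r]. *)
Lemma jump_ramp_ever f a r : rcll f -> 0 <= a -> 0 <= r ->
  jump_ramp f a (a + m.+1%:R) r m.+1%:R^-1 @[m --> \oo] --> ever_jump_ind f a r.
Proof.
move=> cf a0 r0; have am m : a < a + m.+1%:R by rewrite ltrDl.
have m0 m : 0 < m.+1%:R^-1 :> R by rewrite invr_gt0.
rewrite /ever_jump_ind; case: asboolP => [[s as_ js]|nj]; last first.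
  apply: (@cvg_near_cst _ _ _ _ _ (@eventually_filter)); apply: nearW => m.
  have [_ h _] := jump_rampP cf a0 (am m) r0 (m0 m); apply: h.
  by move=> [s /andP[as_ _] js]; apply: nj; exists s.
apply: (@cvg_near_cst _ _ _ _ _ (@eventually_filter)).
have d0 : 0 < jump f s - r by rewrite subr_gt0.
have h1 : \forall m \near \oo, m.+1%:R^-1 < jump f s - r.
  have /cvgrPdist_lt/(_ _ d0) := @cvg_harmonic R; apply: filterS => m.
  by rewrite sub0r normrN => /(le_lt_trans (ler_norm _)).
have h2 : \forall m \near \oo, s - a <= m.+1%:R.
  exists (Num.bound (s - a)) => // m /= bm.
  have := archi_boundP (_ : 0 <= s - a); rewrite subr_ge0 ltW// => /(_ isT) h.
  by rewrite (le_trans (ltW h))// ler_nat leqW.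
near=> m; have [_ _ h] := jump_rampP cf a0 (am m) r0 (m0 m); apply: h.
exists s.
  by rewrite as_/= -lerBlDl; near: m.
by rewrite -ltrBrDl; near: m.
Unshelve. all: by end_near. Qed.

Lemma ever_jump_ind_itv f a r : 0 <= ever_jump_ind f a r <= 1.
Proof. by rewrite /ever_jump_ind; case: ifP; rewrite ?lexx ?ler01. Qed.

Lemma bmeas_ramp_smax (n : nat) (r e : R) : 0 < e ->
  bmeas (fun z : g_sigma_algebraType (@cylinder R n) => ramp r e (smax n z)).
Proof.
move=> e0; apply: (@bmeas_itv _ _ _ 0 1); last by move=> z; rewrite ramp_ge0 ramp_le1.
have mr : measurable_fun setT (ramp r e).
  by apply: continuous_measurable_fun; exact: ramp_continuous.
apply: (measurableT_comp mr).
have H k : (k <= n)%N ->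
    measurable_fun setT (fun z : g_sigma_algebraType (@cylinder R n) => smax k z).
  elim: k => [_|k IH kn].
    exact: (@measurable_cst _ _ (g_sigma_algebraType (@cylinder R n)) R setT 0).
  apply: measurable_maxr; first by apply: IH; exact: ltnW.
  by apply: measurable_funB; apply: measurable_coordinate => //; exact: ltnW.
exact: H.
Qed.

End jump_limit.

Section cb.
Context {R : realType} {d} {T : measurableType d}.
Variables (Phi : R -> R) (X : R -> T -> R) (P : R -> probability T R).
Hypothesis HX : cb_process Phi X P.

Notation past t := (g_sigma_algebraType (history X t)).

(** Negative starting points are sent to 0, so that the transition kernel is measurable on the whole
    line and no domain has to be carried along. *)
Definition law (y : R) : probability T R := P (Num.max y 0).

Lemma lawE y : 0 <= y -> law y = P y.
Proof. by move=> y0; rewrite /law max_l. Qed.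

Lemma X_measurable t : 0 <= t -> measurable_fun setT (X t).
Proof. exact: (cb_measurable HX). Qed.

Lemma past_measurable t A : 0 <= t -> natural_filtration X t A -> measurable A.
Proof.
move=> t0 FA; have sub : history X t `<=` measurable.
  move=> A' [s /= ]; rewrite in_itv/= => /andP[s0 st] [B mB <-].
  exact: X_measurable.
exact: (smallest_sub (sigma_algebra_measurable T) sub FA).
Qed.

Lemma past_bmeas t (G : T -> R) : 0 <= t -> @bmeas R _ (past t) G -> bmeas G.
Proof.
move=> t0 [mG bG]; split=> // _ B mB; rewrite setTI.
by apply: (past_measurable t0); rewrite -[X in natural_filtration _ _ X]setTI; exact: mG.
Qed.

Lemma past_adapted s t : 0 <= s -> s <= t -> @measurable_fun _ _ (past t) R setT (X s).
Proof.
move=> s0 st _ B mB; apply: sub_sigma_algebra.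
by exists s; [rewrite /= in_itv/= s0|exists B].
Qed.

Lemma past_bmeasS s t (G : T -> R) : s <= t ->
  @bmeas R _ (past s) G -> @bmeas R _ (past t) G.
Proof.
move=> st [mG bG]; split=> // _ B mB.
have sub : history X s `<=` history X t.
  move=> A [r /= ]; rewrite in_itv/= => /andP[r0 rs] h.
  by exists r => //=; rewrite in_itv/= r0 (le_trans rs).
exact: (sub_sigma_algebra2 sub (mG measurableT B mB)).
Qed.

Lemma past_bmeas_exp (lambda s t : R) : 0 <= lambda -> 0 <= s -> s <= t ->
  @bmeas R _ (past t) (fun w => expR (- (lambda * X s w))).
Proof.
move=> l0 s0 st; apply: (@bmeas_itv _ _ (past t) 0 1).
  apply: measurableT_comp => //; apply: measurable_funN.
  by apply: measurable_funM => //; exact: past_adapted.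
move=> w; rewrite expR_ge0 -expR0 ler_expR oppr_le0 mulr_ge0//.
exact: (cb_ge0 HX).
Qed.

Lemma bmeas_expX (lambda s : R) : 0 <= lambda -> 0 <= s ->
  bmeas (fun w => expR (- (lambda * X s w))).
Proof. by move=> l0 s0; apply: (past_bmeas s0); exact: past_bmeas_exp. Qed.

Lemma cb_start_integral (f : R -> R) y : 0 <= y -> bmeas f ->
  \int[P y]_w f (X 0 w) = f y.
Proof.
move=> y0 bf; have bX : bmeas (fun w => f (X 0 w)).
  by apply: bmeas_comp => //; exact: X_measurable.
apply/eqP; rewrite -subr_eq0 -[X in _ - X](bintegral_cst (P y)).
rewrite -bintegralB//; last exact: bmeas_cst.
apply/eqP; pose A := [set w | X 0 w = y].
have mA : measurable A.
  have -> : A = setT `&` X 0 @^-1` [set y] by rewrite setTI.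
  by apply: X_measurable => //; exact: measurable_set1.
apply: (bintegral_ae0 (N := ~` A)).
- by apply: bmeasB => //; exact: bmeas_cst.
- exact: measurableC.
- by rewrite probability_setC// (cb_start HX)// subee.
- by move=> w /contrapT ->; rewrite subrr.
Qed.

Definition trans (s : R) (f : R -> R) (y : R) : R := \int[law y]_w f (X s w).

Lemma bkernel_trans s : 0 <= s -> bkernel (trans s).
Proof.
move=> s0; apply: (@bkernel_prob R _ _ _ R R T measurable law (X s)).
- exact: measurable_self_generated.
- by move=> A B; exact: measurableI.
- exact: X_measurable.
move=> B mB.
rewrite (_ : (fun s' => _) = fine \o (fun y => P (Num.max y 0) (X s @^-1` B))); last first.
  apply/funext => y /=; rewrite -bintegral_indic//.
  by rewrite -[X in measurable X]setTI; exact: X_measurable.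
apply: measurableT_comp => //.
have h := cb_kernel HX s0 mB.
have mm : measurable_fun setT (fun y : R => Num.max y 0).
  by apply: measurable_maxr => //; exact: measurable_cst.
apply: (measurable_comp _ _ h mm) => // _ [y _ <-] /=.
by rewrite in_itv/= andbT le_max lexx orbT.
Qed.

(** Two monotone class arguments extend [cb_markov]: in [f] for the indicator of a fixed past event,
    then in [G] over the past sigma-algebra. *)
Lemma markov x s t (G : T -> R) (f : R -> R) : 0 <= x -> 0 <= s -> 0 <= t ->
  @bmeas R _ (past t) G -> bmeas f ->
  \int[P x]_w (G w * f (X (t + s) w)) = \int[P x]_w (G w * trans s f (X t w)).
Proof.
move=> x0 s0 t0 bG bf.
have ts0 : 0 <= t + s by exact: addr_ge0.
have bh1 : bmeas (fun w => f (X (t + s) w)).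
  by apply: bmeas_comp => //; exact: X_measurable.
have bh2 : bmeas (fun w => trans s f (X t w)).
  by apply: bmeas_comp; [exact: (bker_bmeas (bkernel_trans s0))|exact: X_measurable].
have bkid : bkernel (fun (G : past t -> R) (w : T) => G w).
  by split=> // G' bG'; exact: (past_bmeas t0).
have mid : measurable_fun setT (@id T) by exact: measurable_id.
have main (A : set T) : natural_filtration X t A ->
    \int[P x]_w (\1_A w * f (X (t + s) w)) = \int[P x]_w (\1_A w * trans s f (X t w)).
  move=> FA; have mA := past_measurable t0 FA.
  have bA : bmeas (\1_A : T -> R) by exact: bmeas_indic.
  move: f bf {bh1 bh2}; apply: (@bfunctional_ext R _ R measurable).
  - exact: measurable_self_generated.
  - by move=> B C; exact: measurableI.
  - exact: (bfunctional_integral (P x) bkernel_id bA (X_measurable ts0)).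
  - exact: (bfunctional_integral (P x) (bkernel_trans s0) bA (X_measurable t0)).
  - by rewrite /trans; under [RHS]eq_Rintegral do rewrite bintegral_cst.
  move=> B mB.
  have mXB : measurable (X (t + s) @^-1` B).
    by rewrite -[X in measurable X]setTI; exact: X_measurable.
  have mXsB : measurable (X s @^-1` B).
    by rewrite -[X in measurable X]setTI; exact: X_measurable.
  transitivity (fine (P x (A `&` X (t + s) @^-1` B))).
    rewrite -bintegral_indic; last exact: measurableI.
    by apply: eq_Rintegral => w _; rewrite indicI.
  rewrite (cb_markov HX x0 s0 t0 FA mB) /Rintegral; congr fine.
  rewrite [LHS]integral_mkcond; apply: eq_integral => w _; rewrite patchE.
  rewrite indicE; case: ifPn => wA; last by rewrite mul0r.
  rewrite mul1r /trans lawE ?(cb_ge0 HX)// bintegral_indic//.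
  by rewrite fineK// fin_num_measure.
have /= := @bfunctional_ext R _ (past t) measurable
  (fun G' => \int[P x]_w (f (X (t + s) w) * G' (id w)))
  (fun G' => \int[P x]_w (trans s f (X t w) * G' (id w))).
move=> /(_ measurable_self_generated _ _ _ _ _ G bG) H.
under eq_Rintegral do rewrite mulrC; under [RHS]eq_Rintegral do rewrite mulrC.
apply: H.
- by move=> A B; exact: measurableI.
- exact: (bfunctional_integral (P x) bkid bh1 mid).
- exact: (bfunctional_integral (P x) bkid bh2 mid).
- have FT : natural_filtration X t setT by exact: (@measurableT _ (past t)).
  have := main _ FT.
  under eq_Rintegral do rewrite indicT mul1r.
  under [in RHS]eq_Rintegral do rewrite indicT mul1r.
  move=> h.
  by under eq_Rintegral do rewrite mulr1; under [RHS]eq_Rintegral do rewrite mulr1.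
- move=> A mA; under eq_Rintegral do rewrite mulrC.
  by under [RHS]eq_Rintegral do rewrite mulrC; exact: main.
Qed.

End cb.

(** * The branching property *)

Lemma rcllD {R : realType} (f g : R -> R) : rcll f -> rcll g ->
  rcll (fun t => f t + g t).
Proof.
move=> [rf lf] [rg lg]; split=> t t0; first by apply: cvgD; [exact: rf|exact: rg].
by apply: is_cvgD; [exact: lf|exact: lg].
Qed.

Lemma jumpD {R : realType} (f g : R -> R) t : rcll f -> rcll g -> 0 < t ->
  jump (fun t => f t + g t) t = jump f t + jump g t.
Proof.
move=> [_ lf] [_ lg] t0; rewrite /jump limD; [|exact: lf|exact: lg].
by rewrite opprD addrACA.
Qed.

Section cb_laplace.
Context {R : realType} {d} {T : measurableType d}.
Variables (Phi : R -> R) (X : R -> T -> R) (P : R -> probability T R).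
Hypothesis HX : cb_process Phi X P.
Variable v : R -> R -> R.
Hypothesis v_ge0 : forall t lambda : R, 0 <= t -> 0 <= lambda -> 0 <= v t lambda.
Hypothesis laplaceE : forall x t lambda : R, 0 <= x -> 0 <= t -> 0 <= lambda ->
  \int[P x]_w expR (- (lambda * X t w)) = expR (- (x * v t lambda)).

Notation past t := (g_sigma_algebraType (history X t)).
Notation law := (law P).
Notation trans := (trans X P).

Let X0 t w : 0 <= t -> 0 <= X t w. Proof. exact: (cb_ge0 HX). Qed.
Let mX t : 0 <= t -> measurable_fun setT (X t). Proof. exact: (X_measurable HX). Qed.
Let maxX t w : 0 <= t -> Num.max (X t w) 0 = X t w.
Proof. by move=> t0; rewrite max_l ?X0. Qed.

Lemma trans_exp s lambda y : 0 <= s -> 0 <= lambda -> 0 <= y ->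
  trans s (fun z => expR (- (lambda * Num.max z 0))) y = expR (- (v s lambda * y)).
Proof.
move=> s0 l0 y0; rewrite /trans lawE// mulrC -laplaceE//.
by under eq_Rintegral do rewrite maxX//.
Qed.

Lemma laplace_markov x s t lambda (G : T -> R) : 0 <= x -> 0 <= s -> 0 <= t ->
  0 <= lambda -> @bmeas R _ (past t) G ->
  \int[P x]_w (G w * expR (- (lambda * X (t + s) w))) =
  \int[P x]_w (G w * expR (- (v s lambda * X t w))).
Proof.
move=> x0 s0 t0 l0 bG; have ts0 : 0 <= t + s by exact: addr_ge0.
have := markov HX x0 s0 t0 bG (bmeas_exp_max l0).
under eq_Rintegral do rewrite maxX//; move=> ->.
by apply: eq_Rintegral => w _; rewrite trans_exp// X0.
Qed.

Lemma grid_past t h (f : R -> R) (n k : nat) : 0 <= t -> 0 <= h -> (k <= n)%N ->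
  bmeas f -> @bmeas R _ (past (t + n%:R * h)) (fun w => f (X (t + k%:R * h) w)).
Proof.
move=> t0 h0 kn bf; apply: (@bmeas_comp _ _ _ (past (t + n%:R * h)) _ f) => //.
apply: past_adapted; first by rewrite addr_ge0 ?mulr_ge0.
by rewrite lerD2l ler_wpM2r// ler_nat.
Qed.

Lemma prod_grid_past t h (b : nat -> R -> R) (n : nat) : 0 <= t -> 0 <= h ->
  (forall k, bmeas (b k)) ->
  @bmeas R _ (past (t + n%:R * h)) (fun w => \prod_(k < n.+1) b k (X (t + k%:R * h) w)).
Proof.
move=> t0 h0 bb; have H m : (m <= n.+1)%N ->
    @bmeas R _ (past (t + n%:R * h)) (fun w => \prod_(k < m) b k (X (t + k%:R * h) w)).
  elim: m => [_|m IH mn].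
    apply: (@eq_bmeas _ _ (past (t + n%:R * h)) (fun=> 1)); last exact: bmeas_cst.
    by move=> w; rewrite big_ord0.
  apply: (@eq_bmeas _ _ (past (t + n%:R * h)) (fun w =>
    (\prod_(k < m) b k (X (t + k%:R * h) w)) * b m (X (t + m%:R * h) w))).
    by move=> w; rewrite big_ord_recr.
  by apply: bmeasM; [apply: IH; exact: ltnW|exact: grid_past].
exact: H.
Qed.

Definition law_grid (h : R) (k : nat) (w : T) : R := grid (X ^~ w) 0 h k.

(** The weight [G] may be anything known at time [t]; [chain_law] then turns this into the Markov
    property at [t] for functionals of the whole later grid. *)
Lemma cb_chain x t h (G : T -> R) : 0 <= x -> 0 <= t -> 0 <= h ->
  @bmeas R _ (past t) G ->
  chain_property law (law_grid h) (P x) G (fun k w => grid (X ^~ w) t h k).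
Proof.
move=> x0 t0 h0 bG n b f bb bf; rewrite /grid /law_grid /grid.
have tn0 : 0 <= t + n%:R * h by rewrite addr_ge0 ?mulr_ge0.
have bW : @bmeas R _ (past (t + n%:R * h))
    (fun w => G w * \prod_(k < n.+1) b k (X (t + k%:R * h) w)).
  apply: bmeasM; last exact: prod_grid_past.
  by apply: (past_bmeasS (s := t)) => //; rewrite lerDl mulr_ge0.
have := markov HX x0 h0 tn0 bW bf; rewrite /trans.
under eq_Rintegral do rewrite -mulrA.
under [X in _ = X -> _]eq_Rintegral do rewrite -mulrA.
have -> : t + n%:R * h + h = t + n.+1%:R * h by rewrite -natr1 mulrDl mul1r addrA.
move=> ->; apply: eq_Rintegral => w _.
by rewrite add0r mul1r.
Qed.

Section chain_kernel_facts.
Variable h : R.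
Hypothesis h0 : 0 <= h.

Let hk0 k : 0 <= 0 + k%:R * h. Proof. by rewrite add0r mulr_ge0. Qed.

Lemma law_grid_measurable k : measurable_fun setT (law_grid h k).
Proof. exact: mX. Qed.

Lemma law_grid_kernel : bkernel (fun (f : R -> R) y => \int[law y]_w f (law_grid h 1%N w)).
Proof. exact: (bkernel_trans HX (hk0 1%N)). Qed.

Lemma law_grid_start (f : R -> R) y : 0 <= y -> bmeas f ->
  \int[law y]_w f (law_grid h 0%N w) = f y.
Proof.
by move=> y0 bf; rewrite lawE// /law_grid /grid mul0r addr0 (cb_start_integral HX).
Qed.

Lemma law_grid_start_bmeas (f : R -> R) : bmeas f ->
  bmeas (fun y => \int[law y]_w f (law_grid h 0%N w)).
Proof. by move=> bf; exact: (bker_bmeas (bkernel_trans HX (hk0 0%N))). Qed.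

Lemma law_grid_chain y : chain_property law (law_grid h) (law y) (fun=> 1) (law_grid h).
Proof.
by apply: cb_chain => //; [rewrite le_max lexx orbT|exact: bmeas_cst].
Qed.

Lemma law_grid_functional n : bkernel
  (fun (g : g_sigma_algebraType (@cylinder R n) -> R) y => \int[law y]_w g (law_grid h ^~ w)).
Proof.
apply: chain_kernel; [exact: law_grid_measurable|exact: law_grid_kernel|
  exact: law_grid_start|exact: law_grid_start_bmeas|exact: law_grid_chain].
Qed.

Lemma law_grid_chain_law {d'} {T' : measurableType d'} (mu : probability T' R)
    (W : T' -> R) (Z : nat -> T' -> R) n :
  bmeas W -> (forall k, measurable_fun setT (Z k)) -> (forall w, 0 <= Z 0%N w) ->
  chain_property law (law_grid h) mu W Z ->
  forall g : g_sigma_algebraType (@cylinder R n) -> R, bmeas g ->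
  \int[mu]_w (W w * g (Z ^~ w)) =
  \int[mu]_w (W w * \int[law (Z 0%N w)]_w' g (law_grid h ^~ w')).
Proof.
apply: chain_law; [exact: law_grid_measurable|exact: law_grid_kernel|
  exact: law_grid_start|exact: law_grid_start_bmeas|exact: law_grid_chain].
Qed.

End chain_kernel_facts.

Section branching_chain.
Variables x y h : R.
Hypotheses (x0 : 0 <= x) (y0 : 0 <= y) (h0 : 0 <= h).
Notation PP := ((P x \x P y)%E : probability (T * T)%type R).

Definition sum_path (z : T * T) (t : R) : R := X t z.1 + X t z.2.

Let hk0 k : 0 <= 0 + k%:R * h. Proof. by rewrite add0r mulr_ge0. Qed.

Let mX1 t : 0 <= t -> measurable_fun setT (fun z : T * T => X t z.1).
Proof. by move=> t0; apply: (measurableT_comp (mX t0)). Qed.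

Let mX2 t : 0 <= t -> measurable_fun setT (fun z : T * T => X t z.2).
Proof. by move=> t0; apply: (measurableT_comp (mX t0)). Qed.

Lemma sum_path_measurable t : 0 <= t -> measurable_fun setT (fun z => sum_path z t).
Proof. by move=> t0; apply: measurable_funD; [exact: mX1|exact: mX2]. Qed.

Let Z k z := grid (sum_path z) 0 h k.

Let mZ k : measurable_fun setT (Z k).
Proof. exact: sum_path_measurable. Qed.

Let Z_ge0 k z : 0 <= Z k z.
Proof. by rewrite addr_ge0// X0. Qed.

(** The sum is again a chain because the Laplace exponent is linear in the starting point: e^{- v x}
    e^{- v y} depends on x + y only. By [laplace_unique] exponentials suffice, and the Markov
    property is applied to one coordinate at a time. *)
Lemma sum_chain : chain_property law (law_grid h) PP (fun=> 1) Z.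
Proof.
move=> n b f bb bf.
under eq_Rintegral do rewrite mul1r; under [RHS]eq_Rintegral do rewrite mul1r.
pose W z := \prod_(k < n.+1) b k (Z k z).
have bW : bmeas W by apply: (bmeas_prod (F := fun k z => b k (Z k z))) => k; exact: bmeas_comp.
move: f bf; apply: laplace_unique.
- exact: (bfunctional_integral PP bkernel_id bW (mZ n.+1)).
- exact: (bfunctional_integral PP (law_grid_kernel h0) bW (mZ n)).
- by move=> f g bf bg fg; apply: eq_Rintegral => z _; rewrite fg.
- move=> f g bf bg fg; apply: eq_Rintegral => z _; congr (_ * _).
  by apply: eq_Rintegral => w _; rewrite fg// X0.
move=> lambda l0; set t := 0 + n%:R * h.
have t0 : 0 <= t by exact: hk0.
have tS : 0 + n.+1%:R * h = t + h by rewrite /t -natr1 mulrDl mul1r addrA.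
have vh0 : 0 <= v h lambda by exact: v_ge0.
pose E1 c s (z : T * T) := expR (- (c * X s z.1)).
pose E2 c s (z : T * T) := expR (- (c * X s z.2)).
have bE1 c s : 0 <= c -> 0 <= s -> bmeas (E1 c s).
  by move=> c0 s0; apply: (bmeas_comp (Z := fst) (bmeas_expX HX c0 s0)).
have bE2 c s : 0 <= c -> 0 <= s -> bmeas (E2 c s).
  by move=> c0 s0; apply: (bmeas_comp (Z := snd) (bmeas_expX HX c0 s0)).
have th0 : 0 <= t + h by exact: addr_ge0.
have bP w2 : @bmeas R _ (past t) (fun w1 => W (w1, w2)).
  have := @prod_grid_past 0 h (fun k z => b k (z + X (0 + k%:R * h) w2)) n (lexx 0) h0.
  apply=> k; apply: (bmeas_comp (Z := fun z : R => z + X (0 + k%:R * h) w2)) => //.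
  by apply: measurable_funD => //; exact: measurable_cst.
have bP' w1 : @bmeas R _ (past t) (fun w2 => W (w1, w2)).
  have := @prod_grid_past 0 h (fun k z => b k (X (0 + k%:R * h) w1 + z)) n (lexx 0) h0.
  apply=> k; apply: (bmeas_comp (Z := fun z : R => X (0 + k%:R * h) w1 + z)) => //.
  by apply: measurable_funD => //; exact: measurable_cst.
transitivity (\int[PP]_z (W z * E1 lambda (t + h) z * E2 lambda (t + h) z)).
  apply: eq_Rintegral => z _; rewrite -/(W z) -mulrA; congr (_ * _).
  rewrite max_l ?Z_ge0// /E1 /E2 -expRD; congr expR.
  by rewrite /Z /grid /sum_path tS mulrDr opprD.
(* With the second path frozen, [W] is known at time [t] for the first one, so the Markov property
   applies to that coordinate. *)
transitivity (\int[PP]_z (W z * E1 (v h lambda) t z * E2 lambda (t + h) z)).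
  rewrite !bfubini2; do ?by apply: bmeasM; [apply: bmeasM => //|]; auto.
  apply: eq_Rintegral => w2 _ /=.
  rewrite /E2 /=; set e := expR _.
  have bA : bmeas (fun w1 => W (w1, w2) * E1 lambda (t + h) (w1, w2)).
    by apply: bmeasM; [exact: (past_bmeas HX t0 (bP w2))|exact: (bmeas_expX HX)].
  have bB : bmeas (fun w1 => W (w1, w2) * E1 (v h lambda) t (w1, w2)).
    by apply: bmeasM; [exact: (past_bmeas HX t0 (bP w2))|exact: (bmeas_expX HX)].
  under eq_Rintegral do rewrite mulrC; under [RHS]eq_Rintegral do rewrite mulrC.
  rewrite !bintegralZ//; congr (_ * _); exact: (laplace_markov x0 h0 t0 l0 (bP w2)).
transitivity (\int[PP]_z (W z * E1 (v h lambda) t z * E2 (v h lambda) t z)).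
  rewrite !bfubini1; do ?by apply: bmeasM; [apply: bmeasM => //|]; auto.
  apply: eq_Rintegral => w1 _ /=.
  have bG : @bmeas R _ (past t) (fun w2 => W (w1, w2) * E1 (v h lambda) t (w1, w2)).
    apply: bmeasM; first exact: bP'.
    exact: (@bmeas_cst _ _ (past t) (expR (- (v h lambda * X t w1)))).
  exact: (laplace_markov y0 h0 t0 l0 bG).
apply: eq_Rintegral => z _; rewrite -/(W z) -mulrA; congr (_ * _).
have -> : \int[law (Z n z)]_w' expR (- (lambda * Num.max (law_grid h 1%N w') 0)) =
    trans h (fun z => expR (- (lambda * Num.max z 0))) (Z n z).
  by apply: eq_Rintegral => w _; rewrite /law_grid /grid add0r mul1r.
rewrite trans_exp// /E1 /E2 -expRD; congr expR.
by rewrite /Z /grid /sum_path mulrDr opprD.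
Qed.

Lemma sum_law n (g : g_sigma_algebraType (@cylinder R n) -> R) : bmeas g ->
  \int[PP]_z g (grid (sum_path z) 0 h) = \int[P (x + y)]_w g (law_grid h ^~ w).
Proof.
move=> bg; have bpsi := bker_bmeas (law_grid_functional h0 n) bg.
have := law_grid_chain_law h0 (bmeas_cst 1) mZ (Z_ge0 0%N) sum_chain bg.
under eq_Rintegral do rewrite mul1r; move=> ->.
under eq_Rintegral do rewrite mul1r.
set psi := (fun y => _) in bpsi.
have EZ z : Z 0%N z = X 0 z.1 + X 0 z.2 by rewrite /Z /grid mul0r addr0.
have -> : \int[P (x + y)]_w g (law_grid h ^~ w) = psi (x + y).
  by rewrite /psi lawE// addr_ge0.
transitivity (\int[PP]_z psi (X 0 z.1 + X 0 z.2)).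
  by apply: eq_Rintegral => z _; rewrite /psi EZ.
rewrite bfubini1/=; last first.
  apply: (bmeas_comp (f := psi)) => //.
  by apply: measurable_funD; [exact: mX1|exact: mX2].
transitivity (\int[P x]_w psi (X 0 w + y)).
  apply: eq_Rintegral => w _.
  rewrite (cb_start_integral HX (f := fun z => psi (X 0 w + z)))//.
  apply: (bmeas_comp (f := psi)) => //.
  by apply: measurable_funD => //; exact: measurable_cst.
rewrite (cb_start_integral HX (f := fun z => psi (z + y)))//.
apply: (bmeas_comp (f := psi)) => //.
by apply: measurable_funD => //; exact: measurable_cst.
Qed.

End branching_chain.

End cb_laplace.

Lemma bintegral_negligible {R : realType} {d} {T : measurableType d}
    (mu : probability T R) (f : T -> R) (N : set T) : bmeas f ->
  mu.-negligible N -> (forall w, ~ N w -> f w = 0) -> \int[mu]_w f w = 0.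
Proof.
move=> bf [A [mA A0 NA]] fN; apply: (bintegral_ae0 bf mA A0) => w nA.
by apply: fN => /NA.
Qed.

(** * Measurability of jump functionals of a right-continuous process *)

Section rcll_process.
Context {R : realType} {d} {T : measurableType d}.
Variables (mu : probability T R) (Z : T -> R -> R).
Hypothesis rZ : forall w, rcll (Z w).
Hypothesis mZ : forall t, 0 <= t -> measurable_fun setT (Z ^~ t).

Lemma bmeas_ramp_grid a b r e n : 0 <= a -> a < b -> 0 < e ->
  bmeas (fun w => ramp r e (smax n.+1 (grid (Z w) a (mesh a b n)))).
Proof.
move=> a0 ab e0.
apply: (bmeas_comp (Z := fun w => (fun k => grid (Z w) a (mesh a b n) k) :
  g_sigma_algebraType (@cylinder R n.+1)) (bmeas_ramp_smax n.+1 r e0)).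
apply: (measurable_to_cylinder (Z := fun k w => grid (Z w) a (mesh a b n) k)) => k.
by apply: mZ; rewrite addr_ge0// mulr_ge0// ltW// mesh_gt0.
Qed.

Lemma bmeas_jump_ramp a b r e : 0 <= a -> a < b -> 0 <= r -> 0 < e ->
  bmeas (fun w => jump_ramp (Z w) a b r e).
Proof.
move=> a0 ab r0 e0; apply: (@bmeas_itv _ _ _ 0 1); last by move=> w; exact: jump_ramp_itv.
apply: (measurable_fun_cvg (h := fun n w => ramp r e (smax n.+1 (grid (Z w) a (mesh a b n))))).
  by move=> n; have [] := bmeas_ramp_grid r n a0 ab e0.
by move=> w _; have [] := jump_rampP (rZ w) a0 ab r0 e0.
Qed.

Lemma jump_ramp_integral_cvg (W : T -> R) a b r e : bmeas W ->
  0 <= a -> a < b -> 0 <= r -> 0 < e ->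
  \int[mu]_w (W w * ramp r e (smax n.+1 (grid (Z w) a (mesh a b n)))) @[n --> \oo] -->
  \int[mu]_w (W w * jump_ramp (Z w) a b r e).
Proof.
move=> bW a0 ab r0 e0; have [_ [M WM]] := bW.
apply: (bintegral_cvg (M := M * 1)) => [n|n w||w].
- by apply: bmeasM => //; exact: bmeas_ramp_grid.
- by rewrite normrM ler_pM// ger0_norm ?ramp_ge0// ramp_le1.
- by apply: bmeasM => //; exact: bmeas_jump_ramp.
- by apply: cvgMr; have [] := jump_rampP (rZ w) a0 ab r0 e0.
Qed.

Lemma bmeas_ever_jump a r : 0 <= a -> 0 <= r ->
  bmeas (fun w => ever_jump_ind (Z w) a r).
Proof.
move=> a0 r0; apply: (@bmeas_itv _ _ _ 0 1); last by move=> w; exact: ever_jump_ind_itv.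
apply: (measurable_fun_cvg (h := fun m w => jump_ramp (Z w) a (a + m.+1%:R) r m.+1%:R^-1)).
  have am m : a < a + m.+1%:R by rewrite ltrDl.
  have m0 m : 0 < m.+1%:R^-1 :> R by rewrite invr_gt0.
  by move=> m; have [] := bmeas_jump_ramp a0 (am m) r0 (m0 m).
by move=> w _; exact: (jump_ramp_ever (rZ w) a0 r0).
Qed.

Lemma ever_jump_integral_cvg (W : T -> R) a r : bmeas W -> 0 <= a -> 0 <= r ->
  \int[mu]_w (W w * jump_ramp (Z w) a (a + m.+1%:R) r m.+1%:R^-1) @[m --> \oo] -->
  \int[mu]_w (W w * ever_jump_ind (Z w) a r).
Proof.
move=> bW a0 r0; have [_ [M WM]] := bW.
have am m : a < a + m.+1%:R by rewrite ltrDl.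
have m0 m : 0 < m.+1%:R^-1 :> R by rewrite invr_gt0.
apply: (bintegral_cvg (M := M * 1)) => [m|m w||w].
- by apply: bmeasM => //; exact: bmeas_jump_ramp.
- have /andP[h0 h1] := jump_ramp_itv (rZ w) a0 (am m) r0 (m0 m).
  by rewrite normrM ler_pM// ger0_norm.
- by apply: bmeasM => //; exact: bmeas_ever_jump.
- by apply: cvgMr; exact: (jump_ramp_ever (rZ w) a0 r0).
Qed.

End rcll_process.

(* Each jump time is isolated from the left among jumps of comparable size, so
   it is determined by a rational to its left and a bound on the jump. *)
Lemma rcll_jump_times {R : realType} (f : R -> R) : rcll f ->
  exists2 sigma : nat -> R, forall n, 0 < sigma n &
    forall s, 0 < s -> jump f s != 0 -> exists n, sigma n = s.
Proof.
move=> cf.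
pose det (qm : rat * nat) s := [/\ 0 < s, ratr qm.1 < s,
  qm.2.+1%:R^-1 < `|jump f s| &
  forall u, ratr qm.1 < u < s -> `|f u - left_limit f s| < qm.2.+1%:R^-1 / 4].
(* If s < s' were both determined, [f] at [s] and just before [s] would be within e / 4 of the left
   limit at s'; the jump at [s] would be below 3 e / 4, whereas its size exceeds [e]. *)
have uniq qm s s' : det qm s -> det qm s' -> s < s' -> False.
  move=> [s0 qs js Hs] [s'0 qs' js' Hs'] ss'.
  set e : R := qm.2.+1%:R^-1 in js Hs js' Hs'.
  have e0 : 0 < e by rewrite invr_gt0.
  have fs := Hs' s; rewrite qs ss' in fs; have {}fs := fs isT.
  have [dl dl0 Hl] := rcll_left cf s0 (divr_gt0 e0 (ltr0n R 4)).
  pose u := Num.max ((ratr qm.1 + s) / 2) (s - dl / 2).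
  have qu : ratr qm.1 < u by rewrite lt_max; apply/orP; left; lra.
  have us : u < s by rewrite gt_max; apply/andP; split; lra.
  have du : s - dl < u by rewrite lt_max; apply/orP; right; lra.
  have := Hl u; rewrite du us => /(_ isT).
  have := Hs' u; rewrite qu (lt_trans us ss') => /(_ isT).
  move: fs js; rewrite /jump -/(left_limit f s).
  rewrite !ltr_norml ltr_normr => /andP[a1 a2] /orP A /andP[b1 b2] /andP[c1 c2].
  by case: A; lra.
(* Codes that determine nothing get the value 1, an arbitrary positive time: no positive time is a
   fixed jump time, so extra entries are harmless. *)
pose sigma n : R := if unpickle n is Some qm then
  (if pselect (exists s, det qm s) is left h then sval (cid h) else 1) else 1.
exists sigma => [n|s s0 js].
  rewrite /sigma; case: (unpickle n) => [qm|//]; case: pselect => [h|//].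
  by case: (cid h) => s [].
have j0 : 0 < `|jump f s| by rewrite normr_gt0.
have [m Hm] : exists m : nat, m.+1%:R^-1 < `|jump f s|.
  exists (Num.bound `|jump f s|^-1); rewrite invf_plt ?posrE//.
  apply: (lt_le_trans (archi_boundP _)); first by rewrite invr_ge0 ltW.
  by rewrite ler_nat.
have e0 : 0 < m.+1%:R^-1 / 4 :> R by rewrite divr_gt0.
have [dl dl0 Hl] := rcll_left cf s0 e0.
have sdl : s - dl < s by rewrite gtrBl.
have [q] := rat_in_itvoo sdl.
rewrite in_itv/= => /andP[dq qs].
have dqm : det (q, m) s.
  split=> //= u /andP[qu us]; apply: Hl; rewrite us andbT; exact: lt_trans dq qu.
exists (pickle (q, m)); rewrite /sigma pickleK; case: pselect => [h|[]]; last by exists s.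
case: (cid h) => s' /= dqm'; have [ss'|s's|//] := ltgtP s' s.
  by exfalso; exact: uniq dqm' dqm ss'.
by exfalso; exact: uniq dqm dqm' s's.
Qed.

Section cb_jumps.
Context {R : realType} {d} {T : measurableType d}.
Variables (Phi : R -> R) (X : R -> T -> R) (P : R -> probability T R).
Hypothesis HX : cb_process Phi X P.
Variable v : R -> R -> R.
Hypothesis v_ge0 : forall t lambda : R, 0 <= t -> 0 <= lambda -> 0 <= v t lambda.
Hypothesis v_init : forall lambda : R, 0 <= lambda -> v 0 lambda = lambda.
Hypothesis v_lip : forall t lambda : R, 0 <= t -> 0 <= lambda -> exists2 K : R, 0 <= K &
  forall r s : R, 0 <= r -> r <= s -> s <= t -> `|v s lambda - v r lambda| <= K * (s - r).
Hypothesis laplaceE : forall x t lambda : R, 0 <= x -> 0 <= t -> 0 <= lambda ->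
  \int[P x]_w expR (- (lambda * X t w)) = expR (- (x * v t lambda)).

Notation past t := (g_sigma_algebraType (history X t)).
Notation law := (law P).

Let X0 t w : 0 <= t -> 0 <= X t w. Proof. exact: (cb_ge0 HX). Qed.
Let mX t : 0 <= t -> measurable_fun setT (X t). Proof. exact: (X_measurable HX). Qed.
Let rX w : rcll (X ^~ w). Proof. exact: (cb_rcll HX). Qed.

Section law_ramp.
Variables N r e : R.
Hypotheses (N0 : 0 < N) (r0 : 0 <= r) (e0 : 0 < e).

Let h n := mesh 0 N n.
Let h0 n : 0 <= h n. Proof. exact/ltW/mesh_gt0. Qed.

Definition law_ramp n y :=
  \int[law y]_w ramp r e (smax n.+1 (law_grid X (mesh 0 N n) ^~ w)).

Lemma law_ramp_bmeas n : bmeas (law_ramp n).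
Proof.
exact: (bker_bmeas (law_grid_functional HX (h0 n) n.+1) (bmeas_ramp_smax n.+1 r e0)).
Qed.

Lemma law_ramp_cvg y :
  law_ramp n y @[n --> \oo] --> \int[law y]_w jump_ramp (X ^~ w) 0 N r e.
Proof.
have := @jump_ramp_integral_cvg _ _ _ (law y) (fun w => X ^~ w) rX mX (fun=> 1) 0 N r e
  (bmeas_cst 1) (lexx 0) N0 r0 e0.
under eq_fun do under eq_Rintegral do rewrite mul1r.
by under [in X in _ --> X -> _]eq_Rintegral do rewrite mul1r.
Qed.

Lemma law_ramp_le1 n y : `|law_ramp n y| <= 1.
Proof.
apply: bintegral_bound => [|w]; last by rewrite ger0_norm ?ramp_ge0// ramp_le1.
exact: (bmeas_ramp_grid (Z := fun w => X ^~ w) mX r n (lexx 0) N0 e0).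
Qed.

Lemma law_jump_ramp_le1 y : `|\int[law y]_w jump_ramp (X ^~ w) 0 N r e| <= 1.
Proof.
apply: bintegral_bound; first exact: (bmeas_jump_ramp (Z := fun w => X ^~ w)).
move=> w; have /andP[? ?] := jump_ramp_itv (rX w) (lexx 0) N0 r0 e0.
by rewrite ger0_norm.
Qed.

Lemma law_jump_ramp_bmeas : bmeas (fun y => \int[law y]_w jump_ramp (X ^~ w) 0 N r e).
Proof.
split; last by exists 1; exact: law_jump_ramp_le1.
apply: (measurable_fun_cvg (h := law_ramp)) => [n|y _]; last exact: law_ramp_cvg.
by have [] := law_ramp_bmeas n.
Qed.

(** For each mesh, the grid of [t, t + N] along [X] has, given the past, the law of the grid of
    [0, N] along a copy started at X_t; the mesh then tends to 0 on both sides. *)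
Lemma jump_ramp_markov x t (G : T -> R) : 0 <= x -> 0 <= t -> @bmeas R _ (past t) G ->
  \int[P x]_w (G w * jump_ramp (X ^~ w) t (t + N) r e) =
  \int[P x]_w (G w * \int[law (X t w)]_w' jump_ramp (X ^~ w') 0 N r e).
Proof.
move=> x0 t0 bG; have tN : t < t + N by rewrite ltrDl.
have bG' := past_bmeas HX t0 bG.
have hE n : mesh t (t + N) n = h n by rewrite /h /mesh addrAC subrr add0r subr0.
have h1 := @jump_ramp_integral_cvg _ _ _ (P x) (fun w => X ^~ w) rX mX G t (t + N) r e
   bG' t0 tN r0 e0.
apply: (cvg_unique _ h1); first exact: Rhausdorff.
have [_ [M GM]] := bG'.
have -> : (fun n => \int[P x]_w (G w * ramp r e (smax n.+1 (grid (X ^~ w) t (mesh t (t + N) n)))))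
    = (fun n => \int[P x]_w (G w * law_ramp n (X t w))).
  apply/funext => n; rewrite hE.
  have mZ k : measurable_fun setT (fun w => grid (X ^~ w) t (h n) k).
    by apply: mX; rewrite addr_ge0// mulr_ge0.
  have Z0 w : 0 <= grid (X ^~ w) t (h n) 0%N by rewrite X0// addr_ge0// mulr_ge0.
  rewrite (law_grid_chain_law HX (h0 n) bG' mZ Z0 (cb_chain HX x0 t0 (h0 n) bG)
    (bmeas_ramp_smax n.+1 r e0)).
  by apply: eq_Rintegral => w _; rewrite /law_ramp /grid mul0r addr0.
apply: (bintegral_cvg (M := M * 1)) => [n|n w||w].
- by apply: bmeasM => //; apply: bmeas_comp (law_ramp_bmeas n) (mX t0).
- by rewrite normrM ler_pM// law_ramp_le1.
- by apply: bmeasM => //; apply: bmeas_comp law_jump_ramp_bmeas (mX t0).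
- by apply: cvgMr; exact: law_ramp_cvg.
Qed.

End law_ramp.

Lemma ever_jump_markov x t r (G : T -> R) : 0 <= x -> 0 <= t -> 0 <= r ->
  @bmeas R _ (past t) G ->
  \int[P x]_w (G w * ever_jump_ind (X ^~ w) t r) =
  \int[P x]_w (G w * \int[P (X t w)]_w' ever_jump_ind (X ^~ w') 0 r).
Proof.
move=> x0 t0 r0 bG; have bG' := past_bmeas HX t0 bG.
have m0 m : 0 < m.+1%:R^-1 :> R by rewrite invr_gt0.
have S0 m : 0 < m.+1%:R :> R by rewrite ltr0n.
pose psi m y := \int[law y]_w jump_ramp (X ^~ w) 0 m.+1%:R r m.+1%:R^-1.
have bpsi m : bmeas (psi m) by exact: law_jump_ramp_bmeas.
have psi1 m y : `|psi m y| <= 1 by exact: law_jump_ramp_le1.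
pose psi' y := \int[law y]_w ever_jump_ind (X ^~ w) 0 r.
have cpsi y : psi m y @[m --> \oo] --> psi' y.
  have := @ever_jump_integral_cvg _ _ _ (law y) (fun w => X ^~ w) rX mX (fun=> 1) 0 r
    (bmeas_cst 1) (lexx 0) r0.
  under eq_fun do under eq_Rintegral do rewrite mul1r add0r.
  by under [in X in _ --> X -> _]eq_Rintegral do rewrite mul1r.
have bpsi' : bmeas psi'.
  split; first by apply: (measurable_fun_cvg (h := psi)) => [m|y _//]; have [] := bpsi m.
  exists 1 => y; apply: bintegral_bound.
    exact: (bmeas_ever_jump (Z := fun w => X ^~ w)).
  by move=> w; have /andP[? ?] := ever_jump_ind_itv (X ^~ w) 0 r; rewrite ger0_norm.
have h1 := @ever_jump_integral_cvg _ _ _ (P x) (fun w => X ^~ w) rX mX G t r bG' t0 r0.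
apply: (cvg_unique _ h1); first exact: Rhausdorff.
rewrite (_ : (fun m => _) = (fun m => \int[P x]_w (G w * psi m (X t w)))); last first.
  by apply/funext => m; exact: jump_ramp_markov.
have -> : \int[P x]_w (G w * \int[P (X t w)]_w' ever_jump_ind (X ^~ w') 0 r) =
    \int[P x]_w (G w * psi' (X t w)).
  by apply: eq_Rintegral => w _; rewrite /psi' lawE// X0.
have [_ [M GM]] := bG'.
apply: (bintegral_cvg (M := M * 1)) => [n|n w||w].
- by apply: bmeasM => //; apply: bmeas_comp (bpsi n) (mX t0).
- by rewrite normrM ler_pM.
- by apply: bmeasM => //; apply: bmeas_comp bpsi' (mX t0).
- by apply: cvgMr; exact: cpsi.
Qed.

Lemma ever_jump_sum x y r : 0 <= x -> 0 <= y -> 0 <= r ->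
  \int[(P x \x P y)%E]_z ever_jump_ind (sum_path X z) 0 r =
  \int[P (x + y)]_w ever_jump_ind (X ^~ w) 0 r.
Proof.
move=> x0 y0 r0; set PP := (P x \x P y)%E.
have rS z : rcll (sum_path X z) by exact: rcllD.
have mS t : 0 <= t -> measurable_fun setT (fun z => sum_path X z t).
  by move=> t0; exact: (sum_path_measurable HX).
have m0 m : 0 < m.+1%:R^-1 :> R by rewrite invr_gt0.
have S0 m : 0 < 0 + m.+1%:R :> R by rewrite add0r ltr0n.
have Em m : \int[PP]_z jump_ramp (sum_path X z) 0 (0 + m.+1%:R) r m.+1%:R^-1 =
    \int[P (x + y)]_w jump_ramp (X ^~ w) 0 (0 + m.+1%:R) r m.+1%:R^-1.
  have h1 := @jump_ramp_integral_cvg _ _ _ PP (sum_path X) rS mS (fun=> 1) 0 (0 + m.+1%:R) r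
    m.+1%:R^-1 (bmeas_cst 1) (lexx 0) (S0 m) r0 (m0 m).
  have h2 := @jump_ramp_integral_cvg _ _ _ (P (x + y)) (fun w => X ^~ w) rX mX (fun=> 1) 0
    (0 + m.+1%:R) r m.+1%:R^-1 (bmeas_cst 1) (lexx 0) (S0 m) r0 (m0 m).
  under [LHS]eq_Rintegral do rewrite -[jump_ramp _ _ _ _ _]mul1r.
  under [RHS]eq_Rintegral do rewrite -[jump_ramp _ _ _ _ _]mul1r.
  apply: (cvg_unique _ h1); first exact: Rhausdorff.
  rewrite (_ : (fun n => _) = (fun n => \int[P (x + y)]_w (1 * ramp r m.+1%:R^-1
    (smax n.+1 (grid (X ^~ w) 0 (mesh 0 (0 + m.+1%:R) n))))))//.
  apply/funext => n.
  under eq_Rintegral do rewrite mul1r; under [RHS]eq_Rintegral do rewrite mul1r.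
  have hh : 0 <= mesh 0 (0 + m.+1%:R) n :> R by apply/ltW/mesh_gt0.
  exact: (sum_law HX v_ge0 laplaceE x0 y0 hh (bmeas_ramp_smax n.+1 r (m0 m))).
have h1 := @ever_jump_integral_cvg _ _ _ PP (sum_path X) rS mS (fun=> 1) 0 r
  (bmeas_cst 1) (lexx 0) r0.
have h2 := @ever_jump_integral_cvg _ _ _ (P (x + y)) (fun w => X ^~ w) rX mX (fun=> 1) 0 r
  (bmeas_cst 1) (lexx 0) r0.
under [LHS]eq_Rintegral do rewrite -[ever_jump_ind _ _ _]mul1r.
under [RHS]eq_Rintegral do rewrite -[ever_jump_ind _ _ _]mul1r.
apply: (cvg_unique _ h1); first exact: Rhausdorff.
rewrite (_ : (fun m => _) = (fun m => \int[P (x + y)]_w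
  (1 * jump_ramp (X ^~ w) 0 (0 + m.+1%:R) r m.+1%:R^-1)))//.
apply/funext => m.
under eq_Rintegral do rewrite mul1r; under [RHS]eq_Rintegral do rewrite mul1r.
exact: Em.
Qed.

(** Continuity in probability, in a bounded form. The square expands into Laplace transforms at [r]
    and [s]; the Markov property at [r] gives the cross term the exponent 1 + u with u = v_{s-r}(1),
    and [u] is close to 1. *)
Lemma exp_increment x t : 0 <= x -> 0 <= t -> exists2 K : R, 0 <= K &
  forall r s, 0 <= r -> r <= s -> s <= t ->
  \int[P x]_w ((expR (- X r w) - expR (- X s w)) ^+ 2) <= K * (s - r).
Proof.
move=> x0 t0; have [K1 K10 H1] := v_lip t0 ler01.
have [K2 K20 H2] := v_lip t0 (ler0n _ 2).
exists (x * K2 + 2 * K1); first by rewrite addr_ge0// mulr_ge0.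
move=> r s r0 rs st; have s0 := le_trans r0 rs.
have sr0 : 0 <= s - r by rewrite subr_ge0.
set u := v (s - r) 1.
have u0 : 0 <= u by exact: v_ge0.
have bE c t' : 0 <= c -> 0 <= t' -> bmeas (fun w => expR (- (c * X t' w))).
  by move=> c0 t'0; exact: (bmeas_expX HX).
have bEE c c' t' t'' : 0 <= c -> 0 <= t' -> 0 <= c' -> 0 <= t'' ->
    bmeas (fun w => expR (- (c * X t' w)) * expR (- (c' * X t'' w))).
  by move=> *; apply: bmeasM; exact: bE.
have E w : (expR (- X r w) - expR (- X s w)) ^+ 2 =
    expR (- (2 * X r w)) + expR (- (2 * X s w)) +
    (-2) * (expR (- (1 * X r w)) * expR (- (1 * X s w))).
  have e2 z : expR (- (2 * z)) = expR (- z) ^+ 2 :> R.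
    by rewrite expr2 -expRD; congr expR; ring.
  by rewrite !e2 !mul1r; ring.
under eq_Rintegral do rewrite E.
rewrite bintegralD; last 2 first.
- by apply: bmeasD; exact: bE.
- by apply: bmeasZ; exact: bEE.
rewrite bintegralD; [|exact: bE|exact: bE].
rewrite bintegralZ; last exact: bEE.
have -> : \int[P x]_w (expR (- (1 * X r w)) * expR (- (1 * X s w))) =
    \int[P x]_w (expR (- (1 * X r w)) * expR (- (u * X r w))).
  have := laplace_markov HX laplaceE x0 sr0 r0 ler01
    (past_bmeas_exp HX ler01 r0 (lexx r)).
  by rewrite addrC subrK.
(* The factor e^{-z} pays for the unbounded z, since z e^{-z} <= 1. *)
have B : \int[P x]_w expR (- (2 * X r w)) -
    \int[P x]_w (expR (- (1 * X r w)) * expR (- (u * X r w))) <= `|u - 1|.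
  rewrite -bintegralB; [|exact: bE|exact: bEE].
  rewrite -[leRHS](bintegral_cst (P x)); apply: le_bintegral => [||w].
  - by apply: bmeasB; [exact: bE|exact: bEE].
  - exact: bmeas_cst.
  set z := X r w; have z0 : 0 <= z by exact: X0.
  have -> : expR (- (2 * z)) = expR (- (1 * z)) * expR (- (1 * z)).
    by rewrite -expRD; congr expR; ring.
  rewrite -mulrBr mul1r.
  have ze : z * expR (- z) <= 1.
    rewrite expRN -ler_pdivlMr ?invr_gt0 ?expR_gt0// div1r invrK.
    by rewrite (le_trans _ (expR_ge1Dx z))// lerDr.
  have dz : expR (- z) - expR (- (u * z)) <= `|u - 1| * z.
    have := expR_ge1Dx ((1 - u) * z) => h.
    have e1 : expR (- z) <= 1 by rewrite -expR0 ler_expR oppr_le0.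
    have -> : expR (- (u * z)) = expR (- z) * expR ((1 - u) * z).
      by rewrite -expRD; congr expR; ring.
    apply: (@le_trans _ _ (expR (- z) * ((u - 1) * z))).
      rewrite -[X in X - _]mulr1 -mulrBr ler_wpM2l ?expR_ge0//; lra.
    apply: (@le_trans _ _ (expR (- z) * (`|u - 1| * z))).
      by rewrite ler_wpM2l ?expR_ge0// ler_wpM2r// ler_norm.
    by rewrite ler_piMl// mulr_ge0.
  apply: (@le_trans _ _ (expR (- z) * (`|u - 1| * z))).
    by rewrite ler_wpM2l// expR_ge0.
  by rewrite mulrC -mulrA -[leRHS]mulr1 ler_wpM2l.
have u1 : `|u - 1| <= K1 * (s - r).
  have := H1 0 (s - r) (lexx 0) sr0; rewrite v_init// subr0 -/u; apply.
  by apply: le_trans st; rewrite gerBl.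
have A : \int[P x]_w expR (- (2 * X s w)) - \int[P x]_w expR (- (2 * X r w))
    <= x * (K2 * (s - r)).
  rewrite !laplaceE//; have hv := H2 r s r0 rs st.
  have := expR_ge1Dx (x * (v s 2 - v r 2)) => h.
  have vs0 : 0 <= v s 2 by exact: v_ge0.
  have e1 : expR (- (x * v s 2)) <= 1 by rewrite -[leRHS]expR0 ler_expR oppr_le0 mulr_ge0.
  have -> : expR (- (x * v r 2)) = expR (- (x * v s 2)) * expR (x * (v s 2 - v r 2)).
    by rewrite -expRD; congr expR; ring.
  apply: (@le_trans _ _ (expR (- (x * v s 2)) * (x * (v r 2 - v s 2)))).
    rewrite -[X in X - _]mulr1 -mulrBr ler_wpM2l ?expR_ge0//; lra.
  apply: (@le_trans _ _ (expR (- (x * v s 2)) * (x * `|v s 2 - v r 2|))).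
    by rewrite ler_wpM2l ?expR_ge0// ler_wpM2l// distrC ler_norm.
  apply: (@le_trans _ _ (x * `|v s 2 - v r 2|)).
    by rewrite ler_piMl// mulr_ge0.
  by rewrite ler_wpM2l.
by lra.
Qed.

End cb_jumps.

(** * Fixed and common jump times *)

Section cb_no_common_jump.
Context {R : realType} {d} {T : measurableType d}.
Variables (Phi : R -> R) (X : R -> T -> R) (P : R -> probability T R).
Hypothesis HX : cb_process Phi X P.
Variable v : R -> R -> R.
Hypothesis v_ge0 : forall t lambda : R, 0 <= t -> 0 <= lambda -> 0 <= v t lambda.
Hypothesis v_init : forall lambda : R, 0 <= lambda -> v 0 lambda = lambda.
Hypothesis v_lip : forall t lambda : R, 0 <= t -> 0 <= lambda -> exists2 K : R, 0 <= K &
  forall r s : R, 0 <= r -> r <= s -> s <= t -> `|v s lambda - v r lambda| <= K * (s - r).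
Hypothesis laplaceE : forall x t lambda : R, 0 <= x -> 0 <= t -> 0 <= lambda ->
  \int[P x]_w expR (- (lambda * X t w)) = expR (- (x * v t lambda)).

Let X0 t w : 0 <= t -> 0 <= X t w. Proof. exact: (cb_ge0 HX). Qed.
Let mX t : 0 <= t -> measurable_fun setT (X t). Proof. exact: (X_measurable HX). Qed.
Let rX w : rcll (X ^~ w). Proof. exact: (cb_rcll HX). Qed.

(** Along u_n = s - s / (n + 1), e^{-X} tends pointwise to its value at the left limit, and in mean
    square to its value at [s] by [exp_increment]; hence the two coincide almost surely. *)
Lemma no_fixed_jump x s : 0 <= x -> 0 < s ->
  (P x).-negligible [set w | jump (X ^~ w) s != 0].
Proof.
move=> x0 s0; pose u n := s - s * n.+1%:R^-1.
have u0 n : 0 <= u n.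
  by rewrite subr_ge0 -[leRHS]mulr1 ler_pM2l// invf_le1// ler1n.
have us n : u n < s by rewrite gtrBl mulr_gt0// invr_gt0.
pose l w := left_limit (X ^~ w) s.
have cl w : X (u n) w @[n --> \oo] --> l w.
  apply/cvgrPdist_lt => e e0; have [dl dl0 H] := rcll_left (rX w) s0 e0.
  have : s * harmonic n @[n --> \oo] --> (s * 0 : R) by apply: cvgMr; exact: cvg_harmonic.
  rewrite mulr0 => /cvgrPdist_lt/(_ _ dl0); apply: filterS => n.
  rewrite sub0r normrN => hn; rewrite distrC; apply: H; rewrite us andbT.
  by rewrite /u ltrD2l ltrN2 (le_lt_trans (ler_norm _)).
pose f w := (expR (- l w) - expR (- X s w)) ^+ 2.
pose fn n w := (expR (- X (u n) w) - expR (- X s w)) ^+ 2.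
have e01 t w : 0 <= t -> 0 <= expR (- X t w) <= 1.
  by move=> t0; rewrite expR_ge0 -[leRHS]expR0 ler_expR oppr_le0 X0.
have fn1 n w : `|fn n w| <= 1.
  have /andP[a1 a2] := e01 (u n) w (u0 n); have /andP[b1 b2] := e01 s w (ltW s0).
  rewrite /fn normrX expr_le1// ler_norml.
  by apply/andP; split; lra.
have be t : 0 <= t -> bmeas (fun w => expR (- X t w)).
  move=> t0; apply: (@bmeas_itv _ _ _ 0 1) => [|w]; last exact: e01.
  by apply: measurableT_comp => //; apply: measurable_funN; exact: mX.
have bfn n : bmeas (fn n).
  by apply: bmeasX; apply: bmeasB; apply: be => //; exact: ltW.
have cf w : fn n w @[n --> \oo] --> f w.
  have c1 : expR (- X (u n) w) @[n --> \oo] --> expR (- l w).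
    apply: continuous_cvg; first exact: continuous_expR.
    by apply: cvgN; exact: cl.
  have c2 : expR (- X (u n) w) - expR (- X s w) @[n --> \oo] --> expR (- l w) - expR (- X s w).
    by apply: cvgB => //; exact: cvg_cst.
  by rewrite /f /fn; under eq_fun do rewrite expr2; rewrite expr2; apply: cvgM.
have mf : measurable_fun setT f.
  by apply: (measurable_fun_cvg (h := fn)) => // n; have [] := bfn n.
have f1 w : `|f w| <= 1.
  have l0 : 0 <= l w.
    have <- : lim (X (u n) w @[n --> \oo]) = l w by apply: cvg_lim => //; exact: Rhausdorff.
    by apply: limr_ge; [exact: cvgP (cl w)|apply: nearW => n; exact: X0].
  have a2 : expR (- l w) <= 1 by rewrite -[leRHS]expR0 ler_expR oppr_le0.
  have a1 := expR_ge0 (- l w); have /andP[b1 b2] := e01 s w (ltW s0).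
  by rewrite /f normrX expr_le1// ler_norml; apply/andP; split; lra.
have bf : bmeas f by split=> //; exists 1.
have h1 := @bintegral_cvg _ _ _ (P x) _ _ _ bfn fn1 bf cf.
have [K K0 HK] := exp_increment HX v_ge0 v_init v_lip laplaceE x0 (ltW s0).
have h2 : \int[P x]_w fn n w @[n --> \oo] --> (0 : R).
  apply: (@cvg_harmonic_bound _ _ _ (K * s)) => n; rewrite subr0 ger0_norm; last first.
    by apply: Rintegral_ge0 => w _; exact: sqr_ge0.
  apply: (le_trans (HK (u n) s (u0 n) (ltW (us n)) (lexx s))).
  by rewrite -mulrA /u opprB addrC subrK.
have I0 : \int[P x]_w f w = 0 by apply: (cvg_unique _ h1 h2); exact: Rhausdorff.
have : (\int[P x]_w `|(f w)%:E| = 0)%E.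
  under eq_integral do rewrite gee0_abs ?lee_fin ?sqr_ge0//.
  by rewrite bintegralE// I0.
have mfE : measurable_fun setT (EFin \o f) by exact/measurable_EFinP.
move=> /(ae_eq_integral_abs (P x) measurableT mfE) [N [mN N0 NN]].
exists N; split=> // w /= jw; apply: NN => /= h.
have /eqP := h Logic.I; rewrite eqe sqrf_eq0 subr_eq0 => /eqP /expR_inj /oppr_inj lX.
by move/negP: jw; apply; rewrite /jump -/(left_limit _ _) -/(l w) lX subrr.
Qed.

Definition no_jump_prob (r y : R) : R := 1 - \int[P y]_w ever_jump_ind (X ^~ w) 0 r.

(** Given the second path, its jump times lie in the sequence [sigma], and the first path almost
    surely jumps at none of them. Outside this null set every jump of the sum is a jump of one
    summand, so the sum is free of large jumps exactly when both summands are; independence gives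
    the product. *)
Lemma no_jump_mul x y r : 0 <= x -> 0 <= y -> 0 <= r ->
  no_jump_prob r (x + y) = no_jump_prob r x * no_jump_prob r y.
Proof.
move=> x0 y0 r0; rewrite /no_jump_prob.
rewrite -(ever_jump_sum HX v_ge0 laplaceE x0 y0 r0).
set PP := (P x \x P y)%E.
have be : bmeas (fun w => ever_jump_ind (X ^~ w) 0 r).
  exact: (bmeas_ever_jump (Z := fun w => X ^~ w)).
pose e1 (z : T * T) := ever_jump_ind (X ^~ z.1) 0 r; pose e2 (z : T * T) := ever_jump_ind (X ^~ z.2) 0 r.
have b1 : bmeas e1 by apply: (bmeas_comp (Z := fst) be).
have b2 : bmeas e2 by apply: (bmeas_comp (Z := snd) be).
have bS : bmeas (fun z => ever_jump_ind (sum_path X z) 0 r).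
  apply: (bmeas_ever_jump (Z := sum_path X)) => //; first by move=> z; exact: rcllD.
  by move=> t t0; exact: (sum_path_measurable HX).
pose D z := ever_jump_ind (sum_path X z) 0 r - (1 - (1 - e1 z) * (1 - e2 z)).
have bD : bmeas D.
  by apply: bmeasB => //; apply: bmeasB; [exact: bmeas_cst|apply: bmeasM;
    apply: bmeasB => //; exact: bmeas_cst].
have D0 : \int[PP]_z D z = 0.
  rewrite bfubini2//.
  rewrite -[RHS](bintegral_cst (P y)); apply: eq_Rintegral => w2 _.
  have [sigma sigma0 Hsigma] := rcll_jump_times (rX w2).
  apply: (bintegral_negligible (N := \bigcup_n [set w | jump (X ^~ w) (sigma n) != 0])).
  - exact: (bmeas_section2 w2 bD).
  - by apply: negligible_bigcup => n; exact: no_fixed_jump.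
  move=> w1 nN; rewrite /D /e1 /e2 /=.
  have excl s : 0 < s -> jump (X ^~ w1) s = 0 \/ jump (X ^~ w2) s = 0.
    move=> s0; have [|j2] := eqVneq (jump (X ^~ w2) s) 0; first by right.
    left; have [n <-] := Hsigma s s0 j2; apply/eqP/negPn/negP => j1.
    by apply: nN; exists n.
  have js s : 0 < s -> jump (sum_path X (w1, w2)) s = jump (X ^~ w1) s + jump (X ^~ w2) s.
    by move=> s0; exact: jumpD.
  have iff : ever_jump (sum_path X (w1, w2)) 0 r <->
      ever_jump (X ^~ w1) 0 r \/ ever_jump (X ^~ w2) 0 r.
    split=> [[s s0]|].
      rewrite js//; have [->|->] := excl s s0; rewrite ?add0r ?addr0 => h.
        by right; exists s.
      by left; exists s.
    case=> -[s s0 h]; exists s => //; rewrite js//; have [e|e] := excl s s0;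
      rewrite e ?addr0 ?add0r// in h *; by rewrite ltNge r0 in h.
  rewrite /ever_jump_ind; case: asboolP => h; case: asboolP => h1; case: asboolP => h2;
    rewrite ?subrr ?subr0 ?mul0r ?mulr0 ?mulr1 ?subrr ?subr0 ?subrr//.
  - by exfalso; move/iff : h => [].
  - by exfalso; apply: h; apply/iff; left.
  - by exfalso; apply: h; apply/iff; left.
  - by exfalso; apply: h; apply/iff; right.
move: D0; rewrite bintegralB//; last first.
  by apply: bmeasB; [exact: bmeas_cst|apply: bmeasM; apply: bmeasB => //; exact: bmeas_cst].
move/eqP; rewrite subr_eq0 => /eqP ->.
have bM : bmeas (fun z => (1 - e1 z) * (1 - e2 z)).
  by apply: bmeasM; apply: bmeasB => //; exact: bmeas_cst.
rewrite bintegralB//; last exact: bmeas_cst.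
rewrite bintegral_cst opprB addrC subrK bfubini1// /e1 /e2 /=.
have bc : bmeas (fun w => 1 - ever_jump_ind (X ^~ w) 0 r).
  by apply: bmeasB => //; exact: bmeas_cst.
under eq_Rintegral do rewrite bintegralZ//.
under eq_Rintegral do rewrite mulrC.
rewrite bintegralZ// mulrC !bintegralB ?bintegral_cst//; exact: bmeas_cst.
Qed.

Lemma no_jump_itv y r : 0 <= r -> 0 <= no_jump_prob r y <= 1.
Proof.
move=> r0; have be : bmeas (fun w => ever_jump_ind (X ^~ w) 0 r).
  exact: (bmeas_ever_jump (Z := fun w => X ^~ w)).
rewrite /no_jump_prob subr_ge0 gerBl; apply/andP; split.
  rewrite -[leRHS](bintegral_cst (P y)); apply: le_bintegral => //; first exact: bmeas_cst.
  by move=> w; case/andP: (ever_jump_ind_itv (X ^~ w) 0 r).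
by apply: Rintegral_ge0 => w _; case/andP: (ever_jump_ind_itv (X ^~ w) 0 r).
Qed.

End cb_no_common_jump.

(** Cauchy's equation under monotonicity: f <= 1 makes [f] nonincreasing, and psi = - ln f at a
    multiple of x is compared with its values at the neighbouring integers, with an error psi(1)
    over the multiple. *)
Lemma multiplicative_exp {R : realType} (f : R -> R) :
  (forall x y, 0 <= x -> 0 <= y -> f (x + y) = f x * f y) ->
  (forall x, 0 <= x -> 0 <= f x <= 1) -> 0 < f 1 ->
  forall x, 0 <= x -> f x = expR (x * ln (f 1)).
Proof.
move=> fM f01 f1.
have f0 : f 0 = 1.
  by apply: (mulfI (lt0r_neq0 f1)); rewrite mulr1 -fM// addr0.
have fX (n : nat) x : 0 <= x -> f (n%:R * x) = f x ^+ n.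
  move=> x0; elim: n => [|n IH]; first by rewrite mul0r f0 expr0.
  by rewrite -natr1 mulrDl mul1r fM ?mulr_ge0// IH exprSr.
have fle x y : 0 <= x -> x <= y -> f y <= f x.
  move=> x0 xy; have yx : 0 <= y - x by rewrite subr_ge0.
  rewrite -(subrK x y) addrC fM// ler_piMr//; first by case/andP: (f01 x x0).
  by case/andP: (f01 _ yx).
have fpos x : 0 <= x -> 0 < f x.
  move=> x0; apply: (@lt_le_trans _ _ (f ((Num.bound x)%:R * 1))).
    by rewrite fX// exprn_gt0.
  by apply: fle => //; rewrite mulr1; exact/ltW/archi_boundP.
pose psi x := - ln (f x).
have psi0 x : 0 <= x -> 0 <= psi x.
  by move=> x0; rewrite oppr_ge0 ln_le0//; case/andP: (f01 x x0).
have psiX (n : nat) x : 0 <= x -> psi (n%:R * x) = n%:R * psi x.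
  by move=> x0; rewrite /psi fX// lnXn ?fpos// mulrN mulr_natl.
have psile x y : 0 <= x -> x <= y -> psi x <= psi y.
  move=> x0 xy; rewrite lerN2 ler_ln ?posrE ?fpos//; first exact: fle.
  exact: le_trans xy.
suff psiE x : 0 <= x -> psi x = x * psi 1.
  by move=> x x0; have := psiE x x0; rewrite /psi mulrN => /oppr_inj <-; rewrite lnK// posrE fpos.
move=> x0.
have bnd n : `|psi x - x * psi 1| <= psi 1 * n.+1%:R^-1.
  have n0 : 0 < n.+1%:R :> R by rewrite ltr0n.
  have nx0 : 0 <= n.+1%:R * x by rewrite mulr_ge0.
  have /andP[k1 k2] := truncn_itv nx0.
  set k := Num.truncn _ in k1 k2.
  have a1 : k%:R * psi 1 <= n.+1%:R * psi x.
    by rewrite -psiX// -[in leRHS]psiX// psile// ?mulr1 ?mulr_ge0.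
  have a2 : n.+1%:R * psi x <= k.+1%:R * psi 1.
    by rewrite -psiX// -[in leRHS]psiX// psile// mulr1 ltW.
  have p1 := psi0 1 ler01.
  have b1 : k%:R * psi 1 <= n.+1%:R * x * psi 1 by rewrite ler_wpM2r.
  have b2 : n.+1%:R * x * psi 1 <= k.+1%:R * psi 1 by rewrite ler_wpM2r// ltW.
  rewrite ler_pdivlMr// -[X in _ * X](ger0_norm (ltW n0)) -normrM ler_norml.
  by rewrite -natr1 in a2 b2; apply/andP; split; lra.
apply/eqP; rewrite -subr_eq0 -normr_eq0.
have : (fun n : nat => `|psi x - x * psi 1|) n @[n --> \oo] --> (0 : R).
  apply: (@cvg_harmonic_bound _ _ _ (psi 1)) => n.
  by rewrite subr0 normr_id.
move=> h; apply/eqP; apply: (cvg_unique _ _ h); first exact: Rhausdorff.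
exact: cvg_cst.
Qed.

(** * Bounds on the probability of a large jump *)

Section increments.
Context {R : realType}.
Implicit Types (z : nat -> R) (c : R).

Definition below c z (k : nat) : R := \prod_(j < k) (z j.+1 - z j <= c)%R%:R.

Lemma belowS c z k : below c z k.+1 = below c z k * (z k.+1 - z k <= c)%R%:R.
Proof. by rewrite /below big_ord_recr. Qed.

Lemma below_ge0 c z k : 0 <= below c z k.
Proof. by apply: prodr_ge0 => j _; exact: ler0n. Qed.

Lemma below_le1 c z k : below c z k <= 1.
Proof. by apply: prodr_ile1 => j _; rewrite ler0n lern1 leq_b1. Qed.

Lemma below_exceed c z k :
  below c z k - below c z k.+1 = below c z k * (c < z k.+1 - z k)%R%:R.
Proof. by rewrite belowS ltNge; case: (_ <= c); rewrite ?mulr1 ?mulr0 ?subrr ?subr0. Qed.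

(** First-passage decomposition: the k-th term indicates that the k-th increment is the first above
    [c]. *)
Lemma below_telescope c z n :
  1 - below c z n = \sum_(k < n) below c z k * (c < z k.+1 - z k)%R%:R.
Proof.
elim: n => [|n IH]; first by rewrite big_ord0 /below big_ord0 subrr.
by rewrite big_ord_recr/= -IH -below_exceed addrA subrK.
Qed.

Lemma below_smax c z n : 0 <= c -> smax n z <= c -> below c z n = 1.
Proof.
move=> c0 h; rewrite /below big1// => j _.
by rewrite (le_trans (smax_ge z (ltn_ord j)) h).
Qed.

Lemma below_smax_gt c z n : 0 <= c -> c < smax n z -> below c z n = 0.
Proof.
move=> c0; elim: n => [|n IH] /=; first by rewrite ltNge c0.
rewrite belowS lt_max => /orP[/IH ->|]; first by rewrite mul0r.
by rewrite ltNge => /negbTE ->; rewrite mulr0.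
Qed.

(** With [below_le_ramp], this encloses ramps between first-passage events, so that estimates on a
    grid reach the jumps. *)
Lemma ramp_le_below c e z n : 0 <= c -> 0 < e -> ramp c e (smax n z) <= 1 - below c z n.
Proof.
move=> c0 e0; have [h|h] := leP (smax n z) c.
  by rewrite ramp0// subr_ge0 below_le1.
by rewrite below_smax_gt// subr0 ramp_le1.
Qed.

Lemma below_le_ramp r e z n : 0 <= r -> 0 < e ->
  1 - below (r + e) z n <= ramp r e (smax n z).
Proof.
move=> r0 e0; have re0 : 0 <= r + e by rewrite addr_ge0// ltW.
have [h|h] := leP (smax n z) (r + e); first by rewrite below_smax// subrr ramp_ge0.
by rewrite below_smax_gt// subr0 ramp1// ltW.
Qed.

End increments.

(** * First passage of grid increments *)

Section cb_estimates.
Context {R : realType} {d} {T : measurableType d}.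
Variables (Phi : R -> R) (X : R -> T -> R) (P : R -> probability T R).
Hypothesis HX : cb_process Phi X P.
Variable v : R -> R -> R.
Hypothesis v_ge0 : forall t lambda : R, 0 <= t -> 0 <= lambda -> 0 <= v t lambda.
Hypothesis laplaceE : forall x t lambda : R, 0 <= x -> 0 <= t -> 0 <= lambda ->
  \int[P x]_w expR (- (lambda * X t w)) = expR (- (x * v t lambda)).

Notation past t := (g_sigma_algebraType (history X t)).

Let X0 t w : 0 <= t -> 0 <= X t w. Proof. exact: (cb_ge0 HX). Qed.

Lemma bmeas_boolr {d'} {S : measurableType d'} (b : S -> bool) :
  measurable_fun setT b -> bmeas (fun w => (b w)%:R : R).
Proof.
move=> mb; have -> : (fun w => (b w)%:R : R) = \1_[set w | b w].
  by apply/funext => w; rewrite indicE; congr (nat_of_bool _)%:R; apply/idP/idP; rewrite inE.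
apply: bmeas_indic; rewrite -[X in measurable X]setTI.
have -> : [set w | b w] = b @^-1` [set true] by apply/seteqP; split.
exact: mb.
Qed.

Lemma past_incr h c k : 0 <= h ->
  @bmeas R _ (past (0 + k.+1%:R * h))
    (fun w => (grid (X ^~ w) 0 h k.+1 - grid (X ^~ w) 0 h k <= c)%R%:R).
Proof.
move=> h0; apply: (@bmeas_boolr _ (past _)).
have hk (j : nat) : 0 <= 0 + j%:R * h by rewrite add0r mulr_ge0.
apply: (@measurable_fun_ler _ (past _)) => //.
  apply: (@measurable_funB _ (past _)); apply: past_adapted => //.
  by rewrite !add0r ler_wpM2r// ler_nat.
Qed.

Lemma past_below h c k : 0 <= h ->
  @bmeas R _ (past (0 + k%:R * h)) (fun w => below c (grid (X ^~ w) 0 h) k).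
Proof.
move=> h0; elim: k => [|k IH].
  apply: (@eq_bmeas _ _ (past _) (fun=> 1)); last exact: (@bmeas_cst _ _ (past _)).
  by move=> w; rewrite /below big_ord0.
apply: (@eq_bmeas _ _ (past _) (fun w => below c (grid (X ^~ w) 0 h) k *
  (grid (X ^~ w) 0 h k.+1 - grid (X ^~ w) 0 h k <= c)%R%:R)).
  by move=> w; rewrite belowS.
apply: bmeasM; last exact: past_incr.
by apply: past_bmeasS IH; rewrite !add0r ler_wpM2r// ler_nat.
Qed.

Lemma past_exceed h c k : 0 <= h ->
  @bmeas R _ (past (0 + k.+1%:R * h)) (fun w => below c (grid (X ^~ w) 0 h) k *
    (c < grid (X ^~ w) 0 h k.+1 - grid (X ^~ w) 0 h k)%R%:R).
Proof.
move=> h0; apply: (@eq_bmeas _ _ (past _)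
  (fun w => below c (grid (X ^~ w) 0 h) k - below c (grid (X ^~ w) 0 h) k.+1)).
  by move=> w; rewrite below_exceed.
apply: bmeasB; last exact: past_below.
by apply: past_bmeasS (past_below c k h0); rewrite !add0r ler_wpM2r// ler_nat.
Qed.

(* A jump above c leaves the process above c, where exp(- v X) is small. *)
Lemma early_exceed x t lambda c kappa n : 0 <= x -> 0 < t -> 0 <= lambda -> 0 <= c ->
  0 <= kappa -> (forall s, 0 <= s <= t -> kappa <= v s lambda) ->
  \int[P x]_w (expR (- (lambda * X t w)) *
    (1 - below c (grid (X ^~ w) 0 (mesh 0 t n)) n.+1)) <=
  expR (- (kappa * c)) * \int[P x]_w (1 - below c (grid (X ^~ w) 0 (mesh 0 t n)) n.+1).
Proof.
move=> x0 t0 l0 c0 kappa0 Hk; set h := mesh 0 t n.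
pose z w := grid (X ^~ w) 0 h.
have h0 : 0 <= h by exact/ltW/mesh_gt0.
pose G k w := below c (z w) k * (c < z w k.+1 - z w k)%R%:R.
have tk (k : nat) : 0 <= 0 + k%:R * h by rewrite add0r mulr_ge0.
have bG k : @bmeas R _ (past (0 + k.+1%:R * h)) (G k) by exact: past_exceed.
have bG' k : bmeas (G k) by exact: (past_bmeas HX (tk k.+1) (bG k)).
have bW : bmeas (fun w => expR (- (lambda * X t w))) by exact: (bmeas_expX HX l0 (ltW t0)).
have E1 w : expR (- (lambda * X t w)) * (1 - below c (grid (X ^~ w) 0 h) n.+1) =
    \sum_(k < n.+1) G k w * expR (- (lambda * X t w)).
  by rewrite below_telescope mulrC mulr_suml.
under eq_Rintegral do rewrite E1.
under [in leRHS]eq_Rintegral do rewrite below_telescope.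
rewrite (@bintegral_sum _ _ _ (P x) (fun k w => G k w * expR (- (lambda * X t w)))); last first.
  by move=> k; exact: bmeasM.
rewrite (@bintegral_sum _ _ _ (P x) G)// mulr_sumr; apply: ler_sum => k _.
have kt : 0 + k.+1%:R * h <= t.
  by rewrite add0r /h /mesh subr0 mulrCA -[leRHS]mulr1 ler_pM2l// ler_pdivrMr// mul1r ler_nat.
have s0 : 0 <= t - (0 + k.+1%:R * h) by rewrite subr_ge0.
have := laplace_markov HX laplaceE x0 s0 (tk k.+1) l0 (bG k).
rewrite addrC subrK => ->.
rewrite -bintegralZ//; apply: le_bintegral => [||w].
- apply: bmeasM => //; apply: (bmeas_expX HX) => //; exact: v_ge0.
- exact: bmeasZ.
rewrite mulrC /G; case: (ltP c) => hc; last by rewrite !mulr0.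
rewrite !mulr1 ler_wpM2r ?below_ge0// ler_expR lerN2.
have vk : kappa <= v (t - (0 + k.+1%:R * h)) lambda.
  by apply: Hk; rewrite s0 gerBl tk.
have cX : c <= X (0 + k.+1%:R * h) w.
  by rewrite (le_trans (ltW hc))// /z /grid gerBl X0// tk.
by rewrite ler_pM.
Qed.

Hypothesis v_le : forall t lambda : R, 0 <= t -> 0 <= lambda -> v t lambda <= lambda.

(** As v_h(lambda) <= lambda, the process 1 - e^{- lambda X} is a nonnegative supermartingale on the
    grid, and it is at least 1 - e^{- lambda c} once X exceeds [c]. Stopping is written out as an
    induction on the events [stay]. *)
Lemma maximal_inequality x h lambda c n : 0 <= x -> 0 <= h -> 0 <= lambda -> 0 <= c ->
  (1 - expR (- (lambda * c))) *
    \int[P x]_w (1 - below c (grid (X ^~ w) 0 h) n) <= 1 - expR (- (x * lambda)).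
Proof.
move=> x0 h0 l0 c0.
have tk (k : nat) : 0 <= 0 + k%:R * h by rewrite add0r mulr_ge0.
pose stay k (w : T) : R := \prod_(j < k.+1) (fun z => (z <= c)%R%:R) (X (0 + j%:R * h) w).
pose f k w := 1 - expR (- (lambda * X (0 + k%:R * h) w)).
have bstay k : @bmeas R _ (past (0 + k%:R * h)) (stay k).
  apply: (@prod_grid_past _ _ _ X 0 h (fun _ z => (z <= c)%R%:R) k) => // _.
  apply: bmeas_boolr; apply: measurable_fun_ler => //; exact: measurable_cst.
have bstay' k : bmeas (stay k) by exact: (past_bmeas HX (tk k) (bstay k)).
have bE k : bmeas (fun w => expR (- (lambda * X (0 + k%:R * h) w))) by exact: (bmeas_expX HX).
have bf k : bmeas (f k) by apply: bmeasB => //; exact: bmeas_cst.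
have s0 k w : 0 <= stay k w by apply: prodr_ge0 => j _; exact: ler0n.
have s1 k w : stay k w <= 1 by apply: prodr_ile1 => j _; rewrite ler0n lern1 leq_b1.
have f0 k w : 0 <= f k w.
  by rewrite subr_ge0 -[leRHS]expR0 ler_expR oppr_le0 mulr_ge0// X0.
set e := 1 - expR (- (lambda * c)).
have super k : \int[P x]_w (stay k w * f k.+1 w) <= \int[P x]_w (stay k w * f k w).
  have E j : \int[P x]_w (stay k w * f j w) = \int[P x]_w stay k w -
      \int[P x]_w (stay k w * expR (- (lambda * X (0 + j%:R * h) w))).
    by rewrite -bintegralB//; [apply: eq_Rintegral => w _; rewrite mulrBr mulr1|exact: bmeasM].
  rewrite !E lerD2l lerN2.
  have := laplace_markov HX laplaceE x0 h0 (tk k) l0 (bstay k).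
  have -> : 0 + k%:R * h + h = 0 + k.+1%:R * h by rewrite -natr1 mulrDl mul1r addrA.
  move=> ->; apply: le_bintegral => [||w].
  - exact: bmeasM.
  - by apply: bmeasM => //; apply: (bmeas_expX HX) => //; exact: v_ge0.
  - by rewrite ler_wpM2l// ler_expR lerN2 ler_wpM2r ?X0// v_le.
(* The left side is nonincreasing in [k]: a path that leaves at step k + 1 adds [e] to the first
   term and gives up at least [e] in the second. *)
have main k : e * \int[P x]_w (1 - stay k w) + \int[P x]_w (stay k w * f k w) <=
    1 - expR (- (x * lambda)).
  elim: k => [|k IH].
    rewrite -bintegralZ; last by apply: bmeasB => //; exact: bmeas_cst.
    rewrite -bintegralD; last 2 first.
    - by apply: bmeasZ; apply: bmeasB => //; exact: bmeas_cst.
    - exact: bmeasM.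
    have -> : 1 - expR (- (x * lambda)) = \int[P x]_w f 0%N w.
      rewrite bintegralB ?bintegral_cst//; last exact: bmeas_cst.
      have := cb_start_integral HX x0 (bmeas_exp_max l0); rewrite max_l// mulrC => <-.
      congr (1 - _); apply: eq_Rintegral => w _.
      by rewrite mul0r addr0 max_l// X0.
    apply: le_bintegral => // [|w].
      apply: bmeasD; last exact: bmeasM.
      by apply: bmeasZ; apply: bmeasB => //; exact: bmeas_cst.
    rewrite /stay big_ord1; case: (leP _ c) => hc; first by rewrite subrr mulr0 add0r mul1r.
    rewrite subr0 mulr1 mul0r addr0 lerD2l lerN2 ler_expR lerN2.
    by rewrite ler_wpM2l// ltW.
  apply: le_trans IH.
  have E : \int[P x]_w (1 - stay k.+1 w) =
      \int[P x]_w (1 - stay k w) + \int[P x]_w (stay k w - stay k.+1 w).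
    rewrite -bintegralD; [|by apply: bmeasB => //; exact: bmeas_cst|exact: bmeasB].
    by apply: eq_Rintegral => w _; rewrite addrA subrK.
  rewrite E mulrDr -addrA lerD2l; apply: le_trans (super k).
  rewrite -bintegralZ; last exact: bmeasB.
  rewrite -bintegralD; [|by apply: bmeasZ; exact: bmeasB|exact: bmeasM].
  apply: le_bintegral => [||w].
  - by apply: bmeasD; [apply: bmeasZ; exact: bmeasB|exact: bmeasM].
  - exact: bmeasM.
  have -> : stay k.+1 w = stay k w * (X (0 + k.+1%:R * h) w <= c)%R%:R.
    by rewrite /stay big_ord_recr.
  case: (leP _ c) => hc; first by rewrite mulr1 subrr mulr0 add0r.
  rewrite mulr0 subr0 mul0r addr0 mulrC ler_wpM2l// lerD2l lerN2 ler_expR lerN2.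
  by rewrite ler_wpM2l// ltW.
have e0 : 0 <= e by rewrite subr_ge0 -[leRHS]expR0 ler_expR oppr_le0 mulr_ge0.
apply: le_trans (main n); rewrite -[leLHS]addr0 lerD//; last first.
  by apply: Rintegral_ge0 => w _; rewrite mulr_ge0.
have bB : bmeas (fun w => below c (grid (X ^~ w) 0 h) n).
  exact: (past_bmeas HX (tk n) (past_below c n h0)).
rewrite ler_wpM2l//; apply: le_bintegral => [||w].
- by apply: bmeasB => //; exact: bmeas_cst.
- by apply: bmeasB => //; exact: bmeas_cst.
(* [stay] has n + 1 factors, one for each grid point, and [below] has n: if all values are at most
   [c], so are the increments, the values being nonnegative. *)
rewrite lerD2l lerN2 /stay /below; have [/allP H|] := boolP (all (fun j : nat => X (0 + j%:R * h) w <= c) (iota 0 n.+1)).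
  rewrite [leRHS]big1 => [|j _]; first by apply: prodr_ile1 => j _; rewrite ler0n lern1 leq_b1.
  have hj : X (0 + j.+1%:R * h) w <= c by apply: H; rewrite mem_iota/= ltnS.
  by rewrite /grid (le_trans _ hj)// gerBl X0// tk.
move=> /allPn[j]; rewrite mem_iota/= => jn Xj.
rewrite (bigD1 (Ordinal jn))//= (negbTE Xj) mul0r.
by apply: prodr_ge0 => i _; exact: ler0n.
Qed.

End cb_estimates.

(** * Positivity of the probability of a large jump *)

Lemma poly_lin_ind {R : nzRingType} (C : {poly R} -> Prop) :
  C 0 -> (forall c n, C (c *: 'X^n)) -> (forall p q, C p -> C q -> C (p + q)) ->
  forall p, C p.
Proof. by move=> C0 CX CD p; rewrite -[p]coefK poly_def; elim/big_ind : _. Qed.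

Lemma deriv_factor {R : comNzRingType} (n : nat) (g : {poly R}) :
  exists g', ((1 - 'X) ^+ n.+1 * g)^`() = (1 - 'X) ^+ n * g'.
Proof.
exists ((1 - 'X)^`() *+ n.+1 * g + (1 - 'X) * g^`()).
rewrite derivM deriv_exp -pred_Sn mulrDr; congr (_ + _).
  by rewrite [_ * (1 - 'X) ^+ n]mulrC -mulrnAr mulrA.
by rewrite exprSr mulrA.
Qed.

Lemma horner_factor0 {R : comNzRingType} (n : nat) (g : {poly R}) :
  ((1 - 'X) ^+ n.+1 * g).[1] = 0.
Proof. by rewrite hornerM horner_exp !hornerE subrr expr0n mul0r. Qed.

Lemma expR_taylor1 {R : realType} (z : R) : `|expR z - 1 - z| <= z ^+ 2 * expR `|z|.
Proof.
have h1 := expR_ge1Dx z; have h2 := expR_ge1Dx (- z).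
have e0 := expR_gt0 z.
have h3 : expR z - 1 <= z * expR z.
  have : expR z * (1 - z) <= expR z * expR (- z) by rewrite ler_pM2l//; lra.
  by rewrite -expRD subrr expR0; lra.
rewrite ger0_norm; last by lra.
have [z0|z0] := leP 0 z.
  by rewrite expr2 -mulrA (ger0_norm z0); have := ler_wpM2l z0 h3; have := mulr_ge0 z0 (expR_ge0 z); lra.
have h4 : z * (expR z - 1) <= z ^+ 2.
  have : 0 <= (- z) * (expR z - 1 - z) by rewrite mulr_ge0; lra.
  by rewrite expr2; lra.
have h5 : z ^+ 2 <= z ^+ 2 * expR `|z|.
  by rewrite -[leLHS]mulr1 ler_wpM2l ?sqr_ge0// -expR0 ler_expR.
have h6 : z * expR z <= z + z * (expR z - 1) by rewrite mulrBr mulr1 addrC subrK.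
lra.
Qed.

(** * The generator on polynomials in e^{-z} *)

Section exponential_polynomials.
Context {R : realType}.
Variables (alpha beta : R) (nu : {measure set R -> \bar R}).
Hypothesis bm : branching_mechanism alpha beta nu.
Notation Phi := (branching_function alpha beta nu).
Notation pos := (`]0%R, +oo[%classic : set R).

(** For f(z) = p(e^{-z}) one has f'(0) = - p'(1), so this is the compensated jump f(theta) - f(0) -
    theta f'(0). *)
Definition levy_poly (p : {poly R}) (theta : R) : R :=
  p.[expR (- theta)] - p.[1] + theta * p^`().[1].

(* The generator at 0 applied to the function z |-> p(e^{-z}), up to the factor X. *)
Definition generator (p : {poly R}) : R :=
  alpha * p^`().[1] + beta * (p^`()^`().[1] + p^`().[1])
  + \int[nu]_(theta in pos) levy_poly p theta.

Lemma levy_polyXn n theta : levy_poly 'X^n theta = levy_kernel n%:R theta.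
Proof.
rewrite /levy_poly /levy_kernel derivXn hornerMn !hornerXn !expr1n.
by rewrite -expRM_natl mulrN [theta * _]mulrC.
Qed.

Lemma levy_polyZ c p theta : levy_poly (c *: p) theta = c * levy_poly p theta.
Proof. by rewrite /levy_poly derivZ !hornerZ; ring. Qed.

Lemma levy_polyD p q theta : levy_poly (p + q) theta = levy_poly p theta + levy_poly q theta.
Proof. by rewrite /levy_poly derivD !hornerD; ring. Qed.

Lemma levy_poly_integrable p : nu.-integrable pos (EFin \o levy_poly p).
Proof.
move: p; apply: poly_lin_ind => [|c n|p q ip iq].
- apply: (@eq_integrable _ _ _ _ _ _ (fun=> 0%E)) => //; last exact: integrable0.
  by move=> theta _; rewrite /= /levy_poly deriv0 !horner0 subrr mulr0 addr0.
- have -> : EFin \o levy_poly (c *: 'X^n) = (fun theta => c%:E * (EFin \o levy_kernel n%:R) theta)%E.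
    by apply/funext => theta /=; rewrite levy_polyZ levy_polyXn.
  by apply: integrableZl => //; exact: (levy_kernel_integrable bm).
have -> : EFin \o levy_poly (p + q) = ((EFin \o levy_poly p) \+ (EFin \o levy_poly q))%E.
  by apply/funext => theta /=; rewrite levy_polyD.
exact: integrableD.
Qed.

(** This links [generator] to Laplace transforms: being linear, it is determined by its values on
    monomials, and these correspond to the exponentials e^{-nz}. The diffusion term is beta (n (n -
    1) + n) = beta n^2. *)
Lemma generatorXn n : generator 'X^n = Phi n%:R.
Proof.
rewrite /generator branching_functionE; congr (_ + _); last first.
  by apply: eq_Rintegral => theta _; exact: levy_polyXn.
rewrite derivXn derivMn derivXn !hornerMn !hornerXn !expr1n.
congr (_ + beta * _); case: n => [|n]; first by rewrite !mulr0n addr0 expr0n.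
by rewrite /= -mulrnA -mulrnDr -natrX; congr (_%:R); rewrite addnC -mulSn mulnn.
Qed.

Lemma generator0 : generator 0 = 0.
Proof.
rewrite /generator !deriv0 horner0 !mulr0 addr0 mulr0 !add0r.
under eq_Rintegral do rewrite /levy_poly deriv0 !horner0 subrr mulr0 addr0.
by rewrite /Rintegral integral0.
Qed.

Lemma generatorZ c p : generator (c *: p) = c * generator p.
Proof.
rewrite /generator; under eq_Rintegral do rewrite levy_polyZ.
rewrite RintegralZl//; last exact: levy_poly_integrable.
by rewrite !derivZ !hornerZ; ring.
Qed.

Lemma generatorD p q : generator (p + q) = generator p + generator q.
Proof.
rewrite /generator; under eq_Rintegral do rewrite levy_polyD.
rewrite RintegralD//; try exact: levy_poly_integrable.
by rewrite !derivD !hornerD; ring.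
Qed.

(** The support has no negative point, as ]-oo, 0[ is open and carries no mass; so it is unbounded
    to the right and has a point above [c], of which ]c, +oo[ is a neighbourhood. *)
Lemma measure_support_pos (c : R) : ~ bounded_set (measure_support nu) -> 0 <= c ->
  (0 < nu `]c, +oo[%classic)%E.
Proof.
move=> unb c0; have [theta [Stheta ctheta]] : exists theta, measure_support nu theta /\ c < theta.
  apply: contrapT => H; apply: unb; exists c; split; first exact: num_real.
  move=> M cM theta Stheta /=.
  have t0 : 0 <= theta.
    rewrite leNgt; apply/negP => tn.
    have := Stheta `]-oo, 0[%classic (lray_open _) _.
    rewrite /= in_itv/= => /(_ tn); rewrite lt_neqAle => /andP[/eqP nz _]; apply: nz.
    apply/esym/eqP; rewrite -measure_le0 -(levy_carrier (branching_levy bm)).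
    apply: le_measure; rewrite ?inE//.
    by move=> z /=; rewrite !in_itv/= => /ltW.
  rewrite ger0_norm// (le_trans _ (ltW cM))// leNgt; apply/negP => ct.
  by apply: H; exists theta.
apply: Stheta; first exact: rray_open.
by rewrite /= in_itv/= andbT.
Qed.

(* The witness is p = (1 - q)^k (rho - q), with rho = e^{-c} and k even and large.
   It vanishes at 1 to order k, which kills the drift, the diffusion and the
   compensator; the jumps below c, where p is negative, become negligible against
   those above c + 1. *)
Lemma exp_poly_positive (c : R) : ~ bounded_set (measure_support nu) -> 0 <= c ->
  exists p : {poly R}, [/\ p.[1] = 0, 0 < generator p &
    forall q, 0 <= q -> p.[q] <= (q < expR (- c))%R%:R].
Proof.
move=> unb c0; pose c' := c + 1.
pose rho := expR (- c); pose rho' := expR (- c').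
have rho1 : rho <= 1 by rewrite /rho -[leRHS]expR0 ler_expR oppr_le0.
have rr : rho' < rho by rewrite ltr_expR ltrN2 ltrDl.
have rho'0 : 0 < rho' by exact: expR_gt0.
pose a := 1 - rho'; pose b := 1 - rho.
have b0 : 0 <= b by rewrite subr_ge0.
have ba : b < a by rewrite ltrD2l ltrN2.
have a0 : 0 < a by exact: le_lt_trans ba.
pose mn (theta : R) := Num.min theta (theta ^+ 2).
pose ind : R -> R := \1_(`]c', +oo[ : set R).
have c'1 : 1 <= c' by rewrite lerDr.
have mn0 theta : 0 < theta -> 0 <= mn theta.
  by move=> t0; rewrite le_min ltW//= exprn_ge0// ltW.
have imn : nu.-integrable pos (EFin \o mn) by exact: (levy_min_integrable bm).
have iind : nu.-integrable pos (EFin \o ind).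
  apply: le_integrable imn => //.
    by apply/measurable_EFinP; exact: measurable_indic.
  move=> theta /=; rewrite in_itv/= andbT => t0; rewrite lee_fin.
  rewrite (ger0_norm (mn0 _ t0)) /ind indicE; case: (boolP (_ \in _)); last by rewrite normr0 mn0.
  rewrite inE/= in_itv/= andbT => ct; rewrite normr1 /mn.
  have t1 : 1 <= theta by rewrite (le_trans c'1)// ltW.
  by rewrite le_min t1/= exprn_ege1.
pose m1 := \int[nu]_(theta in pos) mn theta.
pose k1 := \int[nu]_(theta in pos) ind theta.
have m10 : 0 <= m1.
  by apply: Rintegral_ge0 => theta; rewrite /= in_itv/= andbT; exact: mn0.
have k10 : 0 < k1.
  have := measure_support_pos unb (le_trans ler01 c'1).
  have -> : nu `]c', +oo[%classic = (\int[nu]_(theta in pos) (ind theta)%:E)%E.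
    rewrite integral_indic//; congr (nu _); apply/seteqP; split=> z /=; last by case.
    rewrite !in_itv/= !andbT => cz; split=> //.
    by rewrite (le_lt_trans _ cz)// (le_trans ler01).
  by rewrite -[X in (0 < X)%E]fineK ?lte_fin//; exact: integrable_fin_num.
(* Jumps above c' contribute at least a^k (rho - rho') k1 and those below [c] at least - b^{k-2} m1;
   as b < a, a large power decides. Two factors 1 - q are set aside from b^k because (1 - q)^2 <=
   min(theta, theta^2) makes the small jumps integrable. *)
have [m Hm] : exists m : nat, (b / a) ^+ m * m1 < a ^+ 2 * (rho - rho') * k1.
  have s1 : `|b / a| < 1.
    by rewrite ger0_norm ?divr_ge0 ?(ltW a0)// ltr_pdivrMr// mul1r.
  have K0 : 0 < a ^+ 2 * (rho - rho') * k1.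
    have rr0 : 0 < rho - rho' by rewrite subr_gt0.
    by rewrite mulr_gt0// mulr_gt0// exprn_gt0.
  have h : (b / a) ^+ n * m1 @[n --> \oo] --> (0 * m1 : R) by apply: cvgMl; exact: cvg_expr.
  move: h; rewrite mul0r => /cvgrPdist_lt/(_ _ K0)[m _ Hm].
  exists m; have := Hm m (leqnn m); rewrite /= sub0r normrN.
  exact: le_lt_trans (ler_norm _).
(* The doubling makes [k] even, so that p(q) has the sign of rho - q or vanishes; the shift makes it
   at least 4, so that p' and p'' still vanish at 1. *)
pose k := m.+2.*2.
have [j jE] : exists j, k = j.+4 by exists m.*2; rewrite /k !doubleS.
pose p : {poly R} := (1 - 'X) ^+ k * (rho%:P - 'X).
have pq q : p.[q] = (1 - q) ^+ k * (rho - q) by rewrite /p hornerM horner_exp !hornerE.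
have p1 : p.[1] = 0 by rewrite /p jE horner_factor0.
have [g1 p'E] := deriv_factor j.+3 (rho%:P - 'X).
have [g2 p''E] := deriv_factor j.+2 g1.
have p'1 : p^`().[1] = 0 by rewrite /p jE p'E horner_factor0.
have p''1 : p^`()^`().[1] = 0 by rewrite /p jE p'E p''E horner_factor0.
have even_ge0 (q : R) : 0 <= (1 - q) ^+ k by rewrite exprn_even_ge0// /k odd_double.
exists p; split=> //; last first.
  move=> q q0; rewrite pq; case: (ltP q) => hq; last first.
    by rewrite mulr_ge0_le0// subr_le0.
  have q1 : q <= 1 by exact: le_trans (ltW hq) rho1.
  have h1 : (1 - q) ^+ k <= 1 by rewrite exprn_ile1 ?subr_ge0// gerBl.
  have h2 : rho - q <= 1 by lra.
  by rewrite -[leRHS]mulr1 ler_pM// subr_ge0 ltW.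
rewrite /generator p'1 p''1 addr0 !mulr0 !add0r.
pose A := a ^+ k * (rho - rho'); pose B := b ^+ (k - 2).
have AB : 0 < A * k1 - B * m1.
  have kE : k = ((m + m).+2).+2 by rewrite /k !doubleS addnn.
  rewrite subr_gt0 /A /B kE subSS subSS subn0.
  have h1 : (b / a) ^+ (m + m).+2 <= (b / a) ^+ m.
    rewrite ler_wiXn2l ?divr_ge0 ?(ltW a0)//; first by rewrite ler_pdivrMr// mul1r ltW.
    by rewrite -addnS -addnS leq_addr.
  have h2 : (b / a) ^+ (m + m).+2 * m1 < a ^+ 2 * (rho - rho') * k1.
    by apply: le_lt_trans Hm; rewrite ler_wpM2r.
  move: h2; rewrite exprMn exprVn.
  have ak : 0 < a ^+ (m + m).+2 by rewrite exprn_gt0.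
  rewrite mulrAC ltr_pdivrMr// => h2; apply: (lt_le_trans h2).
  by rewrite -[in leRHS]addn2 exprD le_eqVlt; apply/orP; left; apply/eqP; ring.
apply: (lt_le_trans AB).
have ig : nu.-integrable pos (EFin \o (fun theta => A * ind theta - B * mn theta)).
  exact: (integrableB _ (integrableZl _ A iind) (integrableZl _ B imn)).
have -> : A * k1 - B * m1 = \int[nu]_(theta in pos) (A * ind theta - B * mn theta).
  rewrite RintegralB//; [|exact: (integrableZl _ A iind)|exact: (integrableZl _ B imn)].
  by rewrite !RintegralZl.
apply: le_Rintegral => //; first exact: levy_poly_integrable.
move=> theta; rewrite /= in_itv/= andbT => t0.
rewrite /levy_poly p1 p'1 mulr0 addr0 subr0 pq.
set q := expR (- theta).
have q0 : 0 < q by exact: expR_gt0.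
have q1 : q <= 1 by rewrite /q -[leRHS]expR0 ler_expR oppr_le0 ltW.
have A0 : 0 <= A by rewrite mulr_ge0 ?exprn_ge0 ?(ltW a0)// subr_ge0 ltW.
have B0 : 0 <= B by rewrite exprn_ge0.
have Bm : 0 <= B * mn theta by rewrite mulr_ge0// mn0.
rewrite /ind indicE; case: (boolP (_ \in _)).
  rewrite inE/= in_itv/= andbT => ct.
  have qr : q < rho' by rewrite /q /rho' ltr_expR ltrN2.
  rewrite mulr1; apply: (@le_trans _ _ A); first by rewrite gerBl.
  apply: ler_pM; rewrite ?exprn_ge0 ?(ltW a0) ?subr_ge0 ?(ltW rr)//.
    by rewrite lerXn2r ?nnegrE ?(ltW a0) ?subr_ge0// lerD2l lerN2 ltW.
  by rewrite lerD2l lerN2 ltW.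
move=> _; rewrite mulr0 sub0r.
have [hq|hq] := leP q rho.
  apply: (@le_trans _ _ 0); first by rewrite oppr_le0.
  by rewrite mulr_ge0// subr_ge0.
rewrite -[rho - q]opprB mulrN lerN2.
have kE : k = ((k - 2) + 2)%N by rewrite subnK// /k doubleS.
rewrite kE exprD -mulrA; apply: ler_pM.
- by rewrite exprn_ge0// subr_ge0.
- by rewrite mulr_ge0 ?sqr_ge0// subr_ge0 ltW.
- by rewrite /B lerXn2r ?nnegrE ?subr_ge0// lerD2l lerN2 ltW.
apply: (@le_trans _ _ ((1 - q) ^+ 2)).
  rewrite -[leRHS]mulr1 ler_wpM2l ?sqr_ge0//.
  by have := expR_gt0 (- c); rewrite -/rho; lra.
have h1 : 1 - q <= theta by have := expR_ge1Dx (- theta); rewrite -/q; lra.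
have h0 : 0 <= 1 - q by rewrite subr_ge0.
rewrite le_min; apply/andP; split; last by rewrite lerXn2r ?nnegrE// ltW.
by rewrite expr2 (le_trans _ h1)// ler_piMr// gerBl ltW.
Qed.

End exponential_polynomials.

(** * Increments above a level occur at a positive rate *)

Section cb_positivity.
Context {R : realType} {d} {T : measurableType d}.
Variables (alpha beta : R) (nu : {measure set R -> \bar R}).
Hypothesis bm : branching_mechanism alpha beta nu.
Notation Phi := (branching_function alpha beta nu).
Variables (X : R -> T -> R) (P : R -> probability T R).
Hypothesis HX : cb_process Phi X P.
Variable v : R -> R -> R.
Hypothesis cv : forall lambda : R, 0 <= lambda -> cumulant_solution Phi lambda (v ^~ lambda).
Hypothesis laplaceE : forall x t lambda : R, 0 <= x -> 0 <= t -> 0 <= lambda ->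
  \int[P x]_w expR (- (lambda * X t w)) = expR (- (x * v t lambda)).

Notation past t := (g_sigma_algebraType (history X t)).
Let lipPhi := branching_function_lipschitz bm.
Let Phi0 : Phi 0 = 0. Proof. exact: branching_function0. Qed.

Let X0 t w : 0 <= t -> 0 <= X t w. Proof. exact: (cb_ge0 HX). Qed.
Let mX t : 0 <= t -> measurable_fun setT (X t). Proof. exact: (X_measurable HX). Qed.
Let rX w : rcll (X ^~ w). Proof. exact: (cb_rcll HX). Qed.

Lemma v_ge0 t lambda : 0 <= t -> 0 <= lambda -> 0 <= v t lambda.
Proof. by move=> t0 l0; exact: (cumulant_ge0 (cv l0)). Qed.

Lemma v_init lambda : 0 <= lambda -> v 0 lambda = lambda.
Proof. by move=> l0; exact: (cumulant0 (cv l0)). Qed.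

Lemma v_lip t lambda : 0 <= t -> 0 <= lambda -> exists2 K : R, 0 <= K &
  forall r s : R, 0 <= r -> r <= s -> s <= t -> `|v s lambda - v r lambda| <= K * (s - r).
Proof. by move=> t0 l0; exact: (cumulant_lipschitz lipPhi Phi0 (cv l0)). Qed.

(** The exponent z is y delta Phi(n) + O(delta^2) by [cumulant_derivative], and e^z = 1 + z + O(z^2)
    with |z| <= 2 K delta. The bound y <= 2 makes the constant uniform. *)
Lemma laplace_taylor (n : nat) : exists2 C : R, 0 <= C &
  forall y delta, 0 <= y <= 2 -> 0 <= delta <= 1 ->
  `|expR (- (y * (v delta n%:R - n%:R))) - 1 - delta * y * Phi n%:R| <= C * delta ^+ 2.
Proof.
have n0 : 0 <= n%:R :> R by exact: ler0n.
have [C C0 HC] := cumulant_derivative lipPhi Phi0 (cv n0).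
have [K K0 HK] := v_lip ler01 n0.
exists ((2 * K) ^+ 2 * expR (2 * K) + 2 * C).
  by rewrite addr_ge0 ?mulr_ge0 ?sqr_ge0 ?expR_ge0.
move=> y delta /andP[y0 y2] /andP[d0 d1].
set z := - (y * (v delta n%:R - n%:R)).
have hz : `|z| <= 2 * K * delta.
  rewrite normrN normrM (ger0_norm y0) -mulrA ler_pM//.
  by have := HK 0 delta (lexx 0) d0 d1; rewrite v_init// subr0.
have hz1 : `|z| <= 2 * K.
  by apply: (le_trans hz); rewrite -[leRHS]mulr1 ler_wpM2l// mulr_ge0.
have -> : expR z - 1 - delta * y * Phi n%:R =
    (expR z - 1 - z) - y * (v delta n%:R - n%:R + Phi n%:R * delta).
  by rewrite /z; ring.
rewrite (le_trans (ler_normB _ _))// [leRHS]mulrDl lerD//.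
  apply: (le_trans (expR_taylor1 z)).
  have h1 : z ^+ 2 <= (2 * K * delta) ^+ 2.
    rewrite -[leLHS]ger0_norm ?sqr_ge0// normrX lerXn2r ?nnegrE ?normr_ge0//.
    by rewrite !mulr_ge0.
  have h2 : expR `|z| <= expR (2 * K) by rewrite ler_expR.
  apply: (le_trans (ler_pM (sqr_ge0 _) (expR_ge0 _) h1 h2)).
  by rewrite [X in X * _ <= _]exprMn mulrAC.
rewrite normrM (ger0_norm y0) -mulrA ler_pM//.
by apply: HC; rewrite d0.
Qed.

(** The increment enters as e^{n X_t} e^{- n X_{t+delta}}, whose first factor is bounded only on a
    bounded range of X_t. The level 2 leaves room around the starting point 1. *)
Definition supported_le2 t (G : T -> R) := forall w, 2 < X t w -> G w = 0.

Lemma past_exp_mul t (n : nat) (G : T -> R) : 0 <= t -> @bmeas R _ (past t) G ->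
  supported_le2 t G -> @bmeas R _ (past t) (fun w => G w * expR (n%:R * X t w)).
Proof.
move=> t0 bG sG.
apply: (@eq_bmeas _ _ (past t) (fun w => G w * expR (n%:R * Num.min (X t w) 2))).
  move=> w; have [h|h] := leP (X t w) 2; first by [].
  by rewrite sG// !mul0r.
apply: bmeasM => //; apply: (@bmeas_itv _ _ (past t) 0 (expR (n%:R * 2))).
  apply: measurableT_comp => //; apply: measurable_funM => //.
  apply: (@measurable_minr _ (past t)) => //; exact: past_adapted.
move=> w; rewrite expR_ge0 ler_expR ler_wpM2l//.
by rewrite ge_min lexx orbT.
Qed.

Lemma poly_increment_bmeas t delta (p : {poly R}) (G : T -> R) : 0 <= t -> 0 <= delta ->
  @bmeas R _ (past t) G -> supported_le2 t G ->
  bmeas (fun w => G w * p.[expR (X t w - X (t + delta) w)]).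
Proof.
move=> t0 d0 bG sG; have td0 : 0 <= t + delta by exact: addr_ge0.
move: p; apply: poly_lin_ind => [|c n|p q bp bq].
- by under eq_fun do rewrite horner0 mulr0; exact: bmeas_cst.
- apply: (@eq_bmeas _ _ _ (fun w => c * ((G w * expR (n%:R * X t w)) *
    expR (- (n%:R * X (t + delta) w))))).
    move=> w; rewrite hornerZ hornerXn -expRM_natl mulrBr expRD; ring.
  apply: bmeasZ; apply: bmeasM; last exact: (bmeas_expX HX).
  exact: (past_bmeas HX t0 (past_exp_mul n t0 bG sG)).
apply: (@eq_bmeas _ _ _ (fun w => G w * p.[expR (X t w - X (t + delta) w)] +
  G w * q.[expR (X t w - X (t + delta) w)])).
  by move=> w; rewrite hornerD mulrDr.
exact: bmeasD.
Qed.

(** Both integrals are linear in [p], so monomials suffice; for these the Markov property gives the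
    conditional mean exactly and [laplace_taylor] expands it. Where [G] does not vanish the minimum
    with 2 is X_t itself; elsewhere it keeps the integrand bounded. *)
Lemma generator_estimate (p : {poly R}) : exists2 C : R, 0 <= C &
  forall x t delta (G : T -> R), 0 <= x -> 0 <= t -> 0 <= delta <= 1 ->
  @bmeas R _ (past t) G -> supported_le2 t G ->
  `|\int[P x]_w (G w * p.[expR (X t w - X (t + delta) w)]) -
    \int[P x]_w (G w * (p.[1] + delta * Num.min (X t w) 2 * generator alpha beta nu p))|
  <= C * delta ^+ 2 * \int[P x]_w `|G w|.
Proof.
have bmin t : 0 <= t -> bmeas (fun w => Num.min (X t w) 2).
  move=> t0; apply: (@bmeas_itv _ _ _ 0 2) => [|w].
    by apply: measurable_minr => //; exact: mX.
  by rewrite le_min X0//= ge_min lexx orbT ler0n.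
have babs (G : T -> R) : bmeas G -> bmeas (fun w => `|G w|).
  move=> [mG [M GM]]; split; first exact: measurableT_comp.
  by exists M => w; rewrite normr_id.
move: p; apply: poly_lin_ind => [|c n|p q [C1 C10 H1] [C2 C20 H2]].
- exists 0 => // x t delta G x0 t0 dI bG sG.
  under eq_Rintegral do rewrite horner0 mulr0.
  under [X in _ - X]eq_Rintegral do rewrite horner0 generator0// mulr0 addr0 mulr0.
  by rewrite bintegral_cst subrr normr0 !mul0r.
- have [C C0 HC] := laplace_taylor n.
  exists (`|c| * C); first by rewrite mulr_ge0.
  move=> x t delta G x0 t0 /andP[d0 d1] bG sG.
  have td0 : 0 <= t + delta by exact: addr_ge0.
  have n0 : 0 <= n%:R :> R by exact: ler0n.
  have bG' := past_bmeas HX t0 bG.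
  have bH := past_exp_mul n t0 bG sG.
  have bH' := past_bmeas HX t0 bH.
  have vn0 : 0 <= v delta n%:R by exact: v_ge0.
  have E1 : \int[P x]_w (G w * (c *: 'X^n).[expR (X t w - X (t + delta) w)]) =
      \int[P x]_w (c * (G w * expR (- (Num.min (X t w) 2 * (v delta n%:R - n%:R))))).
    transitivity (\int[P x]_w (c * ((G w * expR (n%:R * X t w)) *
        expR (- (n%:R * X (t + delta) w))))).
      apply: eq_Rintegral => w _.
      by rewrite hornerZ hornerXn -expRM_natl mulrBr expRD; ring.
    rewrite bintegralZ; last by apply: bmeasM => //; exact: (bmeas_expX HX).
    rewrite (laplace_markov HX laplaceE x0 d0 t0 n0 bH).
    rewrite -bintegralZ; last by apply: bmeasM => //; exact: (bmeas_expX HX).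
    apply: eq_Rintegral => w _; congr (_ * _).
    have [h|h] := leP (X t w) 2; last by rewrite sG// !mul0r.
    by rewrite -mulrA -expRD; congr (_ * expR _); ring.
  have bE : bmeas (fun w => expR (- (Num.min (X t w) 2 * (v delta n%:R - n%:R)))).
    split.
      apply: measurableT_comp => //; apply: measurable_funN.
      by apply: measurable_funM => //; have [] := bmin t t0.
    exists (expR (2 * `|v delta n%:R - n%:R|)) => w.
    rewrite ger0_norm ?expR_ge0// ler_expR -mulrN (le_trans (ler_norm _))// normrM normrN.
    rewrite ler_wpM2r// ger0_norm; first by rewrite ge_min lexx orbT.
    by rewrite le_min X0//= ler0n.
  have E2 w : (c *: 'X^n).[1] + delta * Num.min (X t w) 2 * generator alpha beta nu (c *: 'X^n) =
      c * (1 + delta * Num.min (X t w) 2 * Phi n%:R).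
    by rewrite hornerZ hornerXn expr1n generatorZ// generatorXn; ring.
  rewrite E1; under [X in _ - X]eq_Rintegral do rewrite E2.
  have b1 : bmeas (fun w => c * (G w * expR (- (Num.min (X t w) 2 * (v delta n%:R - n%:R))))).
    by apply: bmeasZ; exact: bmeasM.
  have b2 : bmeas (fun w => G w * (c * (1 + delta * Num.min (X t w) 2 * Phi n%:R))).
    apply: bmeasM => //; apply: bmeasZ; apply: bmeasD; first exact: bmeas_cst.
    by apply: bmeasM; [apply: bmeasM; [exact: bmeas_cst|exact: bmin]|exact: bmeas_cst].
  rewrite -bintegralB// -bintegralZ; last exact: babs.
  have b3 := bmeasB b1 b2.
  apply: (le_trans (le_normr_Rintegral measurableT (bmeas_integrable (P x) b3))).
  apply: le_bintegral => [||w]; [exact: babs|by apply: bmeasZ; exact: babs|].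
  set y := Num.min _ _.
  have yI : 0 <= y <= 2 by rewrite le_min X0//= ler0n ge_min lexx orbT.
  have -> : c * (G w * expR (- (y * (v delta n%:R - n%:R)))) - G w * (c * (1 + delta * y * Phi n%:R)) =
     c * (expR (- (y * (v delta n%:R - n%:R))) - 1 - delta * y * Phi n%:R) * G w by ring.
  rewrite !normrM ler_wpM2r// -[leRHS]mulrA ler_wpM2l// HC// d0//.
exists (C1 + C2); first exact: addr_ge0.
move=> x t delta G x0 t0 dI bG sG; have /andP[d0 d1] := dI.
have bG' := past_bmeas HX t0 bG.
have bgen r : bmeas (fun w => G w * (r.[1] + delta * Num.min (X t w) 2 * generator alpha beta nu r)).
  apply: bmeasM => //; apply: bmeasD; first exact: bmeas_cst.
  by apply: bmeasM; [apply: bmeasM; [exact: bmeas_cst|exact: bmin]|exact: bmeas_cst].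
have bpoly r := poly_increment_bmeas r t0 d0 bG sG.
have -> : \int[P x]_w (G w * (p + q).[expR (X t w - X (t + delta) w)]) =
    \int[P x]_w (G w * p.[expR (X t w - X (t + delta) w)]) +
    \int[P x]_w (G w * q.[expR (X t w - X (t + delta) w)]).
  by rewrite -bintegralD//; apply: eq_Rintegral => w _; rewrite hornerD mulrDr.
have -> : \int[P x]_w (G w * ((p + q).[1] + delta * Num.min (X t w) 2 * generator alpha beta nu (p + q))) =
    \int[P x]_w (G w * (p.[1] + delta * Num.min (X t w) 2 * generator alpha beta nu p)) +
    \int[P x]_w (G w * (q.[1] + delta * Num.min (X t w) 2 * generator alpha beta nu q)).
  rewrite -bintegralD//; apply: eq_Rintegral => w _.
  by rewrite hornerD generatorD//; ring.
rewrite opprD addrACA (le_trans (ler_normD _ _))// !mulrDl lerD//.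
  exact: H1.
exact: H2.
Qed.

Definition mid (z : R) : R := (2^-1 <= z <= 2)%R%:R.

(** Chebyshev's inequality for e^{- X_s}: the mean of its squared distance from e^{-1} is at most K
    s, by the Laplace transforms at 1 and 2, while the distance is at least [eta] when X_s is
    outside [1/2, 2]. *)
Lemma near_start : exists2 t0 : R, 0 < t0 <= 1 &
  forall s, 0 <= s <= t0 -> \int[P 1]_w (1 - mid (X s w)) <= 2^-1.
Proof.
have l2 : 0 <= 2 :> R by [].
have [K1 K10 H1] := v_lip ler01 ler01.
have [K2 K20 H2] := v_lip ler01 l2.
pose K := K2 + 2 * K1.
have K0 : 0 <= K by rewrite addr_ge0// mulr_ge0.
have expdiff (a b : R) : 0 <= a -> expR (- a) - expR (- b) <= `|b - a|.
  move=> a0; have e1 : expR (- a) <= 1 by rewrite -[leRHS]expR0 ler_expR oppr_le0.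
  have -> : expR (- b) = expR (- a) * expR (- (b - a)).
    by rewrite -expRD; congr expR; ring.
  have h := expR_ge1Dx (- (b - a)); have hn := ler_norm (b - a).
  apply: (@le_trans _ _ (expR (- a) * `|b - a|)).
    by rewrite -[X in X - _]mulr1 -mulrBr ler_wpM2l ?expR_ge0//; lra.
  by rewrite ler_piMl.
pose eta := Num.min (expR (- 2^-1) - expR (- 1)) (expR (- 1) - expR (- 2)) : R.
have eta0 : 0 < eta.
  by rewrite lt_min !subr_gt0 !ltr_expR; apply/andP; split; lra.
have eta1 : eta <= expR (- 2^-1) - expR (- 1) by rewrite ge_min lexx.
have eta2 : eta <= expR (- 1) - expR (- 2) by rewrite ge_min lexx orbT.
have e20 : 0 < eta ^+ 2 by rewrite exprn_gt0.
have K20' : 0 < 2 * (K + 1) by rewrite mulr_gt0// ltr_wpDl.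
(* Then K s / eta^2 is at most 1/2; the + 1 avoids a division by 0 when K = 0. *)
exists (Num.min 1 (eta ^+ 2 / (2 * (K + 1)))).
  by rewrite lt_min ltr01 divr_gt0//= ge_min lexx.
move=> s /andP[s0]; rewrite le_min => /andP[s1 st].
have bE c : 0 <= c -> bmeas (fun w => expR (- (c * X s w))).
  by move=> c0; exact: (bmeas_expX HX).
have b2 := bE 2 l2; have b1 := bE 1 ler01.
have bmid : bmeas (fun w => mid (X s w)).
  apply: bmeas_boolr; apply: measurable_and; apply: measurable_fun_ler => //; exact: mX.
have bsq : bmeas (fun w => (expR (- 1) - expR (- (1 * X s w))) ^+ 2).
  by apply: bmeasX; apply: bmeasB => //; exact: bmeas_cst.
have I2 : \int[P 1]_w (expR (- 1) - expR (- (1 * X s w))) ^+ 2 <= K * s.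
  have E w : (expR (- 1) - expR (- (1 * X s w))) ^+ 2 =
      expR (- 2) + expR (- (2 * X s w)) + (- (2 * expR (- 1))) * expR (- (1 * X s w)).
    have -> : expR (- 2) = expR (- 1) ^+ 2 :> R by rewrite expr2 -expRD; congr expR; ring.
    have -> : expR (- (2 * X s w)) = expR (- (1 * X s w)) ^+ 2.
      by rewrite expr2 -expRD; congr expR; ring.
    by ring.
  under eq_Rintegral do rewrite E.
  rewrite bintegralD; [|by apply: bmeasD => //; exact: bmeas_cst|exact: bmeasZ].
  rewrite bintegralD//; last exact: bmeas_cst.
  rewrite bintegralZ// bintegral_cst !laplaceE// !mul1r.
  have h2 := expdiff (v s 2) 2 (v_ge0 s0 l2).
  have h1 := expdiff 1 (v s 1) ler01.
  have k2 := H2 0 s (lexx 0) s0 s1; have k1 := H1 0 s (lexx 0) s0 s1.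
  rewrite !v_init// subr0 in k1 k2; rewrite distrC in h2.
  have e1 : expR (- 1) <= 1 :> R by rewrite -[leRHS]expR0 ler_expR oppr_le0.
  have e0 := expR_ge0 (- 1 : R).
  have -> : expR (- 2) = expR (- 1) * expR (- 1) :> R by rewrite -expRD; congr expR; ring.
  have E2 : expR (- 2) = expR (- 1) * expR (- 1) :> R by rewrite -expRD; congr expR; ring.
  have h3 : expR (- 1) * (expR (- 1) - expR (- v s 1)) <= K1 * s.
    apply: (@le_trans _ _ (expR (- 1) * (K1 * s))); first by rewrite ler_wpM2l//; lra.
    by rewrite ler_piMl// mulr_ge0.
  by rewrite E2 in h2; rewrite /K; lra.
apply: (@le_trans _ _ (\int[P 1]_w ((eta ^+ 2)^-1 * (expR (- 1) - expR (- (1 * X s w))) ^+ 2))).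
  apply: le_bintegral => [||w]; [by apply: bmeasB => //; exact: bmeas_cst|exact: bmeasZ|].
  rewrite mul1r mulrC ler_pdivlMr// /mid.
  case: (boolP (_ <= _ <= _)) => [_|]; first by rewrite subrr mul0r sqr_ge0.
  move=> nI; rewrite subr0 mul1r -[leRHS]ger0_norm ?sqr_ge0// normrX.
  rewrite lerXn2r ?nnegrE ?(ltW eta0)//; move: nI; rewrite negb_and -!ltNge => /orP[h|h].
    have : expR (- 2^-1) < expR (- X s w) by rewrite ltr_expR ltrN2.
    by rewrite ler_normr => h'; apply/orP; right; lra.
  have : expR (- X s w) < expR (- 2) by rewrite ltr_expR ltrN2.
  by rewrite ler_normr => h'; apply/orP; left; lra.
rewrite bintegralZ// mulrC ler_pdivrMr//; apply: (le_trans I2).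
move: st; rewrite ler_pdivlMr// => st.
have : s * 1 <= s * (2 * (K + 1)) by rewrite ler_wpM2l//; lra.
by lra.
Qed.

Lemma jump_ramp_le_ever (f : R -> R) a b r e : rcll f -> 0 <= a -> a < b ->
  0 <= r -> 0 < e -> jump_ramp f a b r e <= ever_jump_ind f a r.
Proof.
move=> cf a0 ab r0 e0; have /andP[_ j1] := jump_ramp_itv cf a0 ab r0 e0.
have [_ j0 _] := jump_rampP cf a0 ab r0 e0.
rewrite /ever_jump_ind; case: asboolP => // ne; rewrite j0// => -[s /andP[as_ _] js].
by apply: ne; exists s.
Qed.

(** Let u be the probability that some increment on [0, t0] exceeds [c]. At each step, with
    probability at least 1/2 - u, no earlier increment exceeds [c] and X lies in [1/2, 2]; from
    there the next one exceeds [c] with probability of order at least h kappa. Summing over the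
    steps gives u >= theta (1/2 - u), hence a lower bound independent of the mesh. *)
Lemma ever_jump_positive r : ~ bounded_set (measure_support nu) -> 0 <= r ->
  0 < \int[P 1]_w ever_jump_ind (X ^~ w) 0 r.
Proof.
(* The margin 1 is the width of the ramp that leads from grid increments above [c] to jumps above
   [r]. *)
move=> unb r0; pose c := r + 1.
have c0 : 0 <= c by rewrite addr_ge0.
have [t0 /andP[t00 t01] Hmid] := near_start.
have [p [p1 kappa0 pc]] := exp_poly_positive bm unb c0.
set kappa := generator _ _ _ _ in kappa0.
have [C C0 HC] := generator_estimate p.
(* The rate is X kappa >= kappa / 2 where X >= 1/2; half of it, kappa / 4, is left once the error C
   h^2 is absorbed, and the steps add up to the length t0. *)
pose theta := t0 * kappa / 4.
have theta0 : 0 < theta by rewrite !mulr_gt0// invr_gt0.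
pose u n := \int[P 1]_w (1 - below c (grid (X ^~ w) 0 (mesh 0 t0 n)) n.+1).
have step n : C * mesh 0 t0 n <= kappa / 4 -> theta * (2^-1 - u n) <= u n.
  move=> Ch; set h := mesh 0 t0 n in Ch *.
  have h0 : 0 < h by exact: mesh_gt0.
  have h0' := ltW h0.
  have nh : n.+1%:R * h = t0 by rewrite /h /mesh subr0 mulrC divfK// pnatr_eq0.
  have h1 : h <= 1.
    apply: le_trans t01; rewrite -nh -[leLHS]mul1r ler_wpM2r// ler1n//.
  have tk (k : nat) : 0 <= 0 + k%:R * h by rewrite add0r mulr_ge0.
  pose a k w := below c (grid (X ^~ w) 0 h) k.
  have ba k : @bmeas R _ (past (0 + k%:R * h)) (a k) by exact: past_below.
  have ba' k : bmeas (a k) by exact: (past_bmeas HX (tk k) (ba k)).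
  have bmid k : @bmeas R _ (past (0 + k%:R * h)) (fun w => mid (X (0 + k%:R * h) w)).
    apply: (@bmeas_boolr _ _ (past _)); apply: (@measurable_and _ (past _));
      apply: (@measurable_fun_ler _ (past _)) => //; exact: past_adapted.
  pose G k w := a k w * mid (X (0 + k%:R * h) w).
  have bG k : @bmeas R _ (past (0 + k%:R * h)) (G k) by exact: bmeasM.
  have bG' k : bmeas (G k) by exact: (past_bmeas HX (tk k) (bG k)).
  have bmid' k : bmeas (fun w => mid (X (0 + k%:R * h) w)).
    exact: (past_bmeas HX (tk k) (bmid k)).
  have mid01 z : 0 <= mid z <= 1 by rewrite /mid ler0n lern1 leq_b1.
  have G0 k w : 0 <= G k w by rewrite mulr_ge0 ?below_ge0//; case/andP: (mid01 (X (0 + k%:R * h) w)).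
  have sG k : supported_le2 (0 + k%:R * h) (G k).
    by move=> w h2; rewrite /G /mid [X in _ && X]leNgt h2 andbF mulr0.
  have bex k : bmeas (fun w => a k w *
      (c < grid (X ^~ w) 0 h k.+1 - grid (X ^~ w) 0 h k)%R%:R).
    exact: (past_bmeas HX (tk k.+1) (past_exceed X c k h0')).
  have am k w : (k <= n.+1)%N -> a n.+1 w <= a k w.
    move=> kn; rewrite -(subnK kn); elim: (n.+1 - k)%N => [|m IH]; first by rewrite add0n.
    apply: le_trans IH; rewrite addSn /a belowS ler_piMr ?below_ge0//.
    by rewrite lern1 leq_b1.
  have uE : u n = 1 - \int[P 1]_w a n.+1 w.
    by rewrite /u (bintegralB _ (bmeas_cst 1) (ba' n.+1)) bintegral_cst.
  have each (k : 'I_n.+1) : h * (kappa / 4) * (2^-1 - u n) <=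
      \int[P 1]_w (a k w * (c < grid (X ^~ w) 0 h k.+1 - grid (X ^~ w) 0 h k)%R%:R).
    set t := 0 + k%:R * h.
    have t0' : 0 <= t by exact: tk.
    have th : 0 + k.+1%:R * h = t + h by rewrite /t -natr1 mulrDl mul1r addrA.
    have tt0 : t <= t0.
      by rewrite /t add0r -nh ler_wpM2r// ler_nat ltnW.
    have hI : 0 <= h <= 1 by rewrite h0'.
    have est := HC 1 t h (G k) ler01 t0' hI (bG k) (sG k).
    rewrite p1 -/kappa in est.
    have bp := poly_increment_bmeas p t0' h0' (bG k) (sG k).
    have A1 : \int[P 1]_w (G k w * p.[expR (X t w - X (t + h) w)]) <=
        \int[P 1]_w (a k w * (c < grid (X ^~ w) 0 h k.+1 - grid (X ^~ w) 0 h k)%R%:R).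
      apply: le_bintegral => // w.
      apply: (@le_trans _ _ (G k w * (c < X (t + h) w - X t w)%R%:R)).
        rewrite ler_wpM2l//; apply: le_trans (pc _ (expR_ge0 _)) _.
        rewrite ltr_expR -opprB ltrN2; exact: lexx.
      rewrite /grid th; apply: ler_wpM2r; first exact: ler0n.
      by rewrite /G ler_piMr ?below_ge0//; case/andP: (mid01 (X (0 + k%:R * h) w)).
    have gE : \int[P 1]_w `|G k w| = \int[P 1]_w G k w.
      by apply: eq_Rintegral => w _; rewrite ger0_norm.
    rewrite gE in est.
    have bmn : bmeas (fun w => Num.min (X t w) 2).
      apply: (@bmeas_itv _ _ _ 0 2) => [|w].
        by apply: measurable_minr => //; exact: mX.
      by rewrite le_min X0//= ge_min lexx orbT ler0n.
    have A2 : h * kappa / 2 * \int[P 1]_w G k w <=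
        \int[P 1]_w (G k w * (0 + h * Num.min (X t w) 2 * kappa)).
      rewrite -bintegralZ//; apply: le_bintegral => [||w]; first exact: bmeasZ.
        apply: bmeasM => //; apply: bmeasD; first exact: bmeas_cst.
        by apply: bmeasM; [apply: bmeasM => //; exact: bmeas_cst|exact: bmeas_cst].
      rewrite mulrC add0r /G /mid -/t; case: (boolP (_ <= _ <= _)) => [|_]; last by rewrite mulr0 !mul0r.
      move=> /andP[m1 m2]; rewrite mulr1 ler_wpM2l ?below_ge0// min_l//.
      have m3 : 2^-1 * kappa <= X t w * kappa by rewrite ler_wpM2r// ltW.
      by have := ler_wpM2l h0' m3; lra.
    (* If none of the n + 1 increments exceeds [c], none of the first [k] does; moreover X lies in
       [1/2, 2] with probability at least 1/2 at every time up to t0. *)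
    have intG : 2^-1 - u n <= \int[P 1]_w G k w.
      have := Hmid t; rewrite t0' tt0 => /(_ isT) hm.
      have bm1 : bmeas (fun w => 1 - mid (X t w)) by exact: (bmeasB (bmeas_cst 1) (bmid' k)).
      have : \int[P 1]_w (a n.+1 w - (1 - mid (X t w))) <= \int[P 1]_w G k w.
        apply: le_bintegral => // [|w]; first exact: (bmeasB (ba' n.+1) bm1).
        have ha := am k w (ltnW (ltn_ord k)).
        have := below_le1 c (grid (X ^~ w) 0 h) k.
        have := below_ge0 c (grid (X ^~ w) 0 h) k.
        rewrite /G -/(a k w) -/t /mid; case: (_ <= _ <= _) => /=; rewrite ?mulr1 ?mulr0; lra.
      rewrite (bintegralB _ (ba' n.+1) bm1).
      by rewrite uE; lra.
    have G1 : 0 <= \int[P 1]_w G k w by apply: Rintegral_ge0 => w _.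
    apply: le_trans A1; move: est; rewrite ler_norml => /andP[est _].
    have hk : h * (kappa / 4) * (2^-1 - u n) <= h * (kappa / 4) * \int[P 1]_w G k w.
      by rewrite ler_wpM2l// mulr_ge0// divr_ge0// ltW.
    apply: (le_trans hk).
    have hC : C * h ^+ 2 * \int[P 1]_w G k w <= h * (kappa / 4) * \int[P 1]_w G k w.
      by rewrite ler_wpM2r// expr2 mulrA mulrC ler_wpM2l.
    have A2' : h * (kappa / 4) * \int[P 1]_w G k w + h * (kappa / 4) * \int[P 1]_w G k w =
        h * kappa / 2 * \int[P 1]_w G k w by field.
    lra.
  have uS : u n = \sum_(k < n.+1) \int[P 1]_w (a k w *
      (c < grid (X ^~ w) 0 h k.+1 - grid (X ^~ w) 0 h k)%R%:R).
    rewrite /u -(@bintegral_sum _ _ _ (P 1) (fun k w => a k w *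
      (c < grid (X ^~ w) 0 h k.+1 - grid (X ^~ w) 0 h k)%R%:R))//.
    by apply: eq_Rintegral => w _; rewrite below_telescope.
  rewrite [leRHS]uS; apply: le_trans (ler_sum _ (fun k _ => each k)).
  rewrite sumr_const card_ord -mulr_natl le_eqVlt; apply/orP; left; apply/eqP.
  by rewrite /theta -nh; field.
(* The solution u of theta (1/2 - u) = u. *)
pose b := theta / (2 * (1 + theta)).
have b0 : 0 < b by rewrite divr_gt0// mulr_gt0// addr_gt0.
have ub n : C * mesh 0 t0 n <= kappa / 4 -> b <= u n.
  move=> /step h; rewrite /b ler_pdivrMr ?mulr_gt0 ?addr_gt0//; lra.
have near_ub : \forall n \near \oo, b <= u n.
  have q0 : 0 < kappa / 4 / (C + 1) by rewrite !divr_gt0// ltr_wpDl.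
  apply: filterS (near_mesh_lt 0 t0 q0) => n hn; apply: ub.
  have m0 := mesh_gt0 n t00.
  apply: (@le_trans _ _ ((C + 1) * mesh 0 t0 n)); first by rewrite ler_wpM2r ?(ltW m0)// lerDl.
  rewrite mulrC -ler_pdivlMr ?ltr_wpDl//; exact: ltW.
have bjr : bmeas (fun w => jump_ramp (X ^~ w) 0 t0 r 1).
  exact: (bmeas_jump_ramp (Z := fun w => X ^~ w)).
have bev : bmeas (fun w => ever_jump_ind (X ^~ w) 0 r).
  exact: (bmeas_ever_jump (Z := fun w => X ^~ w)).
apply: (lt_le_trans b0); apply: (@le_trans _ _ (\int[P 1]_w jump_ramp (X ^~ w) 0 t0 r 1)); last first.
  by apply: le_bintegral => // w; exact: jump_ramp_le_ever.
have cvg1 := @jump_ramp_integral_cvg _ _ _ (P 1) (fun w => X ^~ w) rX mX (fun=> 1) 0 t0 r 1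
  (bmeas_cst 1) (lexx 0) t00 r0 ltr01.
under [leRHS]eq_Rintegral do rewrite -[jump_ramp _ _ _ _ _]mul1r.
have <- : lim ((\int[P 1]_w (1 * ramp r 1 (smax n.+1 (grid (X ^~ w) 0 (mesh 0 t0 n)))))
    @[n --> \oo]) = \int[P 1]_w (1 * jump_ramp (X ^~ w) 0 t0 r 1).
  by apply: cvg_lim => //; exact: Rhausdorff.
apply: limr_ge; first exact: cvgP cvg1.
apply: filterS near_ub => n h; apply: (le_trans h).
apply: le_bintegral => [||w].
- apply: bmeasB; first exact: bmeas_cst.
  have h0 : 0 <= mesh 0 t0 n by exact/ltW/mesh_gt0.
  have tk : 0 <= 0 + n.+1%:R * mesh 0 t0 n by rewrite add0r mulr_ge0.
  exact: (past_bmeas HX tk (past_below X c n.+1 h0)).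
- by apply: bmeasM; [exact: bmeas_cst|exact: (bmeas_ramp_grid (Z := fun w => X ^~ w))].
- by rewrite mul1r below_le_ramp.
Qed.

End cb_positivity.

(** * The limit of the conditional expectation *)

Lemma cvg_pinfty_bound {R : realType} (f : R -> R) (l K M : R) :
  (forall r, M < r -> `|f r - l| <= K / r) -> f r @[r --> +oo] --> l.
Proof.
move=> H; apply/cvgrPdist_le => e e0.
near=> r.
have r0 : 0 < r by near: r; apply: nbhs_pinfty_gt; exact: num_real.
have rM : M < r by near: r; apply: nbhs_pinfty_gt; exact: num_real.
have rK : K / e < r by near: r; apply: nbhs_pinfty_gt; exact: num_real.
by rewrite distrC (le_trans (H r rM))// ler_pdivrMr// mulrC -ler_pdivrMr// ltW.
Unshelve. all: by end_near. Qed.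

Lemma expRN_sub1 {R : realType} (s : R) : 0 <= s -> `|1 - expR (- s) - s| <= s ^+ 2.
Proof.
move=> s0; have h1 := expR_ge1Dx (- s); have e0 := expR_gt0 (- s).
have h2 : expR (- s) * (1 + s) <= 1.
  have := expR_ge1Dx s => h3.
  have : expR (- s) * (1 + s) <= expR (- s) * expR s by rewrite ler_pM2l.
  by rewrite -expRD addNr expR0.
have h4 : s * (1 - s) <= s * expR (- s) by rewrite ler_wpM2l//; lra.
rewrite expr2 ler_norml; apply/andP; split; lra.
Qed.

Section cb_asymptotics.
Context {R : realType} {d} {T : measurableType d}.
Variables (Phi : R -> R) (X : R -> T -> R) (P : R -> probability T R).
Hypothesis HX : cb_process Phi X P.
Variable v : R -> R -> R.
Hypothesis v_ge0 : forall t lambda : R, 0 <= t -> 0 <= lambda -> 0 <= v t lambda.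
Hypothesis v_le : forall t lambda : R, 0 <= t -> 0 <= lambda -> v t lambda <= lambda.
Hypothesis laplaceE : forall x t lambda : R, 0 <= x -> 0 <= t -> 0 <= lambda ->
  \int[P x]_w expR (- (lambda * X t w)) = expR (- (x * v t lambda)).

Let X0 t w : 0 <= t -> 0 <= X t w. Proof. exact: (cb_ge0 HX). Qed.
Let mX t : 0 <= t -> measurable_fun setT (X t). Proof. exact: (X_measurable HX). Qed.
Let rX w : rcll (X ^~ w). Proof. exact: (cb_rcll HX). Qed.

Lemma bmeas_ever a r : 0 <= a -> 0 <= r -> bmeas (fun w => ever_jump_ind (X ^~ w) a r).
Proof. by move=> a0 r0; exact: (bmeas_ever_jump (Z := fun w => X ^~ w)). Qed.

Lemma below_bmeas c N n : 0 < N ->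
  bmeas (fun w => below c (grid (X ^~ w) 0 (mesh 0 N n)) n.+1).
Proof.
move=> N0; have h0 : 0 <= mesh 0 N n by exact/ltW/mesh_gt0.
have tk : 0 <= 0 + n.+1%:R * mesh 0 N n by rewrite add0r mulr_ge0.
exact: (past_bmeas HX tk (past_below X c n.+1 h0)).
Qed.

Lemma jump_ramp_integral_le (W : T -> R) (B : R) x N r e : bmeas W -> 0 < N -> 0 <= r -> 0 < e ->
  (forall n, \int[P x]_w (W w * ramp r e (smax n.+1 (grid (X ^~ w) 0 (mesh 0 N n)))) <= B) ->
  \int[P x]_w (W w * jump_ramp (X ^~ w) 0 N r e) <= B.
Proof.
move=> bW N0 r0 e0 H.
have h := @jump_ramp_integral_cvg _ _ _ (P x) (fun w => X ^~ w) rX mX W 0 N r e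
  bW (lexx 0) N0 r0 e0.
have <- : lim ((\int[P x]_w (W w * ramp r e (smax n.+1 (grid (X ^~ w) 0 (mesh 0 N n)))))
    @[n --> \oo]) = \int[P x]_w (W w * jump_ramp (X ^~ w) 0 N r e).
  by apply: cvg_lim => //; exact: Rhausdorff.
by apply: limr_le; [exact: cvgP h|exact: nearW].
Qed.

(** The maximal inequality is used at lambda = 1 / r, for which lambda r = 1 and 1 - e^{- x / r} <=
    x / r; the bound depends neither on the horizon nor on the mesh. *)
Lemma ever_jump_small x r : 0 <= x -> 0 < r ->
  \int[P x]_w ever_jump_ind (X ^~ w) 0 r <= x / (1 - expR (- 1)) / r.
Proof.
move=> x0 r0; have r0' := ltW r0; set B := x / _ / r.
have e1 : expR (- 1) < 1 :> R by rewrite -[ltRHS]expR0 ltr_expR ltrN10.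
have E1 N e n : 0 < N -> 0 < e ->
    \int[P x]_w (1 * ramp r e (smax n.+1 (grid (X ^~ w) 0 (mesh 0 N n)))) <= B.
  move=> N0 e0; have h0 : 0 <= mesh 0 N n by exact/ltW/mesh_gt0.
  have ri0 : 0 <= r^-1 by rewrite invr_ge0.
  have := maximal_inequality HX v_ge0 laplaceE v_le n.+1 x0 h0 ri0 r0'.
  rewrite mulVf ?gt_eqF// => h.
  apply: (@le_trans _ _ (\int[P x]_w (1 - below r (grid (X ^~ w) 0 (mesh 0 N n)) n.+1))).
    apply: le_bintegral => [||w].
    - by apply: bmeasM; [exact: bmeas_cst|exact: (bmeas_ramp_grid (Z := fun w => X ^~ w))].
    - by apply: bmeasB; [exact: bmeas_cst|exact: below_bmeas].
    - by rewrite mul1r; exact: ramp_le_below.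
  rewrite /B mulrAC ler_pdivlMr ?subr_gt0// mulrC; apply: (le_trans h).
  by have := expR_ge1Dx (- (x / r)); lra.
have h := @ever_jump_integral_cvg _ _ _ (P x) (fun w => X ^~ w) rX mX (fun=> 1) 0 r
  (bmeas_cst 1) (lexx 0) r0'.
under eq_Rintegral do rewrite -[ever_jump_ind _ _ _]mul1r.
have <- : lim ((\int[P x]_w (1 * jump_ramp (X ^~ w) 0 (0 + m.+1%:R) r m.+1%:R^-1))
    @[m --> \oo]) = \int[P x]_w (1 * ever_jump_ind (X ^~ w) 0 r).
  by apply: cvg_lim => //; exact: Rhausdorff.
apply: limr_le; first exact: cvgP h.
apply: nearW => m; have m0 : 0 < m.+1%:R^-1 :> R by rewrite invr_gt0.
have N0 : 0 < 0 + m.+1%:R :> R by rewrite add0r ltr0n.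
by apply: jump_ramp_integral_le => // [|n]; [exact: bmeas_cst|exact: E1].
Qed.

(** [early_exceed] is uniform in the mesh, so it survives the limit; a path with a large jump after
    0 but none after [t] has one in ]0, t]. *)
Lemma early_jump_bound x t lambda kappa r : 0 <= x -> 0 <= t -> 0 <= lambda ->
  0 <= kappa -> 0 <= r -> (forall s, 0 <= s <= t -> kappa <= v s lambda) ->
  \int[P x]_w (expR (- (lambda * X t w)) *
    (ever_jump_ind (X ^~ w) 0 r - ever_jump_ind (X ^~ w) t r)) <=
  expR (- (kappa * r)) * \int[P x]_w ever_jump_ind (X ^~ w) 0 r.
Proof.
move=> x0 t0 l0 k0 r0 Hk; have g0 : 0 <= \int[P x]_w ever_jump_ind (X ^~ w) 0 r.
  by apply: Rintegral_ge0 => w _; case/andP: (ever_jump_ind_itv (X ^~ w) 0 r).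
have [t0'|tpos] := leP t 0.
  have -> : t = 0 by apply/eqP; rewrite eq_le t0' t0.
  under eq_Rintegral do rewrite subrr mulr0.
  by rewrite bintegral_cst mulr_ge0// expR_ge0.
set W := fun w => expR (- (lambda * X t w)).
have bW : bmeas W by exact: (bmeas_expX HX).
have W01 w : 0 <= W w <= 1.
  by rewrite /W expR_ge0 -[leRHS]expR0 ler_expR oppr_le0 mulr_ge0// X0.
have m0 m : 0 < m.+1%:R^-1 :> R by rewrite invr_gt0.
(* The level is shifted by the ramp width: the indicator that some increment exceeds c_m then lies
   above the ramp starting at c_m and below the one starting at [r], so [early_exceed] can be read
   between two ramps. *)
pose c m := r + m.+1%:R^-1.
have c0 m : 0 <= c m by rewrite addr_ge0// ltW.
pose D m w := jump_ramp (X ^~ w) 0 t (c m) m.+1%:R^-1.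
have bD m : bmeas (D m) by exact: (bmeas_jump_ramp (Z := fun w => X ^~ w)).
have ID m : \int[P x]_w (W w * D m w) <=
    expR (- (kappa * r)) * \int[P x]_w ever_jump_ind (X ^~ w) 0 r.
  apply: (@le_trans _ _ (expR (- (kappa * r)) *
      \int[P x]_w jump_ramp (X ^~ w) 0 t r m.+1%:R^-1)); last first.
    rewrite ler_wpM2l ?expR_ge0//; apply: le_bintegral => //.
    - exact: (bmeas_jump_ramp (Z := fun w => X ^~ w)).
    - exact: bmeas_ever.
    - by move=> w; exact: jump_ramp_le_ever.
  have h1 := @jump_ramp_integral_cvg _ _ _ (P x) (fun w => X ^~ w) rX mX W 0 t (c m)
    m.+1%:R^-1 bW (lexx 0) tpos (c0 m) (m0 m).
  have h2 := @jump_ramp_integral_cvg _ _ _ (P x) (fun w => X ^~ w) rX mX (fun=> 1) 0 t r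
    m.+1%:R^-1 (bmeas_cst 1) (lexx 0) tpos r0 (m0 m).
  have h3 : expR (- (kappa * r)) * \int[P x]_w (1 * ramp r m.+1%:R^-1 (smax n.+1
      (grid (X ^~ w) 0 (mesh 0 t n)))) @[n --> \oo] -->
      expR (- (kappa * r)) * \int[P x]_w (1 * jump_ramp (X ^~ w) 0 t r m.+1%:R^-1).
    exact: cvgMr.
  under [in leRHS]eq_Rintegral do rewrite -[jump_ramp _ _ _ _ _]mul1r.
  rewrite -subr_ge0.
  pose u n := expR (- (kappa * r)) * \int[P x]_w (1 * ramp r m.+1%:R^-1 (smax n.+1
      (grid (X ^~ w) 0 (mesh 0 t n)))) - \int[P x]_w (W w * ramp (c m) m.+1%:R^-1 (smax n.+1
      (grid (X ^~ w) 0 (mesh 0 t n)))).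
  have h4 : u n @[n --> \oo] --> expR (- (kappa * r)) *
      \int[P x]_w (1 * jump_ramp (X ^~ w) 0 t r m.+1%:R^-1) - \int[P x]_w (W w * D m w).
    exact: (cvgB h3 h1).
  rewrite -(cvg_lim _ h4); last exact: Rhausdorff.
  apply: limr_ge; first exact: cvgP h4.
  apply: nearW => n; rewrite subr_ge0.
  have bb := below_bmeas (c m) n tpos.
  have b1b : bmeas (fun w => 1 - below (c m) (grid (X ^~ w) 0 (mesh 0 t n)) n.+1).
    by apply: bmeasB => //; exact: bmeas_cst.
  have br r' e : 0 < e -> bmeas (fun w => ramp r' e (smax n.+1 (grid (X ^~ w) 0 (mesh 0 t n)))).
    by move=> e0; exact: (bmeas_ramp_grid (Z := fun w => X ^~ w)).
  apply: (@le_trans _ _ (\int[P x]_w (W w * (1 - below (c m) (grid (X ^~ w) 0 (mesh 0 t n)) n.+1)))).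
    apply: le_bintegral => [||w]; [by apply: bmeasM => //; exact: br|exact: bmeasM|].
    by rewrite ler_wpM2l//; [case/andP: (W01 w)|exact: ramp_le_below].
  have h5 := early_exceed HX v_ge0 laplaceE n x0 tpos l0 (c0 m) k0 Hk.
  apply: (le_trans h5); apply: ler_pM; rewrite ?expR_ge0//.
  - by apply: Rintegral_ge0 => w _; rewrite subr_ge0 below_le1.
  - by rewrite ler_expR lerN2 ler_wpM2l// lerDl ltW.
  - apply: le_bintegral => // [|w].
      by apply: bmeasM; [exact: bmeas_cst|exact: br].
    by rewrite mul1r; exact: below_le_ramp.
pose j w : R := if `[< has_jump (X ^~ w) 0 t r >] then 1 else 0.
have Dj w : D m w @[m --> \oo] --> j w.
  rewrite /j; case: asboolP => [[s sI js]|nj]; last first.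
    apply: (@cvg_near_cst _ _ _ _ _ (@eventually_filter)); apply: nearW => m.
    have [_ h _] := jump_rampP (rX w) (lexx 0) tpos (c0 m) (m0 m); apply: h => hj.
    by apply: nj; apply: has_jump_le hj; rewrite /c lerDl ltW.
  apply: (@cvg_near_cst _ _ _ _ _ (@eventually_filter)).
  have d0 : 0 < (jump (X ^~ w) s - r) / 2 by rewrite divr_gt0// subr_gt0.
  have /cvgrPdist_lt/(_ _ d0) := @cvg_harmonic R; apply: filterS => m.
  rewrite sub0r normrN => /(le_lt_trans (ler_norm _)) hm.
  have [_ _ h] := jump_rampP (rX w) (lexx 0) tpos (c0 m) (m0 m); apply: h.
  have {}hm : m.+1%:R^-1 < (jump (X ^~ w) s - r) / 2 := hm.
  by exists s => //; rewrite /c; move: hm; move: (m.+1%:R^-1 : R) => z hm; lra.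
have j01 w : 0 <= j w <= 1 by rewrite /j; case: ifP; rewrite ?lexx ?ler01.
have bj : bmeas j.
  apply: (@bmeas_itv _ _ _ 0 1) => //.
  by apply: (measurable_fun_cvg (h := D)) => // m; have [] := bD m.
have cD : \int[P x]_w (W w * D m w) @[m --> \oo] --> \int[P x]_w (W w * j w).
  apply: (bintegral_cvg (M := 1 * 1)) => [m|m w||w]; [exact: bmeasM| |exact: bmeasM|].
    have /andP[d1 d2] := jump_ramp_itv (rX w) (lexx 0) tpos (c0 m) (m0 m).
    have /andP[w1 w2] := W01 w.
    by rewrite normrM !ger0_norm// ler_pM.
  by apply: cvgMr; exact: Dj.
apply: (@le_trans _ _ (\int[P x]_w (W w * j w))); last first.
  have <- : lim (\int[P x]_w (W w * D m w) @[m --> \oo]) = \int[P x]_w (W w * j w).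
    by apply: cvg_lim => //; exact: Rhausdorff.
  by apply: limr_le; [exact: cvgP cD|apply: nearW].
apply: le_bintegral => [||w]; [|exact: bmeasM|].
  by apply: bmeasM => //; apply: bmeasB; exact: bmeas_ever.
rewrite ler_wpM2l//.
have /andP[j0 j1] := j01 w.
rewrite /ever_jump_ind; case: asboolP => h0; case: asboolP => ht; rewrite ?subrr ?subr0 ?sub0r//.
- suff : has_jump (X ^~ w) 0 t r by rewrite /j => /asboolP ->.
  have [s s0 js] := h0; have [st|ts] := leP s t; last by case: ht; exists s.
  by exists s => //; rewrite s0.
- by rewrite (le_trans _ j0)// oppr_le0.
Qed.

End cb_asymptotics.

(** It is applied with w = c_r: [g] is the probability of the conditioning event, [N] the numerator,
    [A] its part due to the jumps after [t], and [e] the relative bound for the earlier ones. The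
    condition w x <= 1/2 gives g >= w x / 2. *)
Lemma ratio_bound {R : realType} (N A a g x w C e : R) : 0 < x -> 0 < w -> w * x <= 2^-1 ->
  `|g - w * x| <= (w * x) ^+ 2 -> `|A - w * a| <= C * w ^+ 2 -> `|N - A| <= e * g ->
  `|N / g - a / x| <= e + 2 * (C / x + `|a|) * w.
Proof.
move=> x0 w0 wx hg hA hN; have wx0 : 0 < w * x by rewrite mulr_gt0.
have gl : w * x / 2 <= g.
  have h1 : (w * x) ^+ 2 <= w * x / 2 by rewrite expr2 ler_wpM2l// ltW.
  by move: hg; rewrite ler_distl => /andP[? _]; lra.
have g0 : 0 < g by apply: lt_le_trans gl; rewrite divr_gt0.
have gx0 : 0 < g * x by rewrite mulr_gt0.
have -> : N / g - a / x = (N - A) / g + ((A - w * a) * x - a * (g - w * x)) / (g * x).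
  by field; rewrite !gt_eqF.
apply: (le_trans (ler_normD _ _)); apply: lerD.
  by rewrite normrM normfV (gtr0_norm g0) ler_pdivrMr.
rewrite normrM normfV (gtr0_norm gx0) ler_pdivrMr//.
apply: (@le_trans _ _ (C * w ^+ 2 * x + `|a| * (w * x) ^+ 2)).
  apply: (le_trans (ler_normB _ _)); rewrite !normrM (gtr0_norm x0).
  by apply: lerD; [rewrite ler_pM2r|rewrite ler_wpM2l].
have C0 : 0 <= C.
  have : 0 <= C * w ^+ 2 by apply: le_trans hA; exact: normr_ge0.
  by rewrite pmulr_lge0// exprn_gt0.
have -> : C * w ^+ 2 * x + `|a| * (w * x) ^+ 2 =
    2 * (C / x + `|a|) * w * (w * x / 2 * x).
  by field; rewrite gt_eqF.
rewrite ler_wpM2l//; last by rewrite ler_pM2r.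
by rewrite !mulr_ge0// ?(ltW w0)// addr_ge0// divr_ge0// ltW.
Qed.

Section cb_large_jump.
Context {R : realType} {d} {T : measurableType d}.
Variables (alpha beta : R) (nu : {measure set R -> \bar R}).
Hypothesis bm : branching_mechanism alpha beta nu.
Notation Phi := (branching_function alpha beta nu).
Variables (X : R -> T -> R) (P : R -> probability T R).
Hypothesis HX : cb_process Phi X P.
Variable v : R -> R -> R.
Hypothesis cv : forall lambda : R, 0 <= lambda -> cumulant_solution Phi lambda (v ^~ lambda).
Hypothesis laplaceE : forall x t lambda : R, 0 <= x -> 0 <= t -> 0 <= lambda ->
  \int[P x]_w expR (- (lambda * X t w)) = expR (- (x * v t lambda)).
Hypothesis alpha_gt0 : 0 < alpha.
Hypothesis nu_unbounded : ~ bounded_set (measure_support nu).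

Notation past t := (g_sigma_algebraType (history X t)).

Let v_ge0 := v_ge0 cv.
Let v_init := v_init cv.
Let v_lip := v_lip bm cv.

Let v_le (t lambda : R) : 0 <= t -> 0 <= lambda -> v t lambda <= lambda.
Proof.
move=> t0 l0; apply: (cumulant_le_init (cv l0)) => // z z0.
exact: (branching_function_ge0 bm (ltW alpha_gt0)).
Qed.

Let X0 t w : 0 <= t -> 0 <= X t w. Proof. exact: (cb_ge0 HX). Qed.
Let mX t : 0 <= t -> measurable_fun setT (X t). Proof. exact: (X_measurable HX). Qed.

Let bmeas_ever := bmeas_ever HX.

(** The constant makes g = g_r(1) at most 1/2, so that 1 - g is positive and c = - ln (1 - g)
    satisfies c (1 - g) <= g, hence c <= 2 g. *)
Lemma ever_jump_exp : exists2 K : R, 0 < K & forall r, K <= r ->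
  exists2 c : R, 0 < c <= K / r &
    forall y, 0 <= y -> \int[P y]_w ever_jump_ind (X ^~ w) 0 r = 1 - expR (- (c * y)).
Proof.
have e1 : 0 < 1 - expR (- 1) :> R by rewrite subr_gt0 -[ltRHS]expR0 ltr_expR ltrN10.
exists (2 / (1 - expR (- 1))); first by rewrite divr_gt0.
move=> r Kr; have r0 : 0 < r by apply: lt_le_trans Kr; rewrite divr_gt0.
have g1 := ever_jump_positive bm HX cv laplaceE nu_unbounded (ltW r0).
have := ever_jump_small HX v_ge0 v_le laplaceE ler01 r0.
have E := multiplicative_exp (f := no_jump_prob X P r)
  (fun x y x0 y0 => no_jump_mul HX v_ge0 v_init v_lip laplaceE x0 y0 (ltW r0))
  (fun y _ => no_jump_itv HX y (ltW r0)).
move: E g1; rewrite {1}/no_jump_prob.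
set g := \int[P 1]_w _ => E g1 g2.
have g3 : g <= 2^-1.
  apply: (le_trans g2); rewrite ler_pdivrMr// mul1r -(ler_pM2l (_ : 0 < 2 :> R))//.
  by rewrite mulrA mulfV ?mul1r.
have phi0 : 0 < 1 - g by lra.
have lnphi : expR (ln (1 - g)) = 1 - g by rewrite lnK.
exists (- ln (1 - g)).
  apply/andP; split.
    by rewrite oppr_gt0 -ltr_expR lnphi expR0; lra.
  have := expR_ge1Dx (- ln (1 - g)); rewrite expRN lnphi.
  rewrite -(ler_pM2r phi0) mulVf ?gt_eqF//; set c := - ln _ => h.
  have c0 : 0 <= c by rewrite /c oppr_ge0 -ler_expR lnphi expR0; lra.
  have h1 : c * 2^-1 <= c * (1 - g) by rewrite ler_wpM2l//; lra.
  have -> : 2 / (1 - expR (- 1)) / r = 2 * (1 / (1 - expR (- 1)) / r) by rewrite !mulrA mulr1.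
  by lra.
move=> y y0; have := E phi0 y y0; rewrite /no_jump_prob => h.
by rewrite mulNr opprK [_ * y]mulrC -h; lra.
Qed.

Lemma large_jump_limit x t lambda (F : T -> R) : 0 < x -> 0 <= t -> 0 < lambda ->
  @bmeas R _ (past t) F ->
  (\int[P x]_w (F w * expR (- (lambda * X t w)) * ever_jump_ind (X ^~ w) 0 r)) /
    \int[P x]_w ever_jump_ind (X ^~ w) 0 r @[r --> +oo] -->
  (\int[P x]_w (X t w * F w * expR (- (lambda * X t w)))) / x.
Proof.
move=> x0 t0 l0 bF; have [mF [M HM]] := bF.
have bF' := past_bmeas HX t0 bF.
have M0 : 0 <= M by apply: le_trans (HM point); exact: normr_ge0.
have [K K0 HK] := ever_jump_exp.
have [kappa k0 Hk] := cumulant_bounded_below (branching_function_lipschitz bm)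
  (branching_function0 _ _ _) (cv (ltW l0)) t0 l0.
set a := \int[P x]_w (X t w * F w * _).
(* From (c X)^2 e^{- lambda X} <= 4 c^2 / lambda^2, which is [expR_ge_sqr] at lambda X; [M] bounds
   [F]. *)
pose C := M * (4 / lambda ^+ 2).
(* The thresholds give c_r <= K / r and c_r x <= 1/2; the term M / kappa comes from e^{- kappa r} <=
   1 / (kappa r). *)
apply: (@cvg_pinfty_bound _ _ _ (M / kappa + 2 * (C / x + `|a|) * K)
  (Num.max K (2 * (K * x)))) => r.
rewrite gt_max => /andP[Kr Kxr]; have r0 : 0 < r by exact: lt_trans Kr.
have [c /andP[c0 cK] Hc] := HK r (ltW Kr).
set e := expR (- (kappa * r)).
have er : e <= (kappa * r)^-1.
  rewrite /e expRN lef_pV2 ?posrE ?expR_gt0 ?mulr_gt0//.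
  by have := expR_ge1Dx (kappa * r); lra.
have bE := bmeas_expX HX (ltW l0) t0.
have bG : @bmeas R _ (past t) (fun w => F w * expR (- (lambda * X t w))).
  by apply: bmeasM => //; exact: (past_bmeas_exp HX (ltW l0) t0).
have bG' := past_bmeas HX t0 bG.
have W0 w : 0 <= expR (- (lambda * X t w)) by exact: expR_ge0.
have bc := bmeas_expX HX (ltW c0) t0.
have bXG : bmeas (fun w => X t w * F w * expR (- (lambda * X t w))).
  split.
    apply: measurable_funM; last by have [] := bE.
    by apply: measurable_funM; [exact: mX|have [] := bF'].
  exists (M / lambda) => w; rewrite mulrAC mulrC normrM ler_pM//.
  rewrite ger0_norm ?mulr_ge0// ?X0// expRN ler_pdivrMr ?expR_gt0//.
  rewrite mulrC ler_pdivlMr// mulrC.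
  by have := expR_ge1Dx (lambda * X t w); lra.
apply: (@le_trans _ _ (M * e + 2 * (C / x + `|a|) * c)); last first.
  rewrite [leRHS]mulrDl; apply: lerD.
    by rewrite -mulrA -invfM ler_wpM2l.
  rewrite -[leRHS]mulrA ler_wpM2l// mulr_ge0// addr_ge0// divr_ge0 ?(ltW x0)//.
  by rewrite /C mulr_ge0// divr_ge0// sqr_ge0.
apply: (@ratio_bound _ _ (\int[P x]_w (F w * expR (- (lambda * X t w)) *
  (1 - expR (- (c * X t w)))))) => //.
- apply: (@le_trans _ _ (K / r * x)); first by rewrite ler_wpM2r// ltW.
  rewrite mulrAC ler_pdivrMr//; lra.
- rewrite Hc ?(ltW x0)//; have := @expRN_sub1 _ (c * x); apply.
  by rewrite mulr_ge0// ltW.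
- have b1 : bmeas (fun w => F w * expR (- (lambda * X t w)) * (1 - expR (- (c * X t w)))).
    by apply: bmeasM => //; apply: bmeasB => //; exact: bmeas_cst.
  rewrite -bintegralZ// -bintegralB//; last exact: bmeasZ.
  apply: bintegral_bound; first by apply: bmeasB => //; exact: bmeasZ.
  move=> w.
  have -> : F w * expR (- (lambda * X t w)) * (1 - expR (- (c * X t w))) -
      c * (X t w * F w * expR (- (lambda * X t w))) =
      F w * (expR (- (lambda * X t w)) * (1 - expR (- (c * X t w)) - c * X t w)) by ring.
  rewrite normrM /C -mulrA ler_pM// normrM (ger0_norm (W0 w)).
  have cX : 0 <= c * X t w by rewrite mulr_ge0 ?X0// ltW.
  apply: (le_trans (ler_wpM2l (W0 w) (expRN_sub1 cX))).
  have lX : 0 <= lambda * X t w by rewrite mulr_ge0 ?X0// ltW.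
  have := expR_ge_sqr lX => h.
  rewrite expRN exprMn mulrCA [leRHS]mulrC ler_wpM2l ?sqr_ge0//.
  rewrite mulrC ler_pdivrMr ?expR_gt0// mulrAC ler_pdivlMr ?exprn_gt0//.
  by move: h; rewrite exprMn => h; lra.
- have bev0 := bmeas_ever (lexx 0) (ltW r0); have bevt := bmeas_ever t0 (ltW r0).
  have -> : \int[P x]_w (F w * expR (- (lambda * X t w)) * (1 - expR (- (c * X t w)))) =
      \int[P x]_w (F w * expR (- (lambda * X t w)) * ever_jump_ind (X ^~ w) t r).
    rewrite (ever_jump_markov HX (ltW x0) t0 (ltW r0) bG).
    by apply: eq_Rintegral => w _; rewrite Hc ?X0.
  rewrite -bintegralB; [|exact: bmeasM|exact: bmeasM].
  have bd : bmeas (fun w => ever_jump_ind (X ^~ w) 0 r - ever_jump_ind (X ^~ w) t r).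
    exact: bmeasB.
  apply: (@le_trans _ _ (M * \int[P x]_w (expR (- (lambda * X t w)) *
      (ever_jump_ind (X ^~ w) 0 r - ever_jump_ind (X ^~ w) t r)))); last first.
    rewrite -mulrA ler_wpM2l//.
    exact: (early_jump_bound HX v_ge0 laplaceE (ltW x0) t0 (ltW l0) (ltW k0) (ltW r0) Hk).
  rewrite -bintegralZ; last exact: bmeasM.
  under eq_Rintegral do rewrite -mulrBr -mulrA.
  have bH : bmeas (fun w => F w * (expR (- (lambda * X t w)) *
      (ever_jump_ind (X ^~ w) 0 r - ever_jump_ind (X ^~ w) t r))).
    by apply: bmeasM => //; exact: bmeasM.
  have bB : bmeas (fun w => M * (expR (- (lambda * X t w)) *
      (ever_jump_ind (X ^~ w) 0 r - ever_jump_ind (X ^~ w) t r))).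
    by apply: bmeasZ; exact: bmeasM.
  have H w : `|F w * (expR (- (lambda * X t w)) *
      (ever_jump_ind (X ^~ w) 0 r - ever_jump_ind (X ^~ w) t r))| <=
      M * (expR (- (lambda * X t w)) *
      (ever_jump_ind (X ^~ w) 0 r - ever_jump_ind (X ^~ w) t r)).
    have h : ever_jump_ind (X ^~ w) t r <= ever_jump_ind (X ^~ w) 0 r.
      rewrite /ever_jump_ind; case: asboolP => [[s ts js]|_]; case: asboolP => //.
      by case; exists s => //; exact: le_lt_trans ts.
    rewrite normrM ler_pM// ger0_norm// mulr_ge0// subr_ge0.
    exact: h.
  rewrite ler_norml; apply/andP; split.
    rewrite lerNl -mulN1r -bintegralZ//; apply: le_bintegral => [||w] //.
      exact: bmeasZ.
    by rewrite mulN1r lerNl; have := H w; rewrite ler_norml => /andP[].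
  by apply: le_bintegral => [||w] //; exact: le_trans (ler_norm _) (H w).
Qed.

End cb_large_jump.

Lemma sup_jump_gt {R : realType} (f : R -> R) (r : R) :
  (r%:E < sup_jump f)%E <-> ever_jump f 0 r.
Proof.
split => [/ereal_sup_gt[_ [s s0 <-]]|[s s0 js]].
  by rewrite lte_fin => js; exists s => //; move: s0; rewrite /= in_itv/= andbT.
apply: (@lt_le_trans _ _ (jump f s)%:E); first by rewrite lte_fin.
by apply: ereal_sup_ubound; exists s => //=; rewrite in_itv/= s0.
Qed.

Lemma expectation_bintegral {R : realType} d (T : measurableType d) (P : probability T R)
    (Y : T -> R) : fine 'E_P[Y]%E = \int[P]_w Y w.
Proof. by rewrite unlock. Qed.
Theorem theorem4p4 (R : realType) (alpha beta : R)
    (nu : {measure set R -> \bar R})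
    (Hbm : branching_mechanism alpha beta nu)
    (d : measure_display) (T : measurableType d)
    (X : R -> T -> R) (P : R -> probability T R)
    (HX : cb_process (branching_function alpha beta nu) X P)
    (x : R) (Hx : 0 < x) (Halpha : 0 < alpha)
    (Hpi : ~ bounded_set (measure_support nu))
    (t : R) (Ht : 0 <= t)
    (F : T -> R)
    (HFm : measurable_fun [set: g_sigma_algebraType (history X t)] F)
    (HFb : bounded_fun F)
    (lambda : R) (Hlambda : 0 < lambda) :
  expectation_given (P x) (fun w => F w * expR (- (lambda * X t w)))
    [set w | (r%:E < sup_jump (X ^~ w))%E] @[r --> +oo]
  --> x^-1 * fine 'E_(P x)[fun w => (X t w * F w * expR (- (lambda * X t w)))%R]%E.
Proof.
have [v cv lapl] := cb_laplace HX.
have laplaceE (y s l : R) : 0 <= y -> 0 <= s -> 0 <= l ->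
    \int[P y]_w expR (- (l * X s w)) = expR (- (y * v s l)).
  by move=> y0 s0 l0; rewrite -expectation_bintegral lapl.
have bF : @bmeas R _ (g_sigma_algebraType (history X t)) F.
  split => //; have [M [_ HM]] := HFb; exists (M + 1) => w.
  by apply: HM => //; rewrite ltrDl.
have := large_jump_limit Hbm HX cv laplaceE Halpha Hpi Hx Ht Hlambda bF.
rewrite mulrC expectation_bintegral; apply: cvg_trans; apply: near_eq_cvg.
near=> r; have r0 : 0 <= r by near: r; apply: nbhs_pinfty_ge; exact: num_real.
have mX s : 0 <= s -> measurable_fun setT (X s) by exact: (X_measurable HX).
have [me _] := bmeas_ever_jump (Z := fun w => X ^~ w) (cb_rcll HX) mX (lexx 0) r0.
set A := [set w | _].
have EA : (fun w => ever_jump_ind (X ^~ w) 0 r) = \1_A.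
  apply/funext => w; rewrite /ever_jump_ind indicE /A; case: asboolP => [h|nh].
    by rewrite mem_set//; exact/sup_jump_gt.
  by rewrite memNset// => /sup_jump_gt.
(* The supremum runs over uncountably many times; measurability of the event is read off from its
   indicator, a limit of functions of grids. *)
have mA : measurable A by move: me; rewrite EA => /measurable_indicP.
rewrite /expectation_given expectation_bintegral -bintegral_indic//.
by congr (_ / _); rewrite -?EA //; apply: eq_Rintegral => w _ /=; rewrite -EA.
Unshelve. all: by end_near. Qed.
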